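(* For every real $\beta\ge-1$, every $n\in\mathbb N=\{1,2,\ldots\}$ and every $k\in\{1,\ldots,n\}$, $$\mathbb J_{n,k}(\beta)=\sum_{\ell=0}^{n-k}(-1)^\ell\sum_{n=n_0>n_1>\ldots>n_\ell\ge k}\mathbb I_{n,n_1}(2\beta+n-1)\,\mathbb I_{n_1,n_2}(2\beta+n-1)\cdots\mathbb I_{n_{\ell-1},n_\ell}(2\beta+n-1)\binom{n_\ell}{k},$$ where the second sum is over all integer tuples $(n_0,n_1,\ldots,n_\ell)$ with $n=n_0>n_1>\ldots>n_\ell\ge k$ (for $\ell=0$ the product of $\mathbb I$'s is empty and the term is $\binom nk$).
   Context: Angles. For a polyhedral cone $C$, its solid angle is $\alpha(C)=\mathbb P[U\in C]$, where $U$ is uniformly distributed on the unit sphere of the smallest linear subspace containing $C$. For a polytope $P\subset\mathbb R^d$ and a face $F$ of $P$, the tangent cone is $T(F,P)=\{y\in\mathbb R^d:\exists\varepsilon>0,\ f_0+\varepsilon y\in P\}$ with $f_0$ any point in the relative interior of $F$, and the internal angle of $P$ at $F$ is $\alpha(T(F,P))$ (equal to $1$ if $F=P$). Beta densities on $\mathbb R^d$: $f_{d,\beta}(x)=c_{d,\beta}(1-\|x\|^2)^\beta\mathbf 1_{\{\|x\|<1\}}$ for $\beta>-1$, with $c_{d,\beta}=\frac{\Gamma(\frac d2+\beta+1)}{\pi^{d/2}\Gamma(\beta+1)}$; for $\beta=-1$, $f_{d,-1}$ denotes the uniform distribution on the unit sphere $\mathbb S^{d-1}$. For $\beta\ge-1$,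 let $X_1,\dots,X_n$ be i.i.d. in $\mathbb R^{n-1}$ with distribution $f_{n-1,\beta}$; $J_{n,k}(\beta)$ is the expected internal angle of the simplex $[X_1,\dots,X_n]$ (convex hull) at its face $[X_1,\dots,X_k]$. By definition $J_{n,n}(\beta)=1$ (including $n=1$). Put $\mathbb J_{n,k}(\beta)=\binom nk J_{n,k}(\beta)$. For $1\le k\le n$ put $\mathbb I_{n,k}(\alpha)=\binom nk I_{n,k}(\alpha)$, where for $\alpha>-1/k$ $$I_{n,k}(\alpha)=\int_{-\pi/2}^{\pi/2}c_{1,\frac{\alpha k-1}2}(\cos\varphi)^{\alpha k}\left(\int_{-\pi/2}^{\varphi}c_{1,\frac{\alpha-1}2}(\cos\theta)^\alpha d\theta\right)^{n-k}d\varphi .$$ Convention for the degenerate case $n=2$, $\beta=-1$: $\mathbb I_{2,1}(-1)=1$ and $\mathbb J_{2,1}(-1)=1$. *)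

(* Defs.v *)
From HB Require Import structures.
From mathcomp Require Import all_boot all_order all_algebra.
From mathcomp Require Import all_classical all_reals all_analysis.
From mathcomp Require Import measurable_realfun.

Set Implicit Arguments.
Unset Strict Implicit.
Unset Printing Implicit Defensive.

Import Order.TTheory GRing.Theory Num.Theory.
Import numFieldNormedType.Exports.

Local Open Scope classical_set_scope.
Local Open Scope ring_scope.

Section power_measure.
Local Open Scope ereal_scope.
Context d (T : measurableType d) (R : realType).

Fixpoint power_measure (mu : set T -> \bar R) n : set (n.-tuple T) -> \bar R :=
  match n with
  | 0 => \d_([tuple] : 0.-tuple T)
  | m.+1 => pushforward (mu \x @power_measure mu m)
              (fun p : T * m.-tuple T => [tuple of p.1 :: p.2] : m.+1.-tuple T)
  end.

End power_measure.
Arguments power_measure {d T R} mu n _.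

Lemma product_sigma_finite d1 d2 (T1 : measurableType d1)
    (T2 : measurableType d2) (R : realType)
    (m1 : {sigma_finite_measure set T1 -> \bar R})
    (m2 : {sigma_finite_measure set T2 -> \bar R}) :
  sigma_finite setT (m1 \x m2)%E.
Proof.
have /sigma_finiteP[F [TF ndF Foo]] := sigma_finiteT m1.
have /sigma_finiteP[G [TG ndG Goo]] := sigma_finiteT m2.
exists (fun k => F k `*` G k).
  rewrite -setXTT TF TG predeqE => -[x y]; split=> [[/= [i _ Fix] [j _ Gjy]]|].
    exists (maxn i j) => //; split.
    - by move: x Fix; exact/subsetPset/ndF/leq_maxl.
    - by move: y Gjy; exact/subsetPset/ndG/leq_maxr.
  by move=> [k _ []/= ? ?]; split; exists k.
move=> k; have [? ?] := Foo k; have [? ?] := Goo k.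
split; first exact: measurableX.
by rewrite product_measure1E// lte_mul_pinfty// ge0_fin_numE.
Qed.

Section power_measure_sigma_finite.
Local Open Scope ereal_scope.
Context d (T : measurableType d) (R : realType).
Variable mu : {sigma_finite_measure set T -> \bar R}.

Let is_sigma_finite_measure n (nu : set (n.-tuple T) -> \bar R) :=
  [/\ nu set0 = 0, (forall A, 0 <= nu A), semi_sigma_additive nu &
      sigma_finite setT nu].

Let cons_spec n (nu : {sigma_finite_measure set (n.-tuple T) -> \bar R}) :
  is_sigma_finite_measure (pushforward (mu \x nu)
    (fun p : T * n.-tuple T => [tuple of p.1 :: p.2] : n.+1.-tuple T)).
Proof.
set f := (X in pushforward _ X).
have mf : measurable_fun setT f by exact: measurable_cons.
pose m0 := [the {measure set _ -> \bar R} of pushforward (mu \x nu) f].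
pose m := m0 mf.
split; [exact: (measure0 m)|exact: (measure_ge0 m)|
        exact: (@measure_semi_sigma_additive _ _ _ m)|].
have [F TF Foo] := product_sigma_finite mu nu.
pose g (t : n.+1.-tuple T) : T * n.-tuple T := (thead t, [tuple of behead t]).
have mg : measurable_fun setT g.
  apply: measurable_fun_pair; [exact: measurable_tnth|exact: measurable_behead].
exists (fun k => g @^-1` F k).
  by rewrite -preimage_bigcup -TF preimage_setT.
move=> k; have [mFk Fkoo] := Foo k; split.
  by rewrite -[X in measurable X]setTI; exact: mg.
rewrite /pushforward -comp_preimage.
suff -> : g \o f = id by [].
by apply/funext => -[x t]; congr pair; apply/val_inj.
Qed.

Let power_measure_spec n : is_sigma_finite_measure (power_measure mu n).
Proof.
elim: n => [|n [nu0 nu_ge0 nu_add nu_fin]].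
  split=> //=; [exact: measure_semi_sigma_additive|exact: sigma_finiteT].
pose nuM := isMeasure.Build _ _ _ (power_measure mu n) nu0 nu_ge0 nu_add.
pose nuMeas : {measure set (n.-tuple T) -> \bar R} :=
  HB.pack (power_measure mu n) nuM.
pose nuS := Measure_isSigmaFinite.Build _ _ _ nuMeas nu_fin.
pose nu : {sigma_finite_measure set (n.-tuple T) -> \bar R} :=
  HB.pack (power_measure mu n) nuM nuS.
exact: (cons_spec nu).
Qed.

Variable n : nat.

Let power_measure0 : power_measure mu n set0 = 0.
Proof. by have [] := power_measure_spec n. Qed.

Let power_measure_ge0 A : 0 <= power_measure mu n A.
Proof. by have [] := power_measure_spec n. Qed.

Let power_measure_semi_sigma_additive : semi_sigma_additive (power_measure mu n).
Proof. by have [] := power_measure_spec n. Qed.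

HB.instance Definition _ := isMeasure.Build _ _ _ (power_measure mu n)
  power_measure0 power_measure_ge0 power_measure_semi_sigma_additive.

Let power_measure_sigma_finite : sigma_finite setT (power_measure mu n).
Proof. by have [] := power_measure_spec n. Qed.

HB.instance Definition _ := Measure_isSigmaFinite.Build _ _ _
  (power_measure mu n) power_measure_sigma_finite.

End power_measure_sigma_finite.

Notation coordinates R d := (d.-tuple (measurableTypeR R)).

Section euclidean.
Context {R : realType}.

(* The norm of 'rV[R]_d in the library is the sup norm. *)
Definition enorm d (x : 'rV[R]_d) : R := Num.sqrt (\sum_(i < d) x 0 i ^+ 2).

Definition row_of d (t : coordinates R d) : 'rV[R]_d := \row_i tnth t i.

Definition direction d (t : coordinates R d) : coordinates R d :=
  [tuple (enorm (row_of t))^-1 * tnth t i | i < d].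

Definition open_ball d : set (coordinates R d) := [set t | enorm (row_of t) < 1].

Definition lebesgue_power d : set (coordinates R d) -> \bar R :=
  power_measure lebesgue_measure d.

HB.instance Definition _ d := SigmaFiniteMeasure.on (@lebesgue_power d).

Lemma measurable_enorm d :
  measurable_fun setT (fun t : coordinates R d => enorm (row_of t)).
Proof.
have -> : (fun t : coordinates R d => enorm (row_of t)) =
    (fun t => (\sum_(i < d) (tnth t i : R) ^+ 2) `^ 2^-1).
  apply/funext => t; rewrite powR12_sqrt; last by apply: sumr_ge0 => i _; exact: sqr_ge0.
  by congr Num.sqrt; apply: eq_bigr => i _; rewrite mxE.
apply: (measurableT_comp (measurable_powR _)).
apply: measurable_sum => i; apply: measurable_funX.
exact: measurable_tnth.
Qed.

Lemma measurable_open_ball d : measurable (@open_ball d).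
Proof.
have -> : @open_ball d =
    (fun t : coordinates R d => enorm (row_of t)) @^-1` `]-oo, 1[%classic.
  by apply/seteqP; split=> t; rewrite /open_ball/= in_itv.
by rewrite -[X in measurable X]setTI; exact: measurable_enorm.
Qed.

Lemma measurable_direction d : measurable_fun setT (@direction d).
Proof.
apply/measurable_fun_tnthP => i.
have -> : (@tnth d _)^~ i \o @direction d =
    (fun t : coordinates R d => (enorm (row_of t)) `^ (-1) * tnth t i).
  apply/funext => t /=; rewrite tnth_mktuple; congr (_ * _).
  by rewrite powR_inv1// sqrtr_ge0.
apply: measurable_funM; last exact: measurable_tnth.
exact: (measurableT_comp (measurable_powR _) (measurable_enorm (d := d))).
Qed.

Lemma lebesgue_power_box d (A : set (measurableTypeR R)) : measurable A ->
  (lebesgue_measure A < +oo)%E ->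
  (@lebesgue_power d [set t | forall i, A (tnth t i)] < +oo)%E.
Proof.
move=> mA Aoo; elim: d => [|d IH].
  by rewrite /lebesgue_power /= diracE ltry.
rewrite /lebesgue_power/= /pushforward.
have -> : (fun p : measurableTypeR R * d.-tuple (measurableTypeR R) =>
   [tuple of p.1 :: p.2] : d.+1.-tuple _) @^-1` [set t | forall i, A (tnth t i)] =
   A `*` [set t : coordinates R d | forall i, A (tnth t i)].
  apply/seteqP; split=> -[x t] /=.
    move=> h; split; first by have := h ord0.
    by move=> i; have := h (lift ord0 i); rewrite tnthS.
  by move=> [Ax h] i; case: (unliftP ord0 i) => [j ->|->//]; rewrite tnthS.
rewrite product_measure1E//.
  by rewrite lte_mul_pinfty// ge0_fin_numE.
have -> : [set t : coordinates R d | forall i, A (tnth t i)] =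
  \bigcap_(i in [set: 'I_d]) ((fun t => tnth t i) @^-1` A).
  by apply/seteqP; split=> [t h i _|t h i]; [exact: h|exact: (h i)].
apply: fin_bigcap_measurable => // i _.
by rewrite -[X in measurable X]setTI; exact: measurable_tnth.
Qed.

Lemma lebesgue_power_open_ball d : (lebesgue_power (@open_ball d) < +oo)%E.
Proof.
have mI : measurable (`[-1, 1]%classic : set (measurableTypeR R)) by exact: measurable_itv.
apply: (le_lt_trans _ (@lebesgue_power_box d _ mI _)).
  apply: le_measure.
  - by rewrite inE; exact: measurable_open_ball.
  - rewrite inE.
    have -> : [set t : coordinates R d | forall i, `[-1, 1]%classic (tnth t i)] =
      \bigcap_(i in [set: 'I_d]) ((fun t => tnth t i) @^-1` `[-1, 1]%classic).
      by apply/seteqP; split=> [t h i _|t h i]; [exact: h|exact: (h i)].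
    apply: fin_bigcap_measurable => // i _.
    by rewrite -[X in measurable X]setTI; exact: measurable_tnth.
  - move=> t /= tB i /=; rewrite in_itv/= -ler_norml.
    apply: le_trans (ltW tB); rewrite -sqrtr_sqr ler_wsqrtr//.
    by rewrite (bigD1 i)//= mxE lerDl sumr_ge0// => j _; exact: sqr_ge0.
by rewrite lebesgue_measure_itv/=; case: ifP => _; rewrite ?ltry// -EFinD ltry.
Qed.

End euclidean.
Arguments lebesgue_power {R} d _.
Arguments open_ball {R} d _.

Section sphere_law.
Local Open Scope ereal_scope.
Context {R : realType} (d : nat).

(* The cone measure: the law of V / |V| for V uniform in the unit ball. *)
Definition sphere_law (A : set (coordinates R d)) : \bar R :=
  ((fine (lebesgue_power d (open_ball d)))^-1)%:E *
  lebesgue_power d (@direction R d @^-1` A `&` open_ball d).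

Let inv_ball_ge0 : (0 <= (fine (lebesgue_power d (@open_ball R d)))^-1)%R.
Proof. by rewrite invr_ge0 fine_ge0. Qed.

Let sphere_law_spec : [/\ sphere_law set0 = 0, (forall A, 0 <= sphere_law A) &
  semi_sigma_additive sphere_law].
Proof.
pose m0 := [the {measure set (coordinates R d) -> \bar R} of pushforward
  (mfrestr (@measurable_open_ball R d) (@lebesgue_power_open_ball R d))
  (@direction R d)].
pose m := m0 (@measurable_direction R d).
pose law := [the {measure set (coordinates R d) -> \bar R} of
  mscale (NngNum inv_ball_ge0) m].
split; [exact: (measure0 law)|exact: (measure_ge0 law)|
        exact: (@measure_semi_sigma_additive _ _ _ law)].
Qed.

Let sphere_law0 : sphere_law set0 = 0.
Proof. by have [] := sphere_law_spec. Qed.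

Let sphere_law_ge0 A : 0 <= sphere_law A.
Proof. by have [] := sphere_law_spec. Qed.

Let sphere_law_semi_sigma_additive : semi_sigma_additive sphere_law.
Proof. by have [] := sphere_law_spec. Qed.

HB.instance Definition _ := isMeasure.Build _ _ _ sphere_law
  sphere_law0 sphere_law_ge0 sphere_law_semi_sigma_additive.

Let sphere_law_finite : fin_num_fun sphere_law.
Proof.
move=> A mA; rewrite fin_numM//.
rewrite ge0_fin_numE//; apply: le_lt_trans (@lebesgue_power_open_ball R d).
apply: le_measure; rewrite ?inE//.
- apply: measurableI; last exact: measurable_open_ball.
  by rewrite -[X in measurable X]setTI; exact: measurable_direction.
- exact: measurable_open_ball.
Qed.

HB.instance Definition _ := Measure_isFinite.Build _ _ _ sphere_law
  sphere_law_finite.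

End sphere_law.
Arguments sphere_law {R} d _.

Section beta_law.
Context {R : realType}.

Definition Gamma (s : R) : R :=
  \int[lebesgue_measure]_(t in `]0, +oo[) (t `^ (s - 1) * expR (- t)).

Definition beta_const (d : nat) (beta : R) : R :=
  Gamma (d%:R / 2 + beta + 1) / (pi `^ (d%:R / 2) * Gamma (beta + 1)).

Definition beta_density d (beta : R) (t : coordinates R d) : R :=
  beta_const d beta * (1 - enorm (row_of t) ^+ 2) `^ beta *
  \1_(open_ball d) t.

Definition beta_law d (beta : R) (A : set (coordinates R d)) : \bar R :=
  if beta == -1 then sphere_law d A
  else (\int[lebesgue_power d]_(t in A) (beta_density beta t)%:E)%E.

Lemma Gamma_ge0 s : 0 <= Gamma s.
Proof. by apply: Rintegral_ge0 => t _; rewrite mulr_ge0 ?powR_ge0 ?expR_ge0. Qed.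

Lemma beta_density_ge0 d beta (t : coordinates R d) : 0 <= beta_density beta t.
Proof.
rewrite /beta_density /beta_const !mulr_ge0 ?invr_ge0 ?mulr_ge0 ?Gamma_ge0//.
all: exact: powR_ge0.
Qed.

Lemma measurable_beta_density d beta :
  measurable_fun setT (@beta_density d beta).
Proof.
apply: measurable_funM; last by apply: measurable_indic; exact: measurable_open_ball.
apply: measurable_funM => //.
apply: (measurableT_comp (measurable_powR _)).
apply: measurable_funB => //; apply: measurable_funX.
exact: measurable_enorm.
Qed.

Section measure.
Variables (d : nat) (beta : R).
Local Open Scope ereal_scope.

Let density_law (A : set (coordinates R d)) :=
  \int[lebesgue_power d]_(t in A) (beta_density beta t)%:E.

Let beta_lawE : @beta_law d beta =
  if beta == (-1)%R then sphere_law d else density_law.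
Proof. by apply/funext => A; rewrite /beta_law; case: ifP. Qed.

Let beta_law0 : @beta_law d beta set0 = 0.
Proof. by rewrite /beta_law; case: ifP => _; rewrite ?measure0// integral_set0. Qed.

Let beta_law_ge0 A : 0 <= @beta_law d beta A.
Proof.
rewrite /beta_law; case: ifP => // _.
by apply: integral_ge0 => t _; rewrite lee_fin beta_density_ge0.
Qed.

Let beta_law_semi_sigma_additive : semi_sigma_additive (@beta_law d beta).
Proof.
rewrite beta_lawE; case: ifP => _; first exact: measure_semi_sigma_additive.
move=> F mF tF mUF; apply: cvg_toP.
  apply: ereal_nondecreasing_is_cvgn => m n mn.
  apply: lee_sum_nneg_natr => // k _ _; apply: integral_ge0 => t _.
  by rewrite lee_fin beta_density_ge0.
rewrite /density_law ge0_integral_bigcup//=.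
- apply/measurable_funTS/measurableT_comp => //.
  exact: measurable_beta_density.
- by move=> t _; rewrite lee_fin beta_density_ge0.
Qed.

HB.instance Definition _ := isMeasure.Build _ _ _ (@beta_law d beta)
  beta_law0 beta_law_ge0 beta_law_semi_sigma_additive.

Let beta_law_sigma_finite : sigma_finite setT (@beta_law d beta).
Proof.
rewrite beta_lawE; case: ifP => _; first exact: sigma_finiteT.
have /sigma_finiteP[F [TF ndF Foo]] := sigma_finiteT (@lebesgue_power R d).
pose G k := [set t : coordinates R d | (beta_density beta t <= k%:R)%R].
have mG k : measurable (G k).
  have -> : G k = (@beta_density d beta) @^-1` `]-oo, k%:R]%classic.
    by apply/seteqP; split=> t; rewrite /G/= in_itv.
  by rewrite -[X in measurable X]setTI; exact: measurable_beta_density.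
exists (fun k => F k `&` G k).
  apply/seteqP; split=> [t _|//].
  have [i _ Fit] : (\bigcup_i F i) t by rewrite -TF.
  pose j := (Num.truncn (beta_density beta t)).+1.
  exists (maxn i j) => //; split.
    by move: (t) Fit; exact/subsetPset/ndF/leq_maxl.
  rewrite /G/=; apply: (@le_trans _ _ j%:R%R).
    by apply/ltW; exact: truncnS_gt.
  by rewrite ler_nat leq_maxr.
move=> k; have [mFk Fkoo] := Foo k.
have mFG : measurable (F k `&` G k) by exact: measurableI.
split => //; apply: (@le_lt_trans _ _
    (\int[lebesgue_power d]_(t in F k `&` G k) (cst k%:R%:E) t)).
  apply: ge0_le_integral => //.
  - by move=> t _; rewrite lee_fin beta_density_ge0.
  - apply/measurable_funTS/measurableT_comp => //.
    exact: measurable_beta_density.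
  - by move=> t [_ Gt]; rewrite lee_fin.
rewrite integral_cst// lte_mul_pinfty//.
by apply: le_lt_trans Fkoo; apply: le_measure; rewrite ?inE//; exact: subIsetl.
Qed.

HB.instance Definition _ := Measure_isSigmaFinite.Build _ _ _
  (@beta_law d beta) beta_law_sigma_finite.

End measure.
End beta_law.
Arguments beta_law {R} d beta _.

Section convex_geometry.
Context {R : realType} {d : nat}.
Local Notation V := 'rV[R]_d.
Implicit Types (A C F P : set V).

Definition affine_set A := forall x y (t : R), A x -> A y ->
  A (t *: x + (1 - t) *: y).

Definition linear_subspace A := A 0 /\
  forall (a : R) x y, A x -> A y -> A (a *: x + y).

Definition conv_hull A := smallest (@convex_set R V) A.
Definition aff_hull A := smallest affine_set A.
Definition lin_hull A := smallest linear_subspace A.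

Definition relint F := [set x | F x /\
  exists2 e : R, 0 < e & forall y, aff_hull F y -> enorm (y - x) < e -> F y].

(* Does not depend on which point f0 of the relative interior is used. *)
Definition tangent_cone F P := [set y | exists f0, relint F f0 /\
  exists2 e : R, 0 < e & P (f0 + e *: y)].

Definition orthonormal_basis A (b : {m : nat & 'M[R]_(m, d)}) :=
  tagged b *m (tagged b)^T = 1%:M /\ range (fun v => v *m tagged b) = A.

Definition some_orthonormal_basis A : {m : nat & 'M[R]_(m, d)} :=
  xget (Tagged (fun m => 'M[R]_(m, d)) (0 : 'M[R]_(0, d))) (orthonormal_basis A).

(* With B the matrix of an orthonormal basis of lin_hull C and V uniform on the unit
   sphere of R^m, m = dim (lin_hull C), the vector V B is uniform on the unit sphere
   of lin_hull C.  For C = {0} this gives 1, as sphere_law 0 is the point mass. *)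
Definition solid_angle C : R :=
  let b := some_orthonormal_basis (lin_hull C) in
  fine (sphere_law (tag b) [set u : coordinates R (tag b) | C (row_of u *m tagged b)]).

Definition internal_angle F P : R :=
  if `[< F = P >] then 1 else solid_angle (tangent_cone F P).

End convex_geometry.

Section angle_quantities.
Context {R : realType}.

Definition simplex_angle n d k (X : n.-tuple (coordinates R d)) : R :=
  internal_angle (conv_hull [set row_of (tnth X i) | i in [set i : 'I_n | (i < k)%N]])
                 (conv_hull [set row_of (tnth X i) | i in [set: 'I_n]]).

Definition Jnk (n k : nat) (beta : R) : R :=
  if k == n then 1 else
  \int[power_measure (beta_law n.-1 beta) n]_X simplex_angle k X.

(* For n = 2 and beta = -1 the segment [X_1, X_2] is degenerate with
   probability 1/2, and the integrals in Ink 2 1 (-1) are meaningless: bbJ and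
   bbI are then 1 by convention. *)
Definition bbJ (n k : nat) (beta : R) : R :=
  if [&& n == 2%N, k == 1%N & beta == -1] then 1 else 'C(n, k)%:R * Jnk n k beta.

Definition Ink (n k : nat) (alpha : R) : R :=
  \int[lebesgue_measure]_(phi in `[- (pi / 2), pi / 2])
    (beta_const 1 ((alpha * k%:R - 1) / 2) * cos phi `^ (alpha * k%:R) *
     (\int[lebesgue_measure]_(theta in `[- (pi / 2), phi])
        (beta_const 1 ((alpha - 1) / 2) * cos theta `^ alpha)) ^+ (n - k)).

Definition bbI (n k : nat) (alpha : R) : R :=
  if [&& n == 2%N, k == 1%N & alpha == -1] then 1 else 'C(n, k)%:R * Ink n k alpha.

End angle_quantities.

(* nu encodes n = nu_0 > nu_1 > ... > nu_l >= k. *)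
Definition decreasing_chain n k l (nu : {ffun 'I_l.+1 -> 'I_n.+1}) : bool :=
  [&& nu ord0 == n :> nat,
      [forall i : 'I_l, (nu (lift ord0 i) < nu (widen_ord (leqnSn l) i))%N] &
      (k <= nu ord_max)%N].

(* Main.v *)
(* Write d = n - 1 and alpha = 2 beta + d.  For a fixed nonzero g, let A_m be the probability that, in
   the orthogonal projection of g on the span of X_1 - X_0, .., X_(m-1) - X_0, the coefficients of index
   at least k are nonnegative.  The angle of the simplex at the face X_0, .., X_(k-1) is the proportion of
   directions g in its tangent cone; as A_n turns out not to depend on g, Fubini gives J_(n,k) = A_n.

   By the Karush-Kuhn-Tucker conditions for the cone generated by the differences X_i - X_0, of which the
   first k - 1 also enter with negative coefficients, almost surely exactly one set S of points has the
   following property: the coefficients of index at least k of the projection of g on the span of S are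
   nonnegative, and all points outside S lie strictly below the hyperplane through S orthogonal to the
   residual theta.  Fix the differences within S and slice along theta: a point configuration at height h
   is a configuration at height 0 scaled by (1 - h^2)^(1/2), which makes h independent of the
   differences, with density proportional to (1 - h^2)^((alpha |S| - 1)/2), while each other point falls
   below h with probability the one-dimensional marginal distribution function.  With h = sin phi this is
   P(S) = A_|S| I_(m,|S|)(alpha), and summing over S,
   bin(m,k) A_m = bin(m,k) - sum_(k <= j < m) bin(m,j) I_(m,j)(alpha) bin(j,k) A_j,
   which unfolds into the sum over chains.

   For beta = -1 let beta -> -1.  The direction X/|X| of a beta distributed point is uniform on the sphere
   and |X| -> 1 in probability; the signs of the coefficients are those of polynomials in the points, which
   almost surely do not vanish on the sphere.  Hence A_n converges, and the integrals I_(n,k)(alpha) are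
   continuous in alpha >= 0 by dominated convergence. *)

Require Import Defs.
From HB Require Import structures.
From mathcomp Require Import all_boot all_order all_algebra fingroup perm.
From mathcomp Require Import all_classical all_reals all_analysis.
From mathcomp Require Import measurable_realfun ring lra zify.

Set Implicit Arguments.
Unset Strict Implicit.
Unset Printing Implicit Defensive.

Import Order.TTheory GRing.Theory Num.Theory.
Import numFieldNormedType.Exports.

Local Open Scope classical_set_scope.
Local Open Scope ring_scope.

(** Two features shape the argument. All sub-configurations stay in the same R^d, with the same g
    and the same alpha, so the recursion closes on the single family A_m; A_m is independent of g
    because the recursion determines it and its right side does not contain g. Moreover theta varies
    with the differences, so integrals over the hyperplane orthogonal to theta are written as
    integrals over a slab of unit thickness, with respect to Lebesgue measure of full dimension.
    With r = (1 - h^2)^(1/2) and |S| = p + 1, rescaling to height 0 costs r^(d p) for the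
    differences, r^(d - 1) for the base point within its hyperplane and r^(2 beta (p + 1)) for the
    densities, in all r^(alpha |S| - 1). The limit beta -> -1 is taken for d >= 2, where the sphere
    charges no hyperplane and the limit value alpha = d - 2 is nonnegative; for d = 1 the sphere is
    a pair of atoms and the conventions decide. The measurability of the angle is never established:
    off a null set it equals a measurable function, and this already determines its integral. *)

Section measurability.
Context d (T : measurableType d) (R : realType).
Implicit Types b : T -> bool.

(** * Measurability of matrices, entry by entry *)

Lemma measurable_fun_nat_of_bool b : measurable_fun setT b ->
  measurable_fun setT (fun t => (b t)%:R : R).
Proof.
move=> mb; apply: (@measurableT_comp _ _ _ _ bool R (fun c : bool => c%:R) _ b) => //.
Qed.

Definition measurable_mx m n (M : T -> 'M[R]_(m, n)) :=
  forall i j, measurable_fun setT (fun t => M t i j).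

Lemma measurable_mx_cst m n (M : 'M[R]_(m, n)) : measurable_mx (fun=> M).
Proof. by move=> i j; exact: measurable_cst. Qed.

Lemma measurable_mxM m n p (M : T -> 'M[R]_(m, n)) (N : T -> 'M[R]_(n, p)) :
  measurable_mx M -> measurable_mx N -> measurable_mx (fun t => M t *m N t).
Proof.
move=> mM mN i j; under eq_fun do rewrite mxE.
by apply: measurable_sum => k; exact: measurable_funM.
Qed.

Lemma measurable_mxD m n (M N : T -> 'M[R]_(m, n)) :
  measurable_mx M -> measurable_mx N -> measurable_mx (fun t => M t + N t).
Proof.
move=> mM mN i j; under eq_fun do rewrite mxE.
exact: measurable_funD.
Qed.

Lemma measurable_mxZ m n (a : T -> R) (M : T -> 'M[R]_(m, n)) :
  measurable_fun setT a -> measurable_mx M -> measurable_mx (fun t => a t *: M t).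
Proof.
move=> ma mM i j; under eq_fun do rewrite mxE.
exact: measurable_funM.
Qed.

Lemma measurable_mx_tr m n (M : T -> 'M[R]_(m, n)) :
  measurable_mx M -> measurable_mx (fun t => (M t)^T).
Proof. by move=> mM i j; under eq_fun do rewrite mxE; exact: mM. Qed.

Lemma measurable_det n (M : T -> 'M[R]_n) :
  measurable_mx M -> measurable_fun setT (fun t => \det (M t)).
Proof.
move=> mM; apply: measurable_sum => s; apply: measurable_funM => //.
by apply: measurable_prod => i _; exact: mM.
Qed.

Lemma measurable_adj n (M : T -> 'M[R]_n) :
  measurable_mx M -> measurable_mx (fun t => \adj (M t)).
Proof.
move=> mM i j; under eq_fun do rewrite mxE.
apply: measurable_funM => //; apply: measurable_det => k l.
by under eq_fun do rewrite !mxE; exact: mM.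
Qed.

(** [powR] with exponent -1 is the inverse only at nonnegative bases; writing the inverse as f
    (f^2)^(-1) covers both signs and gives the default value 0 at the zeros of [f]. *)
Lemma measurable_invr (f : T -> R) : measurable_fun setT f ->
  measurable_fun setT (fun t => (f t)^-1).
Proof.
move=> mf; rewrite (_ : (fun _ => _) = (fun t => f t * (f t ^+ 2) `^ (-1))); last first.
  apply/funext => t; have [->|f0] := eqVneq (f t) 0; first by rewrite invr0 mul0r.
  by rewrite powR_inv1 ?sqr_ge0// expr2 invfM mulrA divff// mul1r.
apply: measurable_funM => //; apply: (measurableT_comp (measurable_powR _)).
exact: measurable_funX.
Qed.

Lemma measurable_fun_sqrt (f : T -> R) : measurable_fun setT f ->
  measurable_fun setT (fun t => Num.sqrt (f t)).
Proof.
move=> mf; apply: (measurableT_comp _ mf).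
by apply: continuous_measurable_fun; exact: sqrt_continuous.
Qed.

Lemma measurable_fun_opp (f : T -> R) : measurable_fun setT f ->
  measurable_fun setT (fun t => - f t).
Proof. by move=> mf; apply: (measurableT_comp _ mf); exact: oppr_measurable. Qed.

Lemma measurable_fun_expR (f : T -> R) : measurable_fun setT f ->
  measurable_fun setT (fun t => expR (f t)).
Proof. by move=> mf; apply: (measurableT_comp _ mf); exact: measurable_expR. Qed.

End measurability.

Ltac mfun := repeat (first
 [ exact: measurable_cst
 | exact: measurable_id
 | assumption
 | lazymatch goal with
   | |- measurable_fun _ (fun x => GRing.add _ _) => apply: measurable_funD
   | |- measurable_fun _ (fun x => GRing.opp _) => apply: measurable_fun_opp
   | |- measurable_fun _ (@GRing.opp _) => exact: oppr_measurable
   | |- measurable_fun _ (@expR _) => exact: measurable_expR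
   | |- measurable_fun _ (@fst _ _) => exact: measurable_fst
   | |- measurable_fun _ (@snd _ _) => exact: measurable_snd
   | |- measurable_fun _ (Order.le ?a) => apply: (@measurable_fun_ler _ _ _ _ (fun=> a) id)
   | |- measurable_fun _ (Order.lt ?a) => apply: (@measurable_fun_ltr _ _ _ _ (fun=> a) id)
   | |- measurable_fun _ (GRing.add ?a) => apply: (@measurable_funD _ _ _ _ (fun=> a) id)
   | |- measurable_fun _ (GRing.mul ?a) => apply: (@measurable_funM _ _ _ _ (fun=> a) id)
   | |- measurable_fun _ (fun x => GRing.mul _ _) => apply: measurable_funM
   | |- measurable_fun _ (fun x => GRing.exp _ _) => apply: measurable_funX
   | |- measurable_fun _ (fun x => GRing.inv _) => apply: measurable_invr
   | |- measurable_fun _ (fun x => powR _ _) => apply: (measurableT_comp (measurable_powR _))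
   | |- measurable_fun _ (fun x => expR _) => apply: measurable_fun_expR
   | |- measurable_fun _ (fun x => Num.sqrt _) => apply: measurable_fun_sqrt
   | |- measurable_fun _ (fun x => EFin _) => apply/measurable_EFinP
   | |- measurable_fun _ (fun x => mule _ _) => apply: emeasurable_funM
   | |- measurable_fun _ (fun x => GRing.natmul 1 (nat_of_bool _)) => apply: measurable_fun_nat_of_bool
   | |- measurable_fun _ (fun x => andb _ _) => apply: measurable_and
   | |- measurable_fun _ (fun x => negb _) => apply: measurable_neg
   | |- measurable_fun _ (fun x => Order.le _ _) => apply: measurable_fun_ler
   | |- measurable_fun _ (fun x => Order.lt _ _) => apply: measurable_fun_ltr
   | |- measurable_fun _ (fun x => eq_op _ _) => apply: measurable_fun_eqr
   | |- measurable_fun _ (fun x => \sum_(i <- _) _) => apply: measurable_sum => ?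
   | |- measurable_fun _ (fun x => \prod_(i <- _) _) => apply: measurable_prod => ? ?
   | |- measurable_fun _ (fun x => tnth _ _) => apply: (measurableT_comp (measurable_tnth _))
   | |- measurable_fun _ (fun x => fst _) => apply: (measurableT_comp measurable_fst)
   | |- measurable_fun _ (fun x => snd _) => apply: (measurableT_comp measurable_snd)
   | |- measurable_fun _ (fun x => pair _ _) => apply: measurable_fun_pair
   end ]).

(** * Tonelli, densities and powers of a measure *)

Section integration.
Import HBSimple HBNNSimple.
Local Open Scope ereal_scope.
Context {R : realType}.

Lemma measurable_fun_integral d1 d2 (S : measurableType d1) (T : measurableType d2)
    (m : {sigma_finite_measure set T -> \bar R}) (f : S -> T -> \bar R) :
  measurable_fun setT (fun z : S * T => f z.1 z.2) -> (forall x y, 0 <= f x y) ->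
  measurable_fun setT (fun x => \int[m]_y f x y).
Proof.
move=> mf f0; apply: (measurable_fun_fubini_tonelli_F (fun z : S * T => f z.1 z.2)) => //.
Qed.

Lemma tonelli d1 d2 (S : measurableType d1) (T : measurableType d2)
    (m : {sigma_finite_measure set S -> \bar R})
    (m' : {sigma_finite_measure set T -> \bar R}) (f : S -> T -> \bar R) :
  measurable_fun setT (fun z : S * T => f z.1 z.2) -> (forall x y, 0 <= f x y) ->
  \int[m]_x \int[m']_y f x y = \int[m']_y \int[m]_x f x y.
Proof. by move=> mf f0; apply: (fubini_tonelli (fun z : S * T => f z.1 z.2)). Qed.

(** The density is known only through the values of [m] on measurable sets, so the formula is
    checked on simple functions and extended by monotone convergence on both sides. *)
Lemma integral_density d (T : measurableType d) (l m : {measure set T -> \bar R})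
    (b : T -> R) (f : T -> \bar R) :
  measurable_fun setT b -> (forall x, (0 <= b x)%R) ->
  (forall A, measurable A -> m A = \int[l]_(x in A) (b x)%:E) ->
  measurable_fun setT f -> (forall x, 0 <= f x) ->
  \int[m]_x f x = \int[l]_x (f x * (b x)%:E).
Proof.
move=> mb b0 mE mf f0; pose g := nnsfun_approx measurableT mf.
have gf (x : T) : (g n x)%:E @[n --> \oo] --> f x by apply: cvg_nnsfun_approx => //.
have nd (x : T) : {homo (fun n => (g n x)%:E) : a c / (a <= c)%N >-> a <= c}.
  by move=> a c ac; rewrite lee_fin; exact/lefP/nd_nnsfun_approx.
have mg n : measurable_fun setT (fun x : T => (g n x)%:E) by apply/measurable_EFinP.
have g0 n (x : T) : 0 <= (g n x)%:E by rewrite lee_fin.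
have mbe : measurable_fun setT (fun x => (b x)%:E) by apply/measurable_EFinP.
have lim1 : \int[m]_x f x = limn (fun n => \int[m]_x (g n x)%:E).
  rewrite -monotone_convergence//.
  by apply: eq_integral => x _; apply/esym/cvg_lim => //; exact: gf.
have lim2 : \int[l]_x (f x * (b x)%:E) = limn (fun n => \int[l]_x ((g n x)%:E * (b x)%:E)).
  rewrite -monotone_convergence//; last 3 first.
  - by move=> n; apply: emeasurable_funM.
  - by move=> n x _; rewrite mule_ge0// lee_fin.
  - by move=> x _ a c ac; apply: lee_wpmul2r; [rewrite lee_fin|exact: nd].
  apply: eq_integral => x _; apply/esym/cvg_lim => //.
  by apply: cvgeZr => //; exact: gf.
rewrite lim1 lim2; congr (limn _); apply/funext => n.
rewrite integralT_nnsfun sintegralE.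
transitivity (\int[l]_x (\sum_(y \in range (g n)) ((y * \1_(g n @^-1` [set y]) x)%:E * (b x)%:E))); last first.
  apply: eq_integral => x _; rewrite [in RHS](fimfunE (g n)) -fsumEFin// ge0_mule_fsuml//.
  by move=> y; rewrite EFinM nnfun_muleindic_ge0.
have mA y : measurable (g n @^-1` [set y]) by exact: measurable_funPTI.
rewrite ge0_integral_fsum//; last 2 first.
- move=> y; apply: emeasurable_funM => //; apply/measurable_EFinP.
  by apply: measurable_funM => //; exact: measurable_indic.
- by move=> y x _; apply: mule_ge0; [by rewrite EFinM nnfun_muleindic_ge0|by rewrite lee_fin].
apply: eq_fsbigr => y yr.
have y0 : (0 <= y)%R by move: yr; rewrite inE => -[x _ <-].
rewrite mE// integral_mkcond/= -ge0_integralZl//; last 2 first.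
- by apply/(measurable_restrictT _ _).1 => //; exact: measurable_funTS.
- by move=> x _; rewrite patchE; case: ifP; rewrite ?lee_fin.
apply: eq_integral => x _; rewrite patchE indicE.
by case: ifP => _; rewrite -?EFinM ?mulr1 ?mulr0 ?mule0 ?mul0r ?mul0e.
Qed.

Section power.
Context d (T : measurableType d).
Implicit Types mu l : {sigma_finite_measure set T -> \bar R}.

Lemma integral_power_cons mu n (f : n.+1.-tuple T -> \bar R) :
  measurable_fun setT f -> (forall t, 0 <= f t) ->
  \int[power_measure mu n.+1]_t f t =
  \int[mu]_x \int[power_measure mu n]_t f [tuple of x :: t].
Proof.
move=> mf f0; rewrite /= ge0_integral_pushforward//; last exact: measurable_cons.
rewrite preimage_setT fubini_tonelli1//; last by move=> ?; exact: f0.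
by apply: measurableT_comp => //; exact: measurable_cons.
Qed.

Lemma integral_power0 mu (f : 0.-tuple T -> \bar R) :
  measurable_fun setT f -> \int[power_measure mu 0]_t f t = f [tuple].
Proof. by move=> mf; rewrite /= integral_dirac// diracT mul1e. Qed.

Lemma measurable_fun_cons_tuple n :
  measurable_fun setT (fun p : T * n.-tuple T => [tuple of p.1 :: p.2]).
Proof. exact: measurable_cons. Qed.

Lemma measurable_fun_cat_tuple m n :
  measurable_fun setT (fun p : m.-tuple T * n.-tuple T => [tuple of p.1 ++ p.2]).
Proof.
apply/(measurable_fun_tnthP (fun p : m.-tuple T * n.-tuple T => [tuple of p.1 ++ p.2])) => i; case: (split_ordP i) => j ->.
  rewrite (_ : _ \o _ = (fun p : m.-tuple T * n.-tuple T => tnth p.1 j)); first by mfun.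
  by apply/funext => p /=; rewrite tnth_lshift.
rewrite (_ : _ \o _ = (fun p : m.-tuple T * n.-tuple T => tnth p.2 j)); first by mfun.
by apply/funext => p /=; rewrite tnth_rshift.
Qed.

Lemma integral_power_cat mu m n (f : (m + n).-tuple T -> \bar R) :
  measurable_fun setT f -> (forall t, 0 <= f t) ->
  \int[power_measure mu (m + n)]_t f t =
  \int[power_measure mu m]_s \int[power_measure mu n]_t f [tuple of s ++ t].
Proof.
move=> mf f0.
have mg (k l : nat) (g : (k + l).-tuple T -> \bar R) : measurable_fun setT g -> (forall t, 0 <= g t) ->
    measurable_fun setT (fun s : k.-tuple T => \int[power_measure mu l]_t g [tuple of s ++ t]).
  move=> mg g0; apply: measurable_fun_integral => //.
  by apply: (measurableT_comp mg); exact: measurable_fun_cat_tuple.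
elim: m f mf f0 => [|m IH] f mf f0.
  rewrite integral_power0; last exact: mg.
  by apply: eq_integral => t _; congr f; exact/val_inj.
rewrite [LHS](@integral_power_cons mu (m + n) f)// integral_power_cons//; last 2 first.
- exact: mg.
- by move=> t; exact: integral_ge0.
apply: eq_integral => x _.
etransitivity; first apply: (IH (fun u : (m + n).-tuple T => f [tuple of x :: u])) => //.
  by apply: (measurableT_comp mf); apply: measurable_cons.
by apply: eq_integral => s _; apply: eq_integral => t _; congr f; exact/val_inj.
Qed.

Lemma integral_power_density l mu (b : T -> R) n (f : n.-tuple T -> \bar R) :
  measurable_fun setT b -> (forall x, (0 <= b x)%R) ->
  (forall A, measurable A -> mu A = \int[l]_(x in A) (b x)%:E) ->
  measurable_fun setT f -> (forall t, 0 <= f t) ->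
  \int[power_measure mu n]_t f t =
  \int[power_measure l n]_t (f t * (\prod_(i < n) b (tnth t i))%:E).
Proof.
move=> mb b0 muE.
have mB k : measurable_fun setT (fun t : k.-tuple T => (\prod_(i < k) b (tnth t i))%:E).
  by mfun; apply: (measurableT_comp mb); mfun.
have B0 k (t : k.-tuple T) : (0 <= \prod_(i < k) b (tnth t i))%R by exact: prodr_ge0.
elim: n f => [|n IH] f mf f0.
  rewrite !integral_power0//; first by rewrite big_ord0 mule1.
  by apply: emeasurable_funM => //; exact: mB.
rewrite integral_power_cons// integral_power_cons//; last 2 first.
- by apply: emeasurable_funM => //; exact: mB.
- by move=> t; rewrite mule_ge0// lee_fin.
have mfc x : measurable_fun setT (fun t : n.-tuple T => f [tuple of x :: t]).
  by apply: (measurableT_comp mf); apply: measurable_cons.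
rewrite (integral_density mb b0 muE); last 2 first.
- apply: measurable_fun_integral => //.
  by apply: (measurableT_comp mf); exact: measurable_fun_cons_tuple.
- by move=> x; exact: integral_ge0.
apply: eq_integral => x _; rewrite IH// -ge0_integralZr//; last 3 first.
- by apply: emeasurable_funM => //; exact: mB.
- by move=> t _; rewrite mule_ge0// lee_fin.
- by rewrite lee_fin.
apply: eq_integral => t _; rewrite big_ord_recl tnth0 EFinM -muleA; congr (_ * _).
by rewrite muleC; congr (_ * (_)%:E); apply: eq_bigr => i _; rewrite tnthS.
Qed.

Lemma power_measure_box mu n (A : 'I_n -> set T) : (forall i, measurable (A i)) ->
  power_measure mu n [set t | forall i, A i (tnth t i)] = \big[*%E/1]_(i < n) mu (A i).
Proof.
elim: n A => [|n IH] A mA.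
  rewrite /= diracE big_ord0 mem_set//; by case.
rewrite big_ord_recl /= /pushforward.
rewrite (_ : _ @^-1` _ = A ord0 `*` [set t | forall i, A (lift ord0 i) (tnth t i)]).
  rewrite product_measure1E//; first by congr (_ * _); exact: (IH (fun i => A (lift ord0 i))).
  rewrite (_ : mkset _ = \bigcap_(i in [set: 'I_n]) ((fun t => tnth t i) @^-1` A (lift ord0 i))).
    by apply: fin_bigcap_measurable => // i _; rewrite -[X in measurable X]setTI; exact: measurable_tnth.
  by apply/seteqP; split=> [t h i _|t h i]; [exact: h|exact: (h i)].
apply/seteqP; split=> -[x t] /=.
  by move=> h; split; [exact: (h ord0)|move=> i; have := h (lift ord0 i); rewrite tnthS].
by move=> [Ax h] i; case: (unliftP ord0 i) => [j ->|->//]; rewrite tnthS.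
Qed.

Lemma power_measureT mu n : mu setT = 1 -> power_measure mu n setT = 1.
Proof.
move=> mu1; have := @power_measure_box mu n (fun=> setT) (fun=> measurableT).
rewrite (_ : mkset _ = setT); last by apply/seteqP; split.
by move=> ->; rewrite big1.
Qed.

Definition reindex_tuple m n (f : 'I_m -> 'I_n) (t : n.-tuple T) : m.-tuple T :=
  [tuple tnth t (f i) | i < m].

Lemma measurable_reindex_tuple m n (f : 'I_m -> 'I_n) :
  measurable_fun setT (reindex_tuple f).
Proof.
apply/measurable_fun_tnthP => i; rewrite /comp.
by under eq_fun do rewrite tnth_mktuple; exact: measurable_tnth.
Qed.

(** Boxes form a pi-system that generates the product sigma-algebra, so it is enough to compare the
    two laws on boxes; there the coordinates outside the image of [f] contribute factors
    [mu setT = 1]. This provides exchangeability and the passage to sub-samples. *)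
Lemma integral_power_reindex mu m n (f : 'I_m -> 'I_n) (g : m.-tuple T -> \bar R) :
  mu setT = 1 -> injective f -> measurable_fun setT g -> (forall t, 0 <= g t) ->
  \int[power_measure mu n]_t g (reindex_tuple f t) = \int[power_measure mu m]_t g t.
Proof.
move=> mu1 inj_f mg g0.
have mr := measurable_reindex_tuple f.
pose nu0 := [the {measure set _ -> \bar R} of pushforward (power_measure mu n) (reindex_tuple f)].
pose nu := nu0 mr.
rewrite -[LHS]/(\int[power_measure mu n]_(x in reindex_tuple f @^-1` setT) (g \o reindex_tuple f) x).
rewrite -ge0_integral_pushforward//.
pose G := [set B : set (m.-tuple T) | exists2 A : 'I_m -> set T,
  (forall i, measurable (A i)) & B = [set t | forall i, A i (tnth t i)]].
suff E A : measurable A -> nu A = power_measure mu m A.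
  by apply: (eq_measure_integral (power_measure mu m)) => A mA _; exact: E.
have GT : G setT by exists (fun=> setT) => //; apply/seteqP; split.
move: A; apply: (@measure_unique _ _ _ G (fun=> setT)) => //.
- apply/seteqP; split.
    apply: smallest_sub; first exact: smallest_sigma_algebra.
    rewrite -bigcup_seq => B [i _ [C mC <-]]; apply: sub_sigma_algebra.
    exists (fun j => if j == i then C else setT); first by move=> j; case: ifP.
    apply/seteqP; split=> t /=; first by case=> _ Ct j; case: eqP => // ->.
    by move=> /(_ i); rewrite eqxx.
  apply: smallest_sub; first exact: sigma_algebra_measurable.
  move=> B [A mA ->].
  rewrite (_ : mkset _ = \bigcap_(i in [set: 'I_m]) ((fun t => tnth t i) @^-1` A i)).
    by apply: fin_bigcap_measurable => // i _; rewrite -[X in measurable X]setTI; exact: measurable_tnth.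
  by apply/seteqP; split=> [t h i _|t h i]; [exact: h|exact: (h i)].
- move=> B C [A mA ->] [A' mA' ->]; exists (fun i => A i `&` A' i); first by move=> i; exact: measurableI.
  by apply/seteqP; split=> t /= => [[h h'] i|h]; [split|split=> i; have [] := h i].
- by rewrite bigcup_const.
- move=> B [A mA ->]; rewrite /nu/= /pushforward.
  (* The constraint on coordinate j: the single [A i] with f i = j, or everything if j is not in the
     image of [f]. *)
  pose A' j := \bigcap_(i in [set i | f i = j]) A i.
  have mA' j : measurable (A' j) by apply: fin_bigcap_measurable => //; exact: finite_finset.
  rewrite (_ : _ @^-1` _ = [set t | forall j, A' j (tnth t j)]); last first.
    apply/seteqP; split=> t /=.
      by move=> h j i /= <-; have := h i; rewrite tnth_mktuple.
    by move=> h i; rewrite tnth_mktuple; exact: (h (f i)).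
  rewrite !power_measure_box// (bigID (mem (codom f)))/= [X in _ * X]big1 ?mule1; last first.
    move=> j jf; rewrite (_ : A' j = setT)// -subTset => x _ i /= fi.
    by move: jf; rewrite -fi codom_f.
  rewrite -big_enum/= (perm_big (codom f)); last first.
    apply: uniq_perm; rewrite ?enum_uniq//; first by rewrite map_inj_uniq// enum_uniq.
    by move=> j; rewrite mem_enum.
  rewrite big_map big_enum/=; apply: eq_bigr => i _; congr (mu _).
  apply/seteqP; split=> x; first by apply.
  by move=> Ax j /= /inj_f ->.
- move=> _; rewrite /nu/= /pushforward preimage_setT.
  by have -> := power_measureT n mu1; rewrite ltry.
Qed.

End power.
End integration.

(** * Tuples of coordinates as rows and matrices *)

Section rows.
Context {R : realType}.

Definition mx_of d p (D : p.-tuple (coordinates R d)) : 'M[R]_(p, d) :=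
  \matrix_(i, j) tnth (tnth D i) j.

Definition of_row d (v : 'rV[R]_d) : coordinates R d := [tuple v 0 i | i < d].

Definition of_mx d p (M : 'M[R]_(p, d)) : p.-tuple (coordinates R d) :=
  [tuple of_row (row i M) | i < p].

Lemma of_rowK d : cancel (@of_row d) (@row_of R d).
Proof. by move=> v; apply/rowP => i; rewrite mxE tnth_mktuple. Qed.

Lemma row_ofK d : cancel (@row_of R d) (@of_row d).
Proof. by move=> t; apply/eq_from_tnth => i; rewrite tnth_mktuple mxE. Qed.

Lemma of_mxK d p : cancel (@of_mx d p) (@mx_of d p).
Proof. by move=> v; apply/matrixP => i j; rewrite !mxE !tnth_mktuple mxE. Qed.

Lemma measurable_mxN d0 (T : measurableType d0) m n (M : T -> 'M[R]_(m, n)) :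
  measurable_mx M -> measurable_mx (fun t => (- M t)).
Proof.
move=> mM i j; under eq_fun do rewrite mxE.
by apply: measurableT_comp; [exact: oppr_measurable|exact: mM].
Qed.

Lemma measurable_of_row d0 (T : measurableType d0) d (f : T -> 'rV[R]_d) :
  measurable_mx f -> measurable_fun setT (fun t => of_row (f t)).
Proof.
move=> mf; apply/measurable_fun_tnthP => i; rewrite /comp.
by under eq_fun do rewrite tnth_mktuple; exact: mf.
Qed.

Lemma measurable_of_mx d0 (T : measurableType d0) d p (f : T -> 'M[R]_(p, d)) :
  measurable_mx f -> measurable_fun setT (fun t => of_mx (f t)).
Proof.
move=> mf; apply/measurable_fun_tnthP => i; rewrite /comp.
under eq_fun do rewrite tnth_mktuple; apply: measurable_of_row => a b.
by under eq_fun do rewrite mxE; exact: mf.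
Qed.

Lemma measurable_row_of d0 (T : measurableType d0) d (f : T -> coordinates R d) :
  measurable_fun setT f -> measurable_mx (fun t => row_of (f t)).
Proof.
move=> mf i j; under eq_fun do rewrite mxE.
exact: (measurableT_comp (measurable_tnth _) mf).
Qed.

Lemma measurable_mx_of d0 (T : measurableType d0) d p (f : T -> p.-tuple (coordinates R d)) :
  measurable_fun setT f -> measurable_mx (fun t => mx_of (f t)).
Proof.
move=> mf i j; under eq_fun do rewrite mxE.
apply: (measurableT_comp (measurable_tnth _)).
exact: (measurableT_comp (measurable_tnth _) mf).
Qed.

(** The sigma-algebra lives on tuples of coordinates, so measurability of a function of a row is
    stated through the bijection [row_of]. *)
Definition mfun_row d d' (T' : measurableType d') (F : 'rV[R]_d -> T') :=
  measurable_fun setT (fun t : coordinates R d => F (row_of t)).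

Definition mfun_mx d p d' (T' : measurableType d') (F : 'M[R]_(p, d) -> T') :=
  measurable_fun setT (fun t : p.-tuple (coordinates R d) => F (mx_of t)).

Lemma mfun_row_comp d d' (T' : measurableType d') (F : 'rV[R]_d -> T')
    d0 (T : measurableType d0) (f : T -> 'rV[R]_d) :
  mfun_row F -> measurable_mx f -> measurable_fun setT (fun t => F (f t)).
Proof.
move=> mF mf; under eq_fun do rewrite -(of_rowK (f _)).
exact: (measurableT_comp mF (measurable_of_row mf)).
Qed.

Lemma mfun_mx_comp d p d' (T' : measurableType d') (F : 'M[R]_(p, d) -> T')
    d0 (T : measurableType d0) (f : T -> 'M[R]_(p, d)) :
  mfun_mx F -> measurable_mx f -> measurable_fun setT (fun t => F (f t)).
Proof.
move=> mF mf; under eq_fun do rewrite -(of_mxK (f _)).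
exact: (measurableT_comp mF (measurable_of_mx mf)).
Qed.

Definition dot d (u v : 'rV[R]_d) : R := \sum_i u 0 i * v 0 i.

Lemma dotE d (u v : 'rV[R]_d) : dot u v = (u *m v^T) 0 0.
Proof. by rewrite mxE; apply: eq_bigr => i _; rewrite mxE. Qed.

Lemma dotC d (u v : 'rV[R]_d) : dot u v = dot v u.
Proof. by apply: eq_bigr => i _; rewrite mulrC. Qed.

Lemma dotDl d (u v w : 'rV[R]_d) : dot (u + v) w = dot u w + dot v w.
Proof. by rewrite !dotE mulmxDl mxE. Qed.

Lemma dotBl d (u v w : 'rV[R]_d) : dot (u - v) w = dot u w - dot v w.
Proof. by rewrite !dotE mulmxBl !mxE. Qed.

Lemma dotZl d a (u w : 'rV[R]_d) : dot (a *: u) w = a * dot u w.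
Proof. by rewrite !dotE -scalemxAl mxE. Qed.

Lemma dot0l d (w : 'rV[R]_d) : dot 0 w = 0.
Proof. by rewrite dotE mul0mx mxE. Qed.

Lemma dotDr d (u v w : 'rV[R]_d) : dot w (u + v) = dot w u + dot w v.
Proof. by rewrite !(dotC w) dotDl. Qed.

Lemma dotBr d (u v w : 'rV[R]_d) : dot w (u - v) = dot w u - dot w v.
Proof. by rewrite !(dotC w) dotBl. Qed.

Lemma dotZr d a (u w : 'rV[R]_d) : dot w (a *: u) = a * dot w u.
Proof. by rewrite !(dotC w) dotZl. Qed.

Lemma dot_ge0 d (u : 'rV[R]_d) : 0 <= dot u u.
Proof. by apply: sumr_ge0 => i _; rewrite -expr2 sqr_ge0. Qed.

Lemma dot_eq0 d (u : 'rV[R]_d) : (dot u u == 0) = (u == 0).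
Proof.
apply/eqP/eqP => [u0|->]; last by rewrite dot0l.
apply/rowP => i; rewrite mxE; apply/eqP; rewrite -sqrf_eq0 expr2; apply/eqP.
by move/psumr_eq0P : u0 => ->// j _; rewrite -expr2 sqr_ge0.
Qed.

Lemma measurable_dot d0 (T : measurableType d0) d (f g : T -> 'rV[R]_d) :
  measurable_mx f -> measurable_mx g -> measurable_fun setT (fun t => dot (f t) (g t)).
Proof.
move=> mf mg; apply: measurable_sum => i; apply: measurable_funM; [exact: mf|exact: mg].
Qed.

End rows.

Ltac mfunx := repeat (progress mfun || lazymatch goal with
 | |- measurable_fun _ (fun x => dot _ _) => apply: measurable_dot
 | |- measurable_mx (fun x => GRing.add _ _) => apply: measurable_mxD
 | |- measurable_mx (fun x => GRing.scale _ _) => apply: measurable_mxZ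
 | |- measurable_mx (fun x => GRing.opp _) => apply: measurable_mxN
 | |- measurable_mx (fun x => mulmx _ _) => apply: measurable_mxM
 | |- measurable_mx (fun x => trmx _) => apply: measurable_mx_tr
 | |- measurable_mx (fun x => row_of _) => apply: measurable_row_of
 | |- measurable_mx (fun x => mx_of _) => apply: measurable_mx_of
 | |- measurable_mx (fun x => ?M) => exact: (measurable_mx_cst M)
 | |- measurable_mx (@row_of _ _) => exact: (measurable_row_of (@measurable_id _ _ _))
 | |- measurable_mx (@mx_of _ _ _) => exact: (measurable_mx_of (@measurable_id _ _ _))
 | |- mfun_row _ => rewrite /mfun_row
 | |- mfun_mx _ => rewrite /mfun_mx
 end).

(** * Affine maps and slices of Lebesgue measure *)

Section lebesgue_transformations.
Context {R : realType}.
Local Open Scope ereal_scope.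
Notation leb := (@lebesgue_measure R).

Lemma lebesgue_measure_affine_itv (a b u v : R) : a != 0%R ->
  leb ((fun x : R => (a * x + b)%R) @^-1` `]u, v]%classic) = `|a^-1|%:E * leb `]u, v]%classic.
Proof.
move=> a0; rewrite [in RHS]lebesgue_measure_itv/=.
have [a_gt0|a_lt0|a_eq0] := ltrgt0P a; last by rewrite a_eq0 eqxx in a0.
- rewrite (_ : _ @^-1` _ = `]((u - b) / a)%R, ((v - b) / a)%R]%classic); last first.
    apply/seteqP; split=> x /=; rewrite !in_itv/= ltr_pdivrMr// ler_pdivlMr// ltrBlDr lerBrDr (mulrC x) => /andP[-> ->] //.
  rewrite lebesgue_measure_itv/= !lte_fin ltr_pM2r ?invr_gt0// ltrD2r.
  case: ifP => _; last by rewrite mule0.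
  by rewrite gtr0_norm ?invr_gt0// -!EFinB -EFinM; congr (_)%:E; ring.
- rewrite (_ : _ @^-1` _ = `[((v - b) / a)%R, ((u - b) / a)%R[%classic); last first.
    apply/seteqP; split=> x /=; rewrite !in_itv/= ltr_ndivlMr// ler_ndivrMr// ltrBlDr lerBrDr (mulrC x) => /andP[-> ->] //.
  rewrite lebesgue_measure_itv/= !lte_fin ltr_nM2r ?invr_lt0// ltrD2r.
  case: ifP => _; last by rewrite mule0.
  by rewrite ltr0_norm ?invr_lt0// -!EFinB -EFinM; congr (_)%:E; ring.
Qed.

(** The image of [leb] under the affine map, multiplied by |a|, agrees with [leb] on half-open
    intervals and hence everywhere. *)
Lemma integral_affine (a b : R) (f : R -> \bar R) : a != 0%R ->
  measurable_fun setT f -> (forall x, 0 <= f x) ->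
  \int[leb]_x f (a * x + b)%R = `|a^-1|%:E * \int[leb]_x f x.
Proof.
move=> a0 mf f0.
have mh : measurable_fun setT (fun x : measurableTypeR R => (a * x + b)%R : measurableTypeR R).
  by apply: measurable_funD => //; apply: measurable_funM.
pose nu0 := [the {measure set _ -> \bar R} of pushforward leb (fun x : measurableTypeR R => (a * x + b)%R : measurableTypeR R)].
pose nu := nu0 mh.
pose nuS := [the {measure set _ -> \bar R} of mscale (NngNum (normr_ge0 a)) nu].
have E A : measurable A -> leb A = nuS A.
  move: A; apply: lebesgue_measure_unique => X [[u v] _ <-] /=.
  rewrite /mscale/= /pushforward lebesgue_measure_affine_itv// muleA -EFinM normfV divff ?normr_eq0// mul1e//.
have -> : \int[leb]_x f x = \int[nuS]_x f x by apply: eq_measure_integral => A mA _; exact: E.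
rewrite ge0_integral_mscale// muleA -EFinM normfV mulVf ?normr_eq0// mul1e.
by rewrite ge0_integral_pushforward.
Qed.

(** By Tonelli every coordinate contributes one factor [c]. The lemma serves on two levels:
    coordinates of a row, and rows of a matrix. *)
Lemma integral_power_map d (T : measurableType d) (l : {sigma_finite_measure set T -> \bar R})
    n (h : 'I_n -> T -> T) (c : R) (f : n.-tuple T -> \bar R) : (0 <= c)%R ->
  (forall i, measurable_fun setT (h i)) ->
  (forall i g, measurable_fun setT g -> (forall x, 0 <= g x) ->
     \int[l]_x g (h i x) = c%:E * \int[l]_x g x) ->
  measurable_fun setT f -> (forall t, 0 <= f t) ->
  \int[power_measure l n]_t f [tuple h i (tnth t i) | i < n] =
  (c ^+ n)%:E * \int[power_measure l n]_t f t.
Proof.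
move=> c0 mh hE.
have mH k (h' : 'I_k -> T -> T) : (forall i, measurable_fun setT (h' i)) ->
    measurable_fun setT (fun t : k.-tuple T => [tuple h' i (tnth t i) | i < k]).
  move=> mh'; apply/measurable_fun_tnthP => i; rewrite /comp.
  by under eq_fun do rewrite tnth_mktuple; apply: (measurableT_comp (mh' i)); exact: measurable_tnth.
elim: n h mh hE f => [|n IH] h mh hE f mf f0.
  rewrite !integral_power0//; last by apply: (measurableT_comp mf); exact: mH.
  by rewrite expr0 mul1e; congr f; apply/val_inj; case: (mktuple _) => -[].
rewrite integral_power_cons//; last by apply: (measurableT_comp mf); exact: mH.
rewrite [in RHS]integral_power_cons//.
have mfc x : measurable_fun setT (fun t : n.-tuple T => f [tuple of x :: t]).
  by apply: (measurableT_comp mf); apply: measurable_cons.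
have mI : measurable_fun setT (fun x => \int[power_measure l n]_t f [tuple of x :: t]).
  apply: measurable_fun_integral => //.
  by apply: (measurableT_comp mf); exact: measurable_fun_cons_tuple.
have I0 x : 0 <= \int[power_measure l n]_t f [tuple of x :: t] by exact: integral_ge0.
transitivity (\int[l]_x ((c ^+ n)%:E * \int[power_measure l n]_t f [tuple of h ord0 x :: t])).
  apply: eq_integral => x _.
  rewrite -(IH (fun i => h (lift ord0 i)) _ _ (fun t => f [tuple of h ord0 x :: t]))//; last by move=> i; exact: hE.
  apply: eq_integral => t _; congr f; apply/eq_from_tnth => i.
  by rewrite tnth_mktuple; case: (unliftP ord0 i) => [j ->|->]; rewrite ?tnthS ?tnth0 ?tnth_mktuple.
suff key (J : T -> \bar R) : measurable_fun setT J -> (forall x, 0 <= J x) ->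
    \int[l]_x ((c ^+ n)%:E * J (h ord0 x)) = (c ^+ n.+1)%:E * \int[l]_x J x by exact: key.
move=> mJ J0; rewrite ge0_integralZl//; last 2 first.
- exact: (measurableT_comp mJ (mh ord0)).
- by rewrite lee_fin exprn_ge0.
by rewrite (hE ord0 _ mJ J0) muleA -EFinM -exprSr.
Qed.

Lemma integral_row_shift d (v : 'rV[R]_d) (F : 'rV[R]_d -> \bar R) :
  mfun_row F -> (forall x, 0 <= F x) ->
  \int[lebesgue_power d]_x F (row_of x + v)%R = \int[lebesgue_power d]_x F (row_of x).
Proof.
move=> mF F0; pose h (i : 'I_d) (x : measurableTypeR R) : measurableTypeR R := (1 * x + v 0 i)%R.
have hE (x : coordinates R d) : row_of [tuple h i (tnth x i) | i < d] = (row_of x + v)%R.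
  by apply/rowP => i; rewrite !mxE tnth_mktuple /h mul1r.
transitivity (\int[lebesgue_power d]_x F (row_of [tuple h i (tnth x i) | i < d])).
  by under [in RHS]eq_integral do rewrite hE.
rewrite -[RHS]mul1e -[X in X%:E * _](expr1n R d).
apply: (@integral_power_map _ _ leb _ h 1%R (fun x => F (row_of x))) => //.
- by move=> i; apply: measurable_funD => //; apply: measurable_funM.
- by move=> i g mg g0; rewrite integral_affine// ?oner_eq0// invr1 normr1.
Qed.

Lemma integral_row_scale d (r : R) (F : 'rV[R]_d -> \bar R) : (0 < r)%R ->
  mfun_row F -> (forall x, 0 <= F x) ->
  \int[lebesgue_power d]_x F (r *: row_of x)%R = (r^-1 ^+ d)%:E * \int[lebesgue_power d]_x F (row_of x).
Proof.
move=> r0 mF F0; pose h (i : 'I_d) (x : measurableTypeR R) : measurableTypeR R := (r * x + 0)%R.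
have hE (x : coordinates R d) : row_of [tuple h i (tnth x i) | i < d] = (r *: row_of x)%R.
  by apply/rowP => i; rewrite !mxE tnth_mktuple /h addr0.
have rV : (0 <= r^-1)%R by rewrite invr_ge0 ltW.
transitivity (\int[lebesgue_power d]_x F (row_of [tuple h i (tnth x i) | i < d])).
  by under [in RHS]eq_integral do rewrite hE.
apply: (@integral_power_map _ _ leb _ h r^-1%R (fun x => F (row_of x))) => //.
- by move=> i; apply: measurable_funD => //; apply: measurable_funM.
- by move=> i g mg g0; rewrite integral_affine ?gt_eqF// ger0_norm.
Qed.

Lemma integral_mx_shift d p (M : 'M[R]_(p, d)) (F : 'M[R]_(p, d) -> \bar R) :
  mfun_mx F -> (forall x, 0 <= F x) ->
  \int[power_measure (lebesgue_power d) p]_x F (mx_of x + M)%R =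
  \int[power_measure (lebesgue_power d) p]_x F (mx_of x).
Proof.
move=> mF F0; pose h (i : 'I_p) (x : coordinates R d) := of_row (row_of x + row i M)%R.
have hE (x : p.-tuple (coordinates R d)) : mx_of [tuple h i (tnth x i) | i < p] = (mx_of x + M)%R.
  by apply/matrixP => i j; rewrite !mxE !tnth_mktuple !mxE.
transitivity (\int[power_measure (lebesgue_power d) p]_x F (mx_of [tuple h i (tnth x i) | i < p])).
  by under [in RHS]eq_integral do rewrite hE.
rewrite -[RHS]mul1e -[X in X%:E * _](expr1n R p).
apply: (@integral_power_map _ _ (lebesgue_power d) _ h 1%R (fun x => F (mx_of x))) => //.
- move=> i; rewrite /h; apply: measurable_of_row.
  mfunx.
- move=> i g mg g0; rewrite mul1e.
  rewrite (@integral_row_shift d (row i M) (fun v => g (of_row v)))//.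
    by under eq_integral do rewrite row_ofK.
  by rewrite /mfun_row; under eq_fun do rewrite row_ofK.
Qed.

Lemma integral_mx_scale d p (r : R) (F : 'M[R]_(p, d) -> \bar R) : (0 < r)%R ->
  mfun_mx F -> (forall x, 0 <= F x) ->
  \int[power_measure (lebesgue_power d) p]_x F (r *: mx_of x)%R =
  (r^-1 ^+ (d * p))%:E * \int[power_measure (lebesgue_power d) p]_x F (mx_of x).
Proof.
move=> r0 mF F0; pose h (i : 'I_p) (x : coordinates R d) := of_row (r *: row_of x)%R.
have hE (x : p.-tuple (coordinates R d)) : mx_of [tuple h i (tnth x i) | i < p] = (r *: mx_of x)%R.
  by apply/matrixP => i j; rewrite !mxE !tnth_mktuple !mxE.
have rV : (0 <= r^-1 ^+ d)%R by rewrite exprn_ge0// invr_ge0 ltW.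
transitivity (\int[power_measure (lebesgue_power d) p]_x F (mx_of [tuple h i (tnth x i) | i < p])).
  by under [in RHS]eq_integral do rewrite hE.
rewrite exprM; apply: (@integral_power_map _ _ (lebesgue_power d) _ h _ (fun x => F (mx_of x))) => //.
- move=> i; rewrite /h; apply: measurable_of_row.
  mfunx.
- move=> i g mg g0.
  rewrite (@integral_row_scale d r (fun v => g (of_row v)))//.
    by under eq_integral do rewrite row_ofK.
  by rewrite /mfun_row; under eq_fun do rewrite row_ofK.
Qed.

(* The translations along theta preserve Lebesgue measure. *)
Lemma integral_slice d (theta : 'rV[R]_d) (eta : R -> R) (F : 'rV[R]_d -> \bar R) :
  dot theta theta = 1%R -> measurable_fun setT eta -> (forall t, (0 <= eta t)%R) ->
  mfun_row F -> (forall x, 0 <= F x) ->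
  \int[leb]_t (eta t)%:E * \int[lebesgue_power d]_x F (row_of x) =
  \int[leb]_c \int[lebesgue_power d]_x ((eta (dot (row_of x) theta))%:E *
     F (row_of x - dot (row_of x) theta *: theta + c *: theta)%R).
Proof.
move=> th1 me e0 mF F0.
have me' d0 (T : measurableType d0) (f : T -> R) : measurable_fun setT f ->
   measurable_fun setT (fun t => (eta (f t))%:E).
  by move=> mf; mfun; exact: (measurableT_comp me mf).
have mF' d0 (T : measurableType d0) (f : T -> 'rV[R]_d) : measurable_mx f ->
   measurable_fun setT (fun t => F (f t)) by exact: mfun_row_comp.
have ee t : 0 <= (eta t)%:E by rewrite lee_fin.
have step x : \int[leb]_c ((eta (dot (row_of x) theta))%:E *
     F (row_of x - dot (row_of x) theta *: theta + c *: theta)%R) =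
   \int[leb]_c ((eta (dot (row_of x) theta))%:E * F (row_of x + c *: theta)%R).
  have := @integral_affine 1%R (- dot (row_of x) theta)%R
     (fun c => (eta (dot (row_of x) theta))%:E * F (row_of x + c *: theta)%R).
  rewrite invr1 normr1 mul1e => <-//; last 2 first.
  - by apply: emeasurable_funM => //; apply: mF'; mfunx.
  - by move=> c; rewrite mule_ge0.
  apply: eq_integral => c _; congr (_ * F _).
  by rewrite mul1r scalerDl scaleNr; rewrite -!addrA [(_ *: _ - _)%R]addrC.
(* After the translation [c] occurs only in the weight, whose integral over [c] splits off. *)
have shift c : \int[lebesgue_power d]_x ((eta (dot (row_of x) theta))%:E * F (row_of x + c *: theta)%R) =
   \int[lebesgue_power d]_x ((eta (dot (row_of x) theta - c))%:E * F (row_of x)).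
  rewrite -(@integral_row_shift d (c *: theta)%R (fun x => (eta (dot x theta - c))%:E * F x))//.
  - by apply: eq_integral => x _; rewrite dotDl dotZl th1 mulr1 addrK.
  - by rewrite /mfun_row; apply: emeasurable_funM => //; apply: me'; mfunx.
  - by move=> x; rewrite mule_ge0.
rewrite tonelli; last 2 first.
- by apply: emeasurable_funM; [apply: me'; mfunx|apply: mF'; mfunx].
- by move=> c x; rewrite mule_ge0.
under [RHS]eq_integral do rewrite step.
rewrite tonelli; last 2 first.
- by apply: emeasurable_funM; [apply: me'; mfunx|apply: mF'; mfunx].
- by move=> c x; rewrite mule_ge0.
under [RHS]eq_integral do rewrite shift.
rewrite tonelli; last 2 first.
- by apply: emeasurable_funM; [apply: me'; mfunx|apply: mF'; mfunx].
- by move=> c x; rewrite mule_ge0.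
rewrite -ge0_integralZl//; last by exact: integral_ge0.
apply: eq_integral => x _; rewrite ge0_integralZr//; last by apply: me'; mfunx.
congr (_ * _); have := @integral_affine (-1)%R (dot (row_of x) theta) (fun c => (eta c)%:E).
rewrite invrN1 normrN1 mul1e => <-//; last exact: me'.
  by apply: eq_integral => c _; rewrite mulN1r addrC.
Qed.

End lebesgue_transformations.

(** * Independence of the height and the differences *)

Section slice_factorization.
Context {R : realType}.

(** [powR] does not vanish at negative bases. The cutoff builds the indicator of the open ball into
    the density and makes [pospowM] hold for every sign of [r]. *)
Definition pospow (beta r : R) : R := r `^ beta * (0 < r)%R%:R.

Lemma pospow_ge0 beta r : 0 <= pospow beta r.
Proof. by rewrite mulr_ge0 ?powR_ge0. Qed.

Lemma pospow_gt0E beta r : 0 < r -> pospow beta r = r `^ beta.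
Proof. by move=> r0; rewrite /pospow r0 mulr1. Qed.

Lemma pospow_le0 beta r : r <= 0 -> pospow beta r = 0.
Proof. by move=> r0; rewrite /pospow ltNge r0 mulr0. Qed.

Lemma pospowM beta c r : 0 < c -> pospow beta (c * r) = c `^ beta * pospow beta r.
Proof.
move=> c0; have [r0|r0] := ltP 0 r.
  by rewrite !pospow_gt0E ?mulr_gt0// powRM// ltW.
by rewrite !pospow_le0 ?mulr0// pmulr_rle0.
Qed.

Lemma measurable_pospow d0 (T : measurableType d0) beta (f : T -> R) :
  measurable_fun setT f -> measurable_fun setT (fun t => pospow beta (f t)).
Proof. by move=> mf; rewrite /pospow; mfun. Qed.

Section kernel.
Variables (d p : nat) (beta : R).

(** For s = 1 this is, up to a constant, the joint density of p + 1 beta points, in terms of one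
    point and its differences to the others. The squared radius [s] is a parameter because the slice
    of the unit ball at height c is a ball with s = 1 - c^2. *)
Definition ball_kernel (s : R) (x : 'rV[R]_d) (D : 'M[R]_(p, d)) : R :=
  pospow beta (s - dot x x) *
  \prod_(i < p) pospow beta (s - dot (x + row i D) (x + row i D)).

Lemma ball_kernel_ge0 s x D : 0 <= ball_kernel s x D.
Proof. by rewrite mulr_ge0 ?pospow_ge0// prodr_ge0// => i _; exact: pospow_ge0. Qed.

Lemma ball_kernel_le0 s x D : s <= 0 -> ball_kernel s x D = 0.
Proof.
move=> s0; rewrite /ball_kernel pospow_le0 ?mul0r//.
by rewrite subr_le0 (le_trans s0)// dot_ge0.
Qed.

Lemma ball_kernelZ s x D r : 0 < r ->
  ball_kernel (r ^+ 2 * s) (r *: x) (r *: D) =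
  (r ^+ 2) `^ beta ^+ p.+1 * ball_kernel s x D.
Proof.
move=> r0; have r20 : 0 < r ^+ 2 by rewrite exprn_gt0.
have E y : r ^+ 2 * s - dot (r *: y) (r *: y) = r ^+ 2 * (s - dot y y).
  by rewrite dotZl dotZr; ring.
rewrite /ball_kernel E pospowM//.
under eq_bigr => i _ do rewrite linearZ/= -scalerDr E pospowM//.
by rewrite big_split/= prodr_const card_ord [_ ^+ p.+1]exprS mulrACA.
Qed.

(** Pythagoras: all the points share the component c along [th]. *)
Lemma ball_kernel_slice s x D (th : 'rV[R]_d) c : dot th th = 1 -> dot x th = 0 ->
  (forall i, dot (row i D) th = 0) ->
  ball_kernel s (x + c *: th) D = ball_kernel (s - c ^+ 2) x D.
Proof.
move=> th1 xth Dth.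
have E y : dot y th = 0 -> s - dot (y + c *: th) (y + c *: th) = s - c ^+ 2 - dot y y.
  by move=> yth; rewrite !(dotDl, dotDr) !(dotZl, dotZr) [dot th y]dotC yth th1; ring.
rewrite /ball_kernel E//; congr (_ * _); apply: eq_bigr => i _.
by rewrite addrAC E// dotDl xth Dth addr0.
Qed.

Lemma measurable_ball_kernel d0 (T : measurableType d0) (s : T -> R)
    (x : T -> 'rV[R]_d) (D : T -> 'M[R]_(p, d)) :
  measurable_fun setT s -> measurable_mx x -> measurable_mx D ->
  measurable_fun setT (fun t => ball_kernel (s t) (x t) (D t)).
Proof.
move=> ms mx mD; have mrow i : measurable_mx (fun t => row i (D t)).
  by move=> a b; under eq_fun do rewrite mxE; exact: mD.
apply: measurable_funM; first by apply: measurable_pospow; mfunx.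
by apply: measurable_prod => i _; apply: measurable_pospow; mfunx.
Qed.

End kernel.

Local Open Scope ereal_scope.
Notation leb := (@lebesgue_measure R).

(** A weight of mass 1 for the coordinate along theta: it turns an integral over the orthogonal
    hyperplane into one over a slab of R^d. *)
Let eta (t : R) : R := ((0 <= t)%R%:R * (t <= 1)%R%:R)%R.

Let eta_ge0 t : (0 <= eta t)%R. Proof. by rewrite mulr_ge0. Qed.

Let measurable_eta d0 (T : measurableType d0) (f : T -> R) :
  measurable_fun setT f -> measurable_fun setT (fun t => eta (f t)).
Proof. by move=> mf; rewrite /eta; mfun. Qed.

Let int_eta : \int[leb]_t (eta t)%:E = 1.
Proof.
transitivity (\int[leb]_(t in `[0%R, 1%R]) (cst 1) t); last first.
  rewrite integral_cst//= mul1e.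
  have -> : leb `[0%R, 1%R]%classic = 1 :> \bar R; last by [].
  by rewrite lebesgue_measure_itv/= lte_fin ltr01 -EFinB subr0.
rewrite [RHS]integral_mkcond; apply: eq_integral => t _.
rewrite patchE /eta -natrM mulnb; case: ifPn.
  by rewrite inE/= in_itv/= => ->.
by rewrite notin_setE/= in_itv/= => /negP/negbTE ->.
Qed.

(** If [F] is constant along [th], the weight matters only through its mass. This repairs the weight
    after rescaling by r, which turns eta(t) into eta(r t). *)
Let eta_swap d (th : 'rV[R]_d) (eta' : R -> R) (F : 'rV[R]_d -> \bar R) :
  dot th th = 1%R -> measurable_fun setT eta' -> (forall t, 0 <= eta' t)%R ->
  mfun_row F -> (forall x, 0 <= F x) ->
  (forall x c, F (x + c *: th)%R = F x) ->
  \int[lebesgue_power d]_x ((eta' (dot (row_of x) th))%:E * F (row_of x)) =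
  \int[leb]_t (eta' t)%:E *
  \int[lebesgue_power d]_x ((eta (dot (row_of x) th))%:E * F (row_of x)).
Proof.
move=> th1 me' e'0 mF F0 FE.
have me : measurable_fun setT eta by apply: measurable_eta; mfun.
have mF' d0 (T : measurableType d0) (f : T -> 'rV[R]_d) : measurable_mx f ->
   measurable_fun setT (fun t => F (f t)) by exact: mfun_row_comp.
have me'' d0 (T : measurableType d0) (f : T -> R) : measurable_fun setT f ->
   measurable_fun setT (fun t => (eta' (f t))%:E).
  by move=> mf; mfun; exact: (measurableT_comp me' mf).
have := @integral_slice R d th eta (fun x => (eta' (dot x th))%:E * F x) th1 me eta_ge0.
rewrite int_eta mul1e => ->; last 2 first.
- by rewrite /mfun_row; apply: emeasurable_funM => //; apply: me''; mfunx.
- by move=> x; rewrite mule_ge0 ?lee_fin.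
have I0 : 0 <= \int[lebesgue_power d]_x ((eta (dot (row_of x) th))%:E * F (row_of x)).
  by apply: integral_ge0 => x _; rewrite mule_ge0 ?lee_fin.
rewrite -ge0_integralZr//; last 2 first.
- by mfun.
- by move=> t _; rewrite lee_fin.
apply: eq_integral => c _; rewrite -ge0_integralZl//; last 3 first.
- apply: emeasurable_funM => //; mfun; apply: measurable_eta; mfunx.
- by move=> x _; rewrite mule_ge0 ?lee_fin.
- by rewrite lee_fin.
apply: eq_integral => x _; rewrite muleCA; congr (_ * (_ * _)).
  by congr (eta' _)%:E; rewrite dotDl dotBl !dotZl th1; ring.
by rewrite addrAC -addrA -scalerBl FE.
Qed.

(** [psi] and [theta] are homogeneous of degree 0, so they do not see the rescaling that maps the
    slice at height h to the one at height 0. [K] is the integral over the slice at height 0; it is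
    chosen before [G], so it cancels when two functions [G] are compared. *)
Lemma ball_kernel_factorization d p (beta : R) (psi : 'M[R]_(p, d) -> R)
    (theta : 'M[R]_(p, d) -> 'rV[R]_d) :
  mfun_mx psi -> measurable_mx (fun t => theta (mx_of t)) ->
  (forall D, 0 <= psi D)%R ->
  (forall D r, 0 < r -> psi (r *: D) = psi D)%R ->
  (forall D r, 0 < r -> theta (r *: D) = theta D)%R ->
  (forall D, psi D != 0 -> dot (theta D) (theta D) = 1 /\
     forall i, dot (row i D) (theta D) = 0)%R ->
  exists2 K : \bar R, 0 <= K & forall G : R -> R,
    measurable_fun setT G -> (forall t, 0 <= G t)%R ->
    \int[power_measure (lebesgue_power d) p]_D \int[lebesgue_power d]_x
      (psi (mx_of D) * G (dot (row_of x) (theta (mx_of D))) *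
       ball_kernel beta 1 (row_of x) (mx_of D))%:E =
    K * \int[leb]_h (G h * pospow (((2 * beta + d%:R) * p.+1%:R - 1) / 2) (1 - h ^+ 2))%:E.
Proof.
move=> mpsi mth psi0 psiZ thZ psith.
have mth' d0 (T : measurableType d0) (f : T -> 'M[R]_(p, d)) : measurable_mx f ->
   measurable_mx (fun t => theta (f t)).
  move=> mf i j; apply: (mfun_mx_comp (F := fun D => theta D i j)) => //.
  exact: mth.
have mpsi' d0 (T : measurableType d0) (f : T -> 'M[R]_(p, d)) : measurable_mx f ->
   measurable_fun setT (fun t => psi (f t)) by exact: mfun_mx_comp.
pose perp (D : 'M[R]_(p, d)) (x : 'rV[R]_d) := (x - dot x (theta D) *: theta D)%R.
have perpZ D r x : (0 < r)%R -> perp (r *: D)%R (r *: x)%R = (r *: perp D x)%R.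
  by move=> r0; rewrite /perp thZ// dotZl scalerBr scalerA.
pose Q r D x := (psi D * eta (r * dot x (theta D)) * ball_kernel beta 1 (perp D x) D)%R.
have Q0 r D x : (0 <= Q r D x)%R by rewrite mulr_ge0 ?ball_kernel_ge0// mulr_ge0 ?eta_ge0.
have mQ r d0 (T : measurableType d0) (f : T -> 'M[R]_(p, d)) (x : T -> 'rV[R]_d) :
    measurable_mx f -> measurable_mx x -> measurable_fun setT (fun t => (Q r (f t) (x t))%:E).
  move=> mf mx; rewrite /Q; mfunx; first exact: mpsi'.
    by apply: measurable_eta; mfunx; exact: mth'.
  by apply: measurable_ball_kernel => //; rewrite /perp; mfunx; exact: mth'.
exists (\int[power_measure (lebesgue_power d) p]_D \int[lebesgue_power d]_x
  (Q 1%R (mx_of D) (row_of x))%:E).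
  by apply: integral_ge0 => D _; apply: integral_ge0 => x _; rewrite lee_fin.
move=> G mG G0; set K := (X in _ = X * _); have K0 : 0 <= K.
  by apply: integral_ge0 => D _; apply: integral_ge0 => x _; rewrite lee_fin.
set gam := (_ / 2)%R.
have mG' d0 (T : measurableType d0) (f : T -> R) : measurable_fun setT f ->
   measurable_fun setT (fun t => G (f t)) by exact: (measurableT_comp mG).
pose P c D x := (psi D * eta (dot x (theta D)) * G c *
  ball_kernel beta (1 - c ^+ 2) (perp D x) D)%R.
have P0 c D x : (0 <= P c D x)%R by rewrite mulr_ge0 ?ball_kernel_ge0// mulr_ge0// mulr_ge0 ?eta_ge0.
have mP d0 (T : measurableType d0) (c : T -> R) (f : T -> 'M[R]_(p, d)) (x : T -> 'rV[R]_d) :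
    measurable_fun setT c -> measurable_mx f -> measurable_mx x ->
    measurable_fun setT (fun t => (P (c t) (f t) (x t))%:E).
  move=> mc mf mx; rewrite /P; mfunx; [exact: mpsi'| | exact: mG' |].
    by apply: measurable_eta; mfunx; exact: mth'.
  by apply: measurable_ball_kernel; rewrite /perp; mfunx; exact: mth'.
transitivity (\int[power_measure (lebesgue_power d) p]_D \int[leb]_c
    \int[lebesgue_power d]_x (P c (mx_of D) (row_of x))%:E).
  apply: eq_integral => t _; set D := mx_of t.
  have [pD0|pD0] := eqVneq (psi D) 0%R.
    rewrite integral0_eq; last by move=> x _; rewrite pD0 !mul0r.
    rewrite integral0_eq// => c _; rewrite integral0_eq// => x _.
    by rewrite /P pD0 !mul0r.
  have [th1 Dth] := psith D pD0.
  have me : measurable_fun setT eta by apply: measurable_eta; mfun.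
  have := @integral_slice R d (theta D) eta (fun x => (psi D * G (dot x (theta D)) * ball_kernel beta 1 x D)%:E) th1 me eta_ge0.
  rewrite int_eta mul1e => ->; last 2 first.
  - by rewrite /mfun_row; mfunx; [apply: mG'; mfunx|apply: measurable_ball_kernel; mfunx].
  - by move=> x; rewrite lee_fin mulr_ge0 ?ball_kernel_ge0// mulr_ge0.
  apply: eq_integral => c _; apply: eq_integral => x _.
  have xth : dot (perp D (row_of x)) (theta D) = 0%R by rewrite dotBl dotZl th1; ring.
  rewrite -EFinM -/(perp D _) dotDl xth dotZl th1 mulr1 add0r ball_kernel_slice// /P; congr (_)%:E.
  by move: (eta _) (psi D) (G c) (ball_kernel _ _ _ _) => a b e f; ring.
rewrite tonelli; last 2 first.
- apply: measurable_fun_integral; last by move=> z x; rewrite lee_fin.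
  by apply: mP; mfunx.
- by move=> D c; apply: integral_ge0 => x _; rewrite lee_fin.
rewrite -ge0_integralZl//; last 2 first.
- mfun; apply: measurable_pospow; mfun.
- by move=> h _; rewrite lee_fin mulr_ge0 ?pospow_ge0.
apply: eq_integral => c _.
(* Slices at |c| >= 1 miss the open ball, and both sides vanish. *)
have [c1|c1] := leP (1 - c ^+ 2)%R 0%R.
  rewrite pospow_le0// mulr0 mule0 integral0_eq// => D _.
  by rewrite integral0_eq// => x _; rewrite /P ball_kernel_le0// mulr0.
pose r := Num.sqrt (1 - c ^+ 2)%R.
have r0 : (0 < r)%R by rewrite sqrtr_gt0.
have r2 : (1 - c ^+ 2 = r ^+ 2)%R by rewrite sqr_sqrtr// ltW.
have mIP : mfun_mx (fun D : 'M[R]_(p, d) => \int[lebesgue_power d]_x (P c D (row_of x))%:E).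
  rewrite /mfun_mx; apply: measurable_fun_integral; last by move=> z x; rewrite lee_fin.
  by apply: mP; mfunx.
have IP0 (D : 'M[R]_(p, d)) : 0 <= \int[lebesgue_power d]_x (P c D (row_of x))%:E.
  by apply: integral_ge0 => x _; rewrite lee_fin.
have rn0 k : (0 <= r ^+ k)%R by rewrite exprn_ge0// ltW.
have rK k : (r ^+ k * r^-1 ^+ k = 1)%R by rewrite -exprMn divff ?gt_eqF// expr1n.
(* The differences are rescaled here and the point [x] in the next step. *)
transitivity ((r ^+ (d * p))%:E * \int[power_measure (lebesgue_power d) p]_D
    \int[lebesgue_power d]_x (P c (r *: mx_of D)%R (row_of x))%:E).
  rewrite (@integral_mx_scale R d p r (fun D => \int[lebesgue_power d]_x (P c D (row_of x))%:E))//.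
  by rewrite muleA -EFinM rK mul1e.
transitivity ((r ^+ (d * p))%:E * \int[power_measure (lebesgue_power d) p]_D
    ((r ^+ d * (G c * (r ^+ 2) `^ beta ^+ p.+1))%:E * \int[lebesgue_power d]_x (Q r (mx_of D) (row_of x))%:E)).
  congr (_ * _); apply: eq_integral => t _; set D := mx_of t.
  transitivity ((r ^+ d)%:E * \int[lebesgue_power d]_x (P c (r *: D)%R (r *: row_of x)%R)%:E).
    rewrite (@integral_row_scale R d r (fun x => (P c (r *: D)%R x)%:E))//.
    - by rewrite muleA -EFinM rK mul1e.
    - by rewrite /mfun_row; apply: mP; mfunx.
    - by move=> x; rewrite lee_fin.
  rewrite EFinM -muleA; congr (_ * _); rewrite -ge0_integralZl//; last 3 first.
  - by apply: mQ; mfunx.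
  - by move=> x _; rewrite lee_fin.
  - by rewrite lee_fin mulr_ge0// exprn_ge0// powR_ge0.
  apply: eq_integral => x _; rewrite -EFinM; congr (_)%:E.
  rewrite /P /Q psiZ// thZ// dotZl perpZ// r2 -[X in ball_kernel _ X](mulr1 (r ^+ 2)%R) ball_kernelZ//.
  by move: (eta _) (psi D) (G c) (ball_kernel _ _ _ _) (_ `^ _)%R => a b e f g; ring.
have mIQ : measurable_fun setT (fun D : p.-tuple (coordinates R d) =>
    \int[lebesgue_power d]_x (Q r (mx_of D) (row_of x))%:E).
  apply: measurable_fun_integral; last by move=> z x; rewrite lee_fin.
  by apply: mQ; mfunx.
have IQ0 D : 0 <= \int[lebesgue_power d]_x (Q r (mx_of D) (row_of x))%:E.
  by apply: integral_ge0 => x _; rewrite lee_fin.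
rewrite ge0_integralZl//; last by rewrite lee_fin !mulr_ge0// exprn_ge0// powR_ge0.
(* The rescaled slab has the weight eta(r t) of mass 1/r; this is the -1 in the exponent (alpha |S|
   - 1)/2. *)
have -> : \int[power_measure (lebesgue_power d) p]_D
    \int[lebesgue_power d]_x (Q r (mx_of D) (row_of x))%:E = r^-1%:E * K.
  rewrite /K -ge0_integralZl//; last 3 first.
  - apply: measurable_fun_integral; last by move=> z x; rewrite lee_fin.
    by apply: mQ; mfunx.
  - by move=> D _; apply: integral_ge0 => x _; rewrite lee_fin.
  - by rewrite lee_fin invr_ge0 ltW.
  apply: eq_integral => t _; set D := mx_of t.
  have [pD0|pD0] := eqVneq (psi D) 0%R.
    rewrite integral0_eq; last by move=> x _; rewrite /Q pD0 !mul0r.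
    by rewrite integral0_eq ?mule0// => x _; rewrite /Q pD0 !mul0r.
  have [th1 Dth] := psith D pD0.
  have := @eta_swap d (theta D) (fun t => eta (r * t)%R)
    (fun x => (psi D * ball_kernel beta 1 (perp D x) D)%:E) th1.
  have -> : \int[leb]_t (eta (r * t))%:E = r^-1%:E.
    have := @integral_affine R r 0%R (fun t => (eta t)%:E).
    rewrite int_eta mule1 ger0_norm ?invr_ge0 ?ltW// => <-.
    - by apply: eq_integral => u _; rewrite addr0.
    - by rewrite gt_eqF.
    - by mfun; apply: measurable_eta; mfun.
    - by move=> u; rewrite lee_fin.
  move=> swap; etransitivity; last etransitivity; last 1 first.
  - apply: congr1; apply: eq_integral => x _.
    by rewrite /Q mul1r mulrAC [X in X%:E]mulrC EFinM.
  - by apply: eq_integral => x _; rewrite /Q mulrAC [X in X%:E]mulrC EFinM.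
  apply: swap.
  - by apply: measurable_eta; mfun.
  - by move=> u; exact: eta_ge0.
  - by rewrite /mfun_row; mfunx; apply: measurable_ball_kernel; rewrite /perp; mfunx.
  - by move=> x; rewrite lee_fin mulr_ge0 ?ball_kernel_ge0.
  move=> x u; congr (_ * ball_kernel _ _ _ _)%:E.
  by rewrite /perp dotDl dotZl th1 mulr1 scalerDl opprD addrACA subrr addr0.
rewrite [RHS]muleC !muleA -!EFinM; congr (_%:E * _).
rewrite r2 pospow_gt0E ?exprn_gt0// -!powR_mulrn ?powR_ge0 ?ltW//.
rewrite -powR_inv1 ?ltW// -!powRrM.
have rD a b : (r `^ (a + b) = r `^ a * r `^ b)%R.
  by rewrite powRD//; apply/implyP => _; rewrite gt_eqF.
have -> : (2 * gam = (d * p)%:R + d%:R + 2 * (beta * p.+1%:R) + -1)%R.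
  by rewrite /gam natrM -natr1; field.
by rewrite !rD; ring.
Qed.

End slice_factorization.

Ltac nneg := move=> *; rewrite ?lee_fin; repeat first
 [ assumption | exact: expR_ge0 | exact: powR_ge0 | exact: pospow_ge0 | exact: ball_kernel_ge0
 | exact: Gamma_ge0 | exact: ler0n | exact: sqrtr_ge0 | exact: ltW | exact: gauss_fun_ge0
 | match goal with H : forall _, is_true (_ <= _)%O |- _ => exact: H end
 | match goal with H : forall _ _, is_true (_ <= _)%O |- _ => exact: H end
 | apply: mulr_ge0 | apply: prodr_ge0 => * | apply: exprn_ge0 | apply: mule_ge0
 | apply: integral_ge0 => *; rewrite ?lee_fin ].

Ltac mside := solve [mfunx; repeat (apply: measurable_pospow; mfunx)].

Ltac iside := try first [mside | solve [nneg]].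

(** * The Gamma function and the normalization of the beta law *)

Section gamma.
Context {R : realType}.
Local Open Scope ereal_scope.
Notation leb := (@lebesgue_measure R).

Lemma integral_power_prod d (T : measurableType d) (l : {sigma_finite_measure set T -> \bar R})
    (b : T -> R) (c : R) n : measurable_fun setT b -> (forall x, 0 <= b x)%R ->
  \int[l]_x (b x)%:E = c%:E ->
  \int[power_measure l n]_t (\prod_(i < n) b (tnth t i))%:E = (c ^+ n)%:E.
Proof.
move=> mb b0 bc; have c0 : (0 <= c)%R.
  by rewrite -lee_fin -bc; apply: integral_ge0 => x _; rewrite lee_fin.
have mB k : measurable_fun setT (fun t : k.-tuple T => (\prod_(i < k) b (tnth t i))%:E).
  by mfun; apply: (measurableT_comp mb); mfun.
have B0 k (t : k.-tuple T) : 0 <= (\prod_(i < k) b (tnth t i))%:E.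
  by rewrite lee_fin prodr_ge0.
elim: n => [|n IH]; first by rewrite integral_power0// big_ord0 expr0.
rewrite integral_power_cons//.
transitivity (\int[l]_x ((b x)%:E * (c ^+ n)%:E)).
  apply: eq_integral => x _; rewrite -IH -ge0_integralZl//; last 2 first.
  - exact: mB.
  - by rewrite lee_fin.
  by apply: eq_integral => t _; rewrite -EFinM big_ord_recl tnth0; under eq_bigr do rewrite tnthS.
rewrite ge0_integralZr//; iside.
by rewrite bc -EFinM exprS.
Qed.

Lemma continuous_powR_gt0 (s t : R) : (0 < t)%R -> {for t, continuous (fun x : R => (x `^ s)%R)}.
Proof.
move=> t0; apply: differentiable_continuous; apply/derivable1_diffP.
by apply: derivable_powR; rewrite in_itv/= t0.
Qed.

Lemma integral_powR (s e : R) : (0 < s)%R -> (0 < e)%R -> (e < 1)%R ->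
  \int[leb]_(t in `[e, 1%R]) (t `^ (s - 1))%:E = ((1 - e `^ s) / s)%:E.
Proof.
move=> s0 e0 e1.
have ct (f : R -> R) : (forall x, (0 < x)%R -> {for x, continuous f}) -> {within `[e, 1%R], continuous f}.
  move=> cf; apply: continuous_in_subspaceT => x; rewrite inE/= in_itv/= => /andP[ex _].
  exact/cf/(lt_le_trans e0).
have c1 : {within `[e, 1%R], continuous (fun t => s * t `^ (s - 1))%R}.
  apply: ct => x x0; apply: cvgM; first exact: cvg_cst.
  exact: continuous_powR_gt0.
have c2 : derivable_oo_LRcontinuous (fun t : R => t `^ s)%R e 1%R.
  split.
  - move=> x; rewrite in_itv/= => /andP[ex _].
    by apply: derivable_powR; rewrite in_itv/= (lt_trans e0).
  - by apply: cvg_at_right_filter; exact: continuous_powR_gt0.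
  - by apply: cvg_at_left_filter; exact: continuous_powR_gt0.
have c3 : {in `]e, 1%R[, (fun t : R => t `^ s)%R^`()%classic =1 (fun t => s * t `^ (s - 1))%R}.
  by move=> x; rewrite in_itv/= => /andP[ex _]; rewrite powR_derive1// in_itv/= (lt_trans e0).
have := continuous_FTC2 e1 c1 c2 c3.
under eq_integral do rewrite EFinM.
rewrite ge0_integralZl//; last 3 first.
- apply/measurable_EFinP; apply: measurable_funTS; exact: measurable_powR.
- by move=> t _; rewrite lee_fin powR_ge0.
- by rewrite lee_fin ltW.
rewrite powR1 -EFinB => /(congr1 (fun z => (s^-1)%:E * z)).
by rewrite muleA -EFinM mulVf ?mul1e ?gt_eqF// -EFinM mulrC.
Qed.

Lemma integral_pospow01 (s : R) : (0 < s)%R ->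
  \int[leb]_t (pospow (s - 1) t * (t <= 1)%R%:R)%:E <= (s^-1)%:E.
Proof.
move=> s0.
(* These intervals exhaust ]0, 1] and stay away from the singularity at 0; [n.+2] keeps the left end
   below 1. *)
pose F n := `[(n.+2%:R^-1)%R : R, 1%R]%classic.
have -> : \int[leb]_t (pospow (s - 1) t * (t <= 1)%R%:R)%:E =
    \int[leb]_(t in \bigcup_n F n) (t `^ (s - 1))%:E.
  rewrite [RHS]integral_mkcond; apply: eq_integral => t _; rewrite patchE.
  case: ifPn; rewrite ?inE ?notin_setE.
    move=> [n _]; rewrite /F/= in_itv/= => /andP[nt t1].
    by rewrite pospow_gt0E ?t1 ?mulr1// (lt_le_trans _ nt)// invr_gt0.
  move=> nF; have [t1|] := boolP (t <= 1)%R; last by rewrite mulr0.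
  rewrite mulr1; have [t0|t0] := leP t 0%R; first by rewrite pospow_le0.
  exfalso; apply: nF; exists (Num.truncn t^-1) => //; rewrite /F/= in_itv/= t1 andbT.
  rewrite -[leRHS]invrK lef_pV2 ?posrE ?invr_gt0//.
  by rewrite (le_trans (ltW (truncnS_gt _)))// ler_nat.
have cv : (\int[leb]_(t in F n) (t `^ (s - 1))%:E) @[n --> \oo] -->
    \int[leb]_(t in \bigcup_n F n) (t `^ (s - 1))%:E.
  apply: ge0_nondecreasing_set_cvg_integral.
  - move=> m n mn; apply/subsetPset => t; rewrite /F/= !in_itv/= => /andP[mt ->].
    by rewrite andbT (le_trans _ mt)// lef_pV2 ?posrE// ler_nat.
  - by move=> n; exact: measurable_itv.
  - by move=> n; apply/measurable_EFinP; apply: measurable_funTS; exact: measurable_powR.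
  - by move=> n t _; rewrite lee_fin powR_ge0.
rewrite -(cvg_lim _ cv)//; apply: lime_le; first by apply/cvg_ex; eexists; exact: cv.
apply: nearW => n; rewrite integral_powR ?invr_gt0 ?invf_lt1 ?ltr1n//.
by rewrite lee_fin ler_piMl ?invr_ge0 ?(ltW s0)// gerBl powR_ge0.
Qed.

Lemma integral_exp_half : \int[leb]_t (expR (- t / 2) * (0 <= t)%R%:R)%:E = 2%:E.
Proof.
have h : (0 < 2^-1 :> R)%R by rewrite invr_gt0.
transitivity (\int[leb]_t (2%:E * (exponential_pdf 2^-1 t)%:E)).
  apply: eq_integral => t _; rewrite -EFinM /exponential_pdf patchE.
  case: ifPn; rewrite ?inE ?notin_setE/= in_itv/= ?andbT.
    by move=> ->; rewrite mulr1 mulrA divff// mul1r; congr (expR _)%:E; ring.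
  by move=> /negP/negbTE ->; rewrite !mulr0.
rewrite ge0_integralZl//; last 2 first.
- by apply/measurable_EFinP; exact: measurable_exponential_pdf.
- by move=> t _; rewrite lee_fin exponential_pdf_ge0// ltW.
by rewrite integral_exponential_pdf// mule1.
Qed.

Let gint (s : R) := \int[leb]_t (pospow (s - 1) t * expR (- t))%:E.

Let measurable_gint (s : R) : measurable_fun setT (fun t => (pospow (s - 1) t * expR (- t))%:E).
Proof. by mfun; apply: measurable_pospow; mfun. Qed.

Let gint_lty (s : R) : (0 < s)%R -> gint s < +oo.
Proof.
(* For t > 1, t^(s-1) <= t^(N+1) <= C e^(t/2), the last bound coming from the term
   (t/2)^(N+1)/(N+1)! of the exponential series. *)
move=> s0; pose N := Num.truncn s; pose C : R := (2 ^+ N.+1 * N.+1`!%:R)%R.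
have C0 : (0 <= C)%R by rewrite mulr_ge0// exprn_ge0.
have m1 : measurable_fun setT (fun t : R => (pospow (s - 1) t * (t <= 1)%R%:R)%:E).
  by mfun; apply: measurable_pospow; mfun.
have m2 : measurable_fun setT (fun t : R => (expR (- t / 2) * (0 <= t)%R%:R)%:E) by mfun.
have p1 (t : R) : 0 <= (pospow (s - 1) t * (t <= 1)%R%:R)%:E by rewrite lee_fin mulr_ge0// pospow_ge0.
have p2 (t : R) : 0 <= (expR (- t / 2) * (0 <= t)%R%:R)%:E by rewrite lee_fin mulr_ge0// expR_ge0.
apply: (@le_lt_trans _ _ (\int[leb]_t ((pospow (s - 1) t * (t <= 1)%R%:R)%:E +
    C%:E * (expR (- t / 2) * (0 <= t)%R%:R)%:E))).
  apply: ge0_le_integral => //.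
  - by move=> t _; rewrite lee_fin mulr_ge0 ?pospow_ge0 ?expR_ge0.
  - exact: measurable_gint.
  - by apply: emeasurable_funD => //; apply: emeasurable_funM.
  move=> t _; rewrite -EFinM -EFinD lee_fin.
  have [t0|t0] := leP t 0%R.
    by rewrite pospow_le0// !mul0r add0r !mulr_ge0 ?expR_ge0.
  have [t1|t1] := leP t 1%R.
    rewrite mulr1 -[leLHS]addr0 lerD// ?mulr_ge0 ?expR_ge0//.
    by rewrite ler_piMr ?pospow_ge0// -[leRHS]expR0 ler_expR oppr_le0 ltW.
  rewrite mulr0 add0r (ltW t0) mulr1 pospow_gt0E//.
  have -> : (expR (- t) = expR (- t / 2) * expR (- t / 2))%R by rewrite -expRD; congr expR; field.
  rewrite mulrA ler_pM2r ?expR_gt0//.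
  rewrite mulNr expRN ler_pdivrMr ?expR_gt0//.
  have t20 : (0 <= t / 2)%R by rewrite divr_ge0// ltW.
  have := expR_ge1Dxn N t20.
  move=> /(le_trans _) E; have {}E : ((t / 2) ^+ N.+1 / N.+1`!%:R <= expR (t / 2))%R by apply: E; rewrite lerDr.
  rewrite ler_pdivrMr ?ltr0n ?fact_gt0// in E.
  apply: (@le_trans _ _ (t ^+ N.+1)%R).
    rewrite -(powR_mulrn N.+1 (ltW t0)); apply: (ler_powR (ltW t1)).
    by rewrite lerBlDr (le_trans (ltW (truncnS_gt s)))// lerDl.
  have -> : (t ^+ N.+1 = 2 ^+ N.+1 * (t / 2) ^+ N.+1)%R by rewrite -exprMn; congr (_ ^+ _)%R; field.
  by rewrite /C -mulrA ler_pM2l ?exprn_gt0// [leRHS]mulrC.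
rewrite ge0_integralD//; iside.
rewrite ge0_integralZl// integral_exp_half lte_add_pinfty//.
- by apply: le_lt_trans (integral_pospow01 s0) _; rewrite ltry.
- by rewrite -EFinM ltry.
Qed.

(** [Gamma] is the [fine] part of an extended integral, so it equals that integral only once
    finiteness is known. *)
Lemma GammaE (s : R) : (0 < s)%R ->
  \int[leb]_t (pospow (s - 1) t * expR (- t))%:E = (Gamma s)%:E.
Proof.
move=> s0; have g0 : 0 <= gint s.
  by apply: integral_ge0 => t _; rewrite lee_fin mulr_ge0 ?pospow_ge0 ?expR_ge0.
have E : gint s = \int[leb]_(t in `]0%R, +oo[) (t `^ (s - 1) * expR (- t))%:E.
  rewrite [RHS]integral_mkcond; apply: eq_integral => t _; rewrite patchE.
  case: ifPn; rewrite ?inE ?notin_setE/= in_itv/= andbT; first by move=> /pospow_gt0E ->.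
  by move=> /negP; rewrite -leNgt => t0; rewrite pospow_le0// mul0r.
rewrite /Gamma /Rintegral -E fineK// ge0_fin_numE//; exact: gint_lty.
Qed.

Lemma Gamma_gt0 (s : R) : (0 < s)%R -> (0 < Gamma s)%R.
Proof.
move=> s0; rewrite -lte_fin -GammaE//.
(* A lower bound of the integrand on [1, 2], whatever the sign of s - 1. *)
pose c := (expR (- (`|s - 1| * ln 2)) * expR (- 2) : R)%R.
have c0 : (0 < c)%R by rewrite mulr_gt0 ?expR_gt0.
apply: (@lt_le_trans _ _ (\int[leb]_(t in `[1%R, 2%R]) (cst c%:E) t)).
  rewrite integral_cst//=.
  have -> : leb `[1%R, 2%R]%classic = 1 :> \bar R; last by rewrite mule1 lte_fin.
  by rewrite lebesgue_measure_itv/= lte_fin ltr1n/= -EFinB; congr (_%:E); ring.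
apply: (@le_trans _ _ (\int[leb]_(t in `[1%R, 2%R]) (pospow (s - 1) t * expR (- t))%:E)).
  apply: ge0_le_integral => //.
  - by move=> t _; rewrite lee_fin ltW.
  - by apply: measurable_funTS; exact: measurable_gint.
  move=> t /=; rewrite in_itv/= => /andP[t1 t2].
  have t0 : (0 < t)%R by exact: lt_le_trans t1.
  rewrite lee_fin ler_pM ?expR_ge0//; last by rewrite ler_expR lerN2.
  rewrite pospow_gt0E// /powR gt_eqF// ler_expR.
  apply: (@le_trans _ _ (- (`|s - 1| * ln t))%R).
    by rewrite lerN2 ler_wpM2l// ler_ln ?posrE.
  by rewrite -mulNr ler_wpM2r ?ln_ge0// lerNl -normrN ler_norm.
apply: ge0_subset_integral => //; first exact: measurable_gint.
by move=> t _; rewrite lee_fin mulr_ge0 ?pospow_ge0 ?expR_ge0.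
Qed.

Lemma integral_row_gauss d :
  \int[lebesgue_power d]_x (expR (- dot (row_of x) (row_of x)))%:E = ((pi : R) `^ (d%:R / 2))%:E.
Proof.
transitivity (\int[@lebesgue_power R d]_x (\prod_(i < d) gauss_fun (tnth x i))%:E).
  apply: eq_integral => x _; rewrite -expR_sum; congr (expR _)%:E.
  by rewrite -sumrN; apply: eq_bigr => i _; rewrite !mxE expr2.
rewrite (@integral_power_prod _ _ leb _ (Num.sqrt pi))//.
- congr (_%:E); rewrite mulrC powRrM powR12_sqrt ?pi_ge0//.
  by rewrite powR_mulrn ?sqrtr_ge0.
- exact: measurable_gauss_fun.
- by move=> x; exact: gauss_fun_ge0.
- exact: integralT_gauss.
Qed.

(** Integrate e^(-u) (u - |x|^2)^beta, cut off at u > |x|^2, in both orders. Scaling x by u^(1/2)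
    gives Gamma(d/2 + beta + 1) times the wanted integral, while shifting u by |x|^2 gives
    Gamma(beta + 1) times the Gaussian integral pi^(d/2). *)
Lemma integral_pospow_ball d (beta : R) : (-1 < beta)%R ->
  \int[lebesgue_power d]_x (pospow beta (1 - dot (row_of x) (row_of x)))%:E =
  ((beta_const d beta)^-1)%:E.
Proof.
move=> beta1; set V := LHS.
have b1 : (0 < beta + 1)%R by rewrite -ltrBlDr sub0r.
have bd1 : (0 < d%:R / 2 + beta + 1)%R by rewrite -addrA ltr_wpDl// divr_ge0.
have V0 : 0 <= V by apply: integral_ge0 => x _; rewrite lee_fin pospow_ge0.
pose H (u : R) (x : coordinates R d) := (expR (- u) * pospow beta (u - dot (row_of x) (row_of x)))%:E.
have H0 u x : 0 <= H u x by rewrite lee_fin mulr_ge0 ?expR_ge0 ?pospow_ge0.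
have E1 : \int[leb]_u \int[lebesgue_power d]_x H u x = (Gamma (d%:R / 2 + beta + 1))%:E * V.
  rewrite -GammaE// -ge0_integralZr//; iside.
  apply: eq_integral => u _.
  have [u0|u0] := leP u 0%R.
    rewrite pospow_le0// mul0r mul0e integral0_eq// => x _.
    by rewrite /H pospow_le0 ?mulr0// subr_le0 (le_trans u0)// dot_ge0.
  pose r := Num.sqrt u; have r0 : (0 < r)%R by rewrite sqrtr_gt0.
  have r2 : (r ^+ 2 = u)%R by rewrite sqr_sqrtr// ltW.
  have rK k : (r ^+ k * r^-1 ^+ k = 1)%R by rewrite -exprMn divff ?gt_eqF// expr1n.
  transitivity ((r ^+ d)%:E * \int[lebesgue_power d]_x (expR (- u) * pospow beta (u - dot (r *: row_of x) (r *: row_of x))%R)%:E).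
    rewrite (@integral_row_scale R d r (fun x => (expR (- u) * pospow beta (u - dot x x))%:E))//.
    - by rewrite muleA -EFinM rK mul1e.
    - by rewrite /mfun_row; mfunx; apply: measurable_pospow; mfunx.
    - by move=> x; rewrite lee_fin mulr_ge0 ?expR_ge0 ?pospow_ge0.
  transitivity ((r ^+ d)%:E * ((expR (- u) * u `^ beta)%:E * V)).
    congr (_ * _); rewrite -ge0_integralZl//; iside.
    apply: eq_integral => x _; rewrite -EFinM -mulrA -pospowM//; congr (_ * pospow _ _)%:E.
    by rewrite dotZl dotZr -r2; ring.
  rewrite muleA -EFinM; congr (_%:E * _); rewrite pospow_gt0E//.
  have -> : (d%:R / 2 + beta + 1 - 1 = 2^-1 * d%:R + beta)%R by ring.
  rewrite powRD; last by apply/implyP => _; rewrite gt_eqF.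
  by rewrite powRrM powR12_sqrt ?ltW// -/r powR_mulrn ?ltW//; ring.
have E2 : \int[leb]_u \int[lebesgue_power d]_x H u x = (pi `^ (d%:R / 2) * Gamma (beta + 1))%:E.
  rewrite tonelli//; try by rewrite /H; mside.
  rewrite EFinM -integral_row_gauss -ge0_integralZr//; iside.
  apply: eq_integral => x _; set q := dot _ _.
  rewrite -GammaE// addrK -ge0_integralZl//; iside.
  have := @integral_affine R 1%R q (fun u => (expR (- u) * pospow beta (u - q))%:E).
  rewrite invr1 normr1 mul1e => <-//.
  - apply: eq_integral => u _; rewrite -EFinM mul1r addrK opprD expRD.
    by congr (_%:E); ring.
  - mside.
  - nneg.
have G0 := Gamma_gt0 bd1.
rewrite /beta_const invf_div EFinM -E2 E1 muleAC -EFinM divff ?gt_eqF// mul1e//.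
Qed.

Lemma beta_const_gt0 d (beta : R) : (-1 < beta)%R -> (0 < beta_const d beta)%R.
Proof.
move=> beta1; have b1 : (0 < beta + 1)%R by rewrite -ltrBlDr sub0r.
by rewrite divr_gt0 ?mulr_gt0 ?Gamma_gt0 ?powR_gt0 ?pi_gt0// -addrA ltr_wpDl// divr_ge0.
Qed.

Lemma enorm_sqr d (x : 'rV[R]_d) : (enorm x ^+ 2 = dot x x)%R.
Proof.
rewrite /enorm sqr_sqrtr; last by apply: sumr_ge0 => i _; exact: sqr_ge0.
by apply: eq_bigr => i _; rewrite expr2.
Qed.

Lemma beta_densityE d (beta : R) (t : coordinates R d) :
  beta_density beta t = (beta_const d beta * pospow beta (1 - dot (row_of t) (row_of t)))%R.
Proof.
rewrite /beta_density enorm_sqr -mulrA; congr (_ * (_ * _))%R.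
rewrite indicE; congr (nat_of_bool _)%:R; rewrite subr_gt0 -enorm_sqr.
rewrite expr_lt1// ?sqrtr_ge0//.
by apply/idP/idP; rewrite inE.
Qed.

Lemma beta_lawT d (beta : R) : (-1 < beta)%R -> beta_law d beta setT = 1.
Proof.
move=> beta1; rewrite /beta_law gt_eqF//.
under eq_integral do rewrite beta_densityE EFinM.
have c0 := beta_const_gt0 d beta1.
rewrite ge0_integralZl//; iside.
by rewrite integral_pospow_ball// -EFinM divff// gt_eqF// beta_const_gt0.
Qed.

End gamma.

(** * One-dimensional marginals and the substitution h = sin phi *)

Section sine_substitution.
Context {R : realType}.
Local Open Scope ereal_scope.
Notation leb := (@lebesgue_measure R).

Lemma derive1_sin : (@sin R)^`()%classic = cos.
Proof.
apply/funext => x; rewrite derive1E.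
by have [_ ->] := is_derive_sin x.
Qed.

(** The intended [G] contains (1 - t^2)^gam, which may be unbounded at the ends -1 and 1. So the
    substitution is made on compact subintervals, where [G] is continuous, and extended by monotone
    convergence. *)
Lemma integral_sin_substitution (phi : R) (G : R -> R) :
  (- (pi / 2) < phi)%R -> (phi <= pi / 2)%R ->
  measurable_fun setT G -> (forall t, 0 <= G t)%R ->
  (forall a b, -1 < a -> a <= b -> b < 1 -> {within `[a, b], continuous G})%R ->
  \int[leb]_(t in `](-1)%R, sin phi[) (G t)%:E =
  \int[leb]_(x in `](- (pi / 2))%R, phi[) (G (sin x) * cos x)%:E.
Proof.
move=> phi1 phi2 mG G0 cG; pose w := (phi + pi / 2)%R.
have w0 : (0 < w)%R by rewrite /w -ltrBlDr sub0r.
(* [n.+3] keeps the margin below a third of the length [w], so the two cut ends do not cross. *)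
pose e n : R := (w / n.+3%:R)%R.
have e0 n : (0 < e n)%R by rewrite divr_gt0.
have e_le m n : (m <= n)%N -> (e n <= e m)%R.
  by move=> mn; rewrite ler_pM2l// lef_pV2 ?posrE// ler_nat.
have e3 n : (e n <= w / 3)%R by rewrite ler_pM2l// lef_pV2 ?posrE// ler_nat.
pose a n : R := (- (pi / 2) + e n)%R; pose b n : R := (phi - e n)%R.
have ab n : (a n <= b n)%R.
  by rewrite /a /b; have := e3 n; rewrite /w; lra.
have aI n : (- (pi / 2) < a n)%R by rewrite ltrDl.
have bI n : (b n < phi)%R by rewrite gtrBl.
have cov x : (- (pi / 2) < x)%R -> (x < phi)%R -> exists n, (a n <= x <= b n)%R.
  move=> x1 x2; pose m := Num.min (x + pi / 2)%R (phi - x)%R.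
  have m0 : (0 < m)%R by rewrite lt_min -ltrBlDr sub0r x1 subr_gt0.
  exists (Num.truncn (w / m)).
  have : (e (Num.truncn (w / m)) <= m)%R.
    rewrite ler_pdivrMr// -ler_pdivrMl// mulrC (le_trans (ltW (truncnS_gt _)))//.
    by rewrite ler_nat !ltnS leqW.
  by rewrite le_min /a /b => /andP[]; lra.
have pih (x : R) : (- (pi / 2) <= x)%R -> (x <= phi)%R -> x \in `[(- (pi / 2))%R, (pi / 2)%R].
  by move=> x1 x2; rewrite in_itv/= x1 (le_trans x2).
have phiI : phi \in `[(- (pi / 2))%R, (pi / 2)%R] by apply: pih => //; exact: ltW.
have aP n : a n \in `[(- (pi / 2))%R, (pi / 2)%R].
  by apply: pih; [exact: ltW|exact: le_trans (ab n) (ltW (bI n))].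
have bP n : b n \in `[(- (pi / 2))%R, (pi / 2)%R].
  by apply: pih; [exact: le_trans (ltW (aI n)) (ab n)|exact: ltW].
have Npih : (- (pi / 2))%R \in `[(- (pi / 2))%R, (pi / 2 : R)%R].
  by apply: pih => //; exact: ltW.
have pihP : (pi / 2)%R \in `[(- (pi / 2))%R, (pi / 2 : R)%R].
  by rewrite in_itv/= lexx andbT (le_trans (ltW phi1)).
have sNpi : sin (- (pi / 2)) = (-1 : R)%R by rewrite sinN sin_pihalf.
have mcos : measurable_fun setT (fun x : R => (G (sin x) * cos x)%:E).
  apply/measurable_EFinP; apply: measurable_funM.
    by apply: (measurableT_comp mG); apply: continuous_measurable_fun; exact: continuous_sin.
  by apply: continuous_measurable_fun; exact: continuous_cos.
have step n : \int[leb]_(t in `[sin (a n), sin (b n)]) (G t)%:E =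
    \int[leb]_(x in `[a n, b n]) (G (sin x) * cos x)%:E.
  rewrite integration_by_substitution_increasing//.
  - by rewrite derive1_sin.
  - move=> x y; rewrite !in_itv/= => /andP[x1 x2] /andP[y1 y2] xy.
    rewrite ltr_sin//; apply: pih.
    + exact: le_trans (ltW (aI n)) x1.
    + exact: le_trans x2 (ltW (bI n)).
    + exact: le_trans (ltW (aI n)) y1.
    + exact: le_trans y2 (ltW (bI n)).
  - by move=> x _; rewrite derive1_sin; exact: continuous_cos.
  - apply/cvg_ex; exists (cos (a n)); rewrite derive1_sin; apply: cvg_at_right_filter; exact: continuous_cos.
  - apply/cvg_ex; exists (cos (b n)); rewrite derive1_sin; apply: cvg_at_left_filter; exact: continuous_cos.
  - split.
    + by move=> x _; exact: derivable_sin.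
    + by apply: cvg_at_right_filter; exact: continuous_sin.
    + by apply: cvg_at_left_filter; exact: continuous_sin.
  - apply: cG.
    + by rewrite -sNpi ltr_sin.
    + by rewrite leNgt ltr_sin// -leNgt.
    + by rewrite -sin_pihalf ltr_sin// (lt_le_trans (bI n)).
have -> : `](-1)%R, sin phi[%classic = \bigcup_n `[sin (a n), sin (b n)]%classic.
  apply/seteqP; split=> [t|t [n _]] /=; rewrite !in_itv/=.
    move=> /andP[t1 t2]; have t3 : (t <= 1)%R by rewrite (le_trans (ltW t2))// sin_le1.
    have tI : (-1 <= t <= 1)%R by rewrite (ltW t1).
    have tE : sin (asin t) = t by rewrite asinK.
    have tP : asin t \in `[(- (pi / 2))%R, (pi / 2)%R] by rewrite in_itv/= asin_geNpi2// asin_lepi2.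
    have [||n /andP[n1 n2]] := cov (asin t).
    + by rewrite -ltr_sin// sNpi tE.
    + by rewrite -ltr_sin// tE.
    by exists n => //=; rewrite in_itv/= -tE !leNgt !ltr_sin// -!leNgt n1.
  move=> /andP[t1 t2]; apply/andP; split.
    by apply: lt_le_trans t1; rewrite -sNpi ltr_sin.
  by apply: le_lt_trans t2 _; rewrite ltr_sin.
have -> : `](- (pi / 2))%R, phi[%classic = \bigcup_n `[a n, b n]%classic.
  apply/seteqP; split=> [t|t [n _]] /=; rewrite !in_itv/=.
    by move=> /andP[t1 t2]; have [n] := cov t t1 t2; exists n => //=; rewrite in_itv.
  by move=> /andP[t1 t2]; rewrite (lt_le_trans (aI n) t1) (le_lt_trans t2).
have c1 : (\int[leb]_(t in `[sin (a n), sin (b n)]) (G t)%:E) @[n --> \oo] -->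
    \int[leb]_(t in \bigcup_n `[sin (a n), sin (b n)]%classic) (G t)%:E.
  apply: ge0_nondecreasing_set_cvg_integral.
  - move=> m n mn; apply/subsetPset => t /=; rewrite !in_itv/= => /andP[t1 t2].
    apply/andP; split.
      by apply: le_trans t1; rewrite leNgt ltr_sin// -leNgt lerD2l e_le.
    by apply: le_trans t2 _; rewrite leNgt ltr_sin// -leNgt lerD2l lerN2 e_le.
  - by move=> n; exact: measurable_itv.
  - by move=> n; apply/measurable_EFinP; exact: measurable_funTS.
  - by move=> n t _; rewrite lee_fin.
have c2 : (\int[leb]_(x in `[a n, b n]) (G (sin x) * cos x)%:E) @[n --> \oo] -->
    \int[leb]_(x in \bigcup_n `[a n, b n]%classic) (G (sin x) * cos x)%:E.
  apply: ge0_nondecreasing_set_cvg_integral.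
  - move=> m n mn; apply/subsetPset => t /=; rewrite !in_itv/= => /andP[t1 t2].
    apply/andP; split.
      by apply: le_trans t1; rewrite lerD2l e_le.
    by apply: le_trans t2 _; rewrite lerD2l lerN2 e_le.
  - by move=> n; exact: measurable_itv.
  - by move=> n; exact: measurable_funTS.
  - move=> n t /=; rewrite in_itv/= => /andP[t1 t2]; rewrite lee_fin mulr_ge0// cos_ge0_pihalf//.
    rewrite (le_trans (ltW (aI n)) t1) (le_trans t2)//.
    exact: le_trans (ltW (bI n)) phi2.
move: c1; under eq_fun do rewrite step.
by move=> c1; exact: (cvg_unique _ c1 c2).
Qed.

Definition marginal_density (gam t : R) : R := (beta_const 1 gam * pospow gam (1 - t ^+ 2))%R.

Definition marginal_cdf (gam h : R) : R :=
  fine (\int[leb]_t ((t < h)%R%:R * marginal_density gam t)%:E).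

Lemma integral_row1 (f : R -> \bar R) : measurable_fun setT f -> (forall x, 0 <= f x) ->
  \int[lebesgue_power 1]_x f (tnth x ord0) = \int[leb]_t f t.
Proof.
move=> mf f0; rewrite /lebesgue_power integral_power_cons//; last first.
  by apply: (measurableT_comp mf); exact: measurable_tnth.
apply: eq_integral => x _; transitivity (\int[power_measure leb 0]_t (cst (f x) t)).
  by apply: eq_integral => t _; rewrite tnth0.
by rewrite integral_power0.
Qed.

Variable gam : R.
Hypothesis gam1 : (-1 < gam)%R.

Lemma marginal_density_ge0 t : (0 <= marginal_density gam t)%R.
Proof. by rewrite mulr_ge0 ?pospow_ge0// ltW// beta_const_gt0. Qed.

Lemma measurable_marginal_density : measurable_fun setT (marginal_density gam).
Proof. by rewrite /marginal_density; mside. Qed.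

Lemma integral_pospow1 : \int[leb]_t (pospow gam (1 - t ^+ 2))%:E = ((beta_const 1 gam)^-1)%:E.
Proof.
rewrite -(@integral_pospow_ball R 1 gam)//.
rewrite -(@integral_row1 (fun t => (pospow gam (1 - t ^+ 2))%:E)); iside.
by apply: eq_integral => x _; rewrite /dot big_ord1 mxE expr2.
Qed.

Lemma integral_marginal_density : \int[leb]_t (marginal_density gam t)%:E = 1.
Proof.
have c0 := beta_const_gt0 1 gam1.
under eq_integral do rewrite EFinM.
rewrite ge0_integralZl//; iside.
by rewrite integral_pospow1 -EFinM divff// gt_eqF.
Qed.

Lemma marginal_cdf_integral_le1 (h : R) :
  \int[leb]_t ((t < h)%R%:R * marginal_density gam t)%:E <= 1.
Proof.
rewrite -integral_marginal_density; apply: ge0_le_integral => //.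
- by move=> t _; rewrite lee_fin mulr_ge0// marginal_density_ge0.
- by mfun; exact: measurable_marginal_density.
- by mfun; exact: measurable_marginal_density.
- by move=> t _; rewrite lee_fin ler_piMl ?marginal_density_ge0// lern1 leq_b1.
Qed.

Lemma marginal_cdf_integral_ge0 (h : R) :
  0 <= \int[leb]_t ((t < h)%R%:R * marginal_density gam t)%:E.
Proof. by apply: integral_ge0 => t _; rewrite lee_fin mulr_ge0// marginal_density_ge0. Qed.

Lemma marginal_cdfE (h : R) : (marginal_cdf gam h)%:E =
  \int[leb]_t ((t < h)%R%:R * marginal_density gam t)%:E.
Proof.
rewrite /marginal_cdf fineK// ge0_fin_numE ?marginal_cdf_integral_ge0//.
by rewrite (le_lt_trans (marginal_cdf_integral_le1 h))// ltry.
Qed.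

Lemma marginal_cdf_ge0 h : (0 <= marginal_cdf gam h)%R.
Proof. by rewrite -lee_fin marginal_cdfE marginal_cdf_integral_ge0. Qed.

Lemma marginal_cdf_le1 h : (marginal_cdf gam h <= 1)%R.
Proof. by rewrite -lee_fin marginal_cdfE marginal_cdf_integral_le1. Qed.

Lemma measurable_marginal_cdf : measurable_fun setT (marginal_cdf gam).
Proof.
apply/measurable_EFinP; rewrite /comp; under eq_fun do rewrite marginal_cdfE.
apply: measurable_fun_integral.
  mfun; by apply: (measurableT_comp measurable_marginal_density); mfun.
by move=> x y; rewrite lee_fin mulr_ge0// marginal_density_ge0.
Qed.

(** This agrees with [marginal_density] on ]-1, 1[; without the cutoff, continuity and the passage
    to powers of the cosine are direct. *)
Definition marginal_powR (t : R) : R := (beta_const 1 gam * (1 - t ^+ 2) `^ gam)%R.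

Let in11 (t : R) : (0 < 1 - t ^+ 2)%R = (-1 < t < 1)%R.
Proof. by rewrite subr_gt0 -ltr_norml -(real_normK (num_real t)) expr_lt1. Qed.

Lemma continuous_marginal_powR (a b : R) : (-1 < a)%R -> (b < 1)%R -> {within `[a, b], continuous marginal_powR}.
Proof.
move=> a1 b1; apply: continuous_in_subspaceT => x; rewrite inE/= in_itv/= => /andP[ax xb].
have x0 : (0 < 1 - x ^+ 2)%R by rewrite in11 (lt_le_trans a1)//= (le_lt_trans xb).
apply: cvgM; first exact: cvg_cst.
apply: (@continuous_comp _ _ _ (fun t : R => 1 - t ^+ 2)%R (fun t : R => t `^ gam)%R).
  apply: cvgB; first exact: cvg_cst.
  exact: exprn_continuous.
apply: differentiable_continuous; apply/derivable1_diffP.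
by have [] := is_derive1_powR gam x0.
Qed.

Lemma measurable_marginal_powR : measurable_fun setT marginal_powR.
Proof. by rewrite /marginal_powR; mside. Qed.

Lemma marginal_powR_ge0 t : (0 <= marginal_powR t)%R.
Proof. by rewrite mulr_ge0 ?powR_ge0// ltW// beta_const_gt0. Qed.

(** The derivative of the sine adds 1 to the exponent 2 gam; hence in [Ink] the constant with
    parameter (alpha - 1)/2 goes with the power alpha of the cosine. *)
Lemma marginal_powR_sin (t : R) : (- (pi / 2) < t < pi / 2)%R ->
  (marginal_powR (sin t) * cos t = beta_const 1 gam * cos t `^ (2 * gam + 1))%R.
Proof.
move=> /cos_gt0_pihalf c0; rewrite /marginal_powR -cos2sin2 -mulrA; congr (_ * _)%R.
rewrite powRD; last by apply/implyP => _; rewrite gt_eqF.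
by rewrite powRr1 ?ltW// powRrM powR_mulrn// ltW.
Qed.

Lemma integral_marginal_open (g : R -> R) (u : R) : (u <= 1)%R ->
  \int[leb]_t ((t < u)%R%:R * (g t * marginal_density gam t))%:E =
  \int[leb]_(t in `](-1)%R, u[) (g t * marginal_powR t)%:E.
Proof.
move=> u1; rewrite [RHS]integral_mkcond; apply: eq_integral => t _; rewrite patchE.
case: ifPn; rewrite ?inE ?notin_setE/= in_itv/=.
  move=> /andP[t1 t2]; rewrite t2 mul1r /marginal_density pospow_gt0E//.
  by rewrite in11 t1 (lt_le_trans t2).
move=> /negP; rewrite negb_and; case: (ltP t u) => tu; last by rewrite mul0r.
rewrite orbF mul1r => t1; rewrite /marginal_density pospow_le0 ?mulr0//.
by rewrite leNgt in11 negb_and t1.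
Qed.

Lemma marginal_cdf_sin (phi : R) : (- (pi / 2) <= phi)%R -> (phi <= pi / 2)%R ->
  marginal_cdf gam (sin phi) =
  (\int[leb]_(x in `[(- (pi / 2))%R, phi]) (beta_const 1 gam * cos x `^ (2 * gam + 1)))%R.
Proof.
rewrite le_eqVlt => /orP[/eqP <- _|phi1 phi2].
  rewrite set_itv1 /Rintegral integral_set1 /marginal_cdf sinN sin_pihalf integral0_eq// => t _.
  case: ltP => t1; last by rewrite mul0r.
  rewrite mul1r /marginal_density pospow_le0 ?mulr0//.
  by rewrite leNgt in11 negb_and -leNgt (ltW t1).
rewrite /Rintegral /marginal_cdf; congr fine.
transitivity (\int[leb]_t ((t < sin phi)%R%:R * (cst 1 t * marginal_density gam t))%:E).
  by apply: eq_integral => t _; rewrite /= mul1r.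
rewrite integral_marginal_open ?sin_le1//.
transitivity (\int[leb]_(t in `](-1)%R, sin phi[) (marginal_powR t)%:E).
  by apply: eq_integral => t _; rewrite [X in X%:E]mul1r.
rewrite integral_sin_substitution//; last 3 first.
- exact: measurable_marginal_powR.
- exact: marginal_powR_ge0.
- by move=> a b a1 _ b1; exact: continuous_marginal_powR.
rewrite [RHS]integral_itv_bndoo; last first.
  apply/measurable_EFinP; apply: measurable_funTS; mfun.
  by apply: continuous_measurable_fun; exact: continuous_cos.
apply: eq_integral => x; rewrite inE/= in_itv/= => /andP[x1 x2].
by rewrite marginal_powR_sin// x1 (lt_le_trans x2).
Qed.

(** A power of this distribution function is part of the integrand in [InkE], to which the sine
    substitution is applied. *)
Lemma continuous_marginal_cdf (a b : R) : (-1 < a)%R -> (b < 1)%R ->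
  {within `[a, b], continuous (marginal_cdf gam)}.
Proof.
move=> a1 b1.
have mM := measurable_marginal_density.
have I : leb.-integrable `[(-1)%R, 1%R] (EFin \o marginal_density gam).
  apply/integrableP; split; first by apply/measurable_EFinP; exact: measurable_funTS.
  apply: (@le_lt_trans _ _ (\int[leb]_t (marginal_density gam t)%:E)); last first.
    by rewrite integral_marginal_density ltry.
  under eq_integral do rewrite /= ger0_norm ?marginal_density_ge0//.
  apply: ge0_subset_integral => //; first exact/measurable_EFinP.
  by move=> t _; rewrite lee_fin marginal_density_ge0.
have N11 : (-1 <= 1 :> R)%R by lra.
have H := parameterized_integral_continuous N11 I.
apply: (@subspace_eq_continuous _ _ _ (fun h => parameterized_integral leb (-1)%R h (marginal_density gam))); last first.
  apply: (continuous_subspaceW _ H) => t /=; rewrite !in_itv/= => /andP[t1 t2].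
  by rewrite (le_trans (ltW a1) t1) (le_trans t2 (ltW b1)).
move=> h; rewrite inE/= in_itv/= => /andP[h1 h2].
rewrite /from_subspace/= /parameterized_integral /Rintegral /marginal_cdf; congr fine; apply/esym.
rewrite -integral_itv_bndo_bndc; last by apply/measurable_EFinP; exact: measurable_funTS.
rewrite [RHS]integral_mkcond; apply: eq_integral => t _; rewrite patchE.
case: ifPn; rewrite ?inE ?notin_setE/= in_itv/=.
  by move=> /andP[_ ->]; rewrite mul1r.
move=> /negP; rewrite negb_and; case: (ltP t h) => tu; last by rewrite mul0r.
rewrite orbF mul1r -ltNge => t1; rewrite /marginal_density pospow_le0 ?mulr0//.
by rewrite leNgt in11 negb_and -leNgt (ltW t1).
Qed.

End sine_substitution.

(** * [Ink] as an expectation over a random height *)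

Section Ink_integral.
Context {R : realType}.
Local Open Scope ereal_scope.
Notation leb := (@lebesgue_measure R).

(** The probabilistic meaning of I: a height h is drawn with the density of parameter (alpha k -
    1)/2, and n - k independent heights of parameter (alpha - 1)/2 all fall below it. *)
Lemma InkE (n k : nat) (alpha : R) : (-1 < alpha)%R -> (-1 < alpha * k%:R)%R ->
  (Ink n k alpha)%:E = \int[leb]_h (marginal_cdf ((alpha - 1) / 2) h ^+ (n - k) *
     marginal_density ((alpha * k%:R - 1) / 2) h)%:E.
Proof.
move=> a1 ak1; set g1 := ((alpha - 1) / 2)%R; set gk := ((alpha * k%:R - 1) / 2)%R.
have g11 : (-1 < g1)%R by rewrite /g1; lra.
have gk1 : (-1 < gk)%R by rewrite /gk; lra.
set r := (n - k)%N.
have Fr0 h : (0 <= marginal_cdf g1 h ^+ r)%R by rewrite exprn_ge0 ?marginal_cdf_ge0.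
have mcos : measurable_fun setT (@cos R) by apply: continuous_measurable_fun; exact: continuous_cos.
have msin : measurable_fun setT (@sin R) by apply: continuous_measurable_fun; exact: continuous_sin.
have mF := measurable_marginal_cdf g11.
have ck := beta_const_gt0 1 gk1.
have E : \int[leb]_h (marginal_cdf g1 h ^+ r * marginal_density gk h)%:E =
  \int[leb]_(phi in `[(- (pi / 2))%R, (pi / 2)%R])
    (beta_const 1 gk * cos phi `^ (alpha * k%:R) * marginal_cdf g1 (sin phi) ^+ r)%:E.
  transitivity (\int[leb]_t ((t < 1)%R%:R * (marginal_cdf g1 t ^+ r * marginal_density gk t))%:E).
    apply: eq_integral => t _; case: (ltP t 1%R) => t1; first by rewrite mul1r.
    rewrite mul0r /marginal_density pospow_le0 ?mulr0//.
    by rewrite subr_le0 exprn_ege1.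
  rewrite integral_marginal_open//.
  have -> : `](-1)%R, (1 : R)%R[ = `](-1)%R, sin (pi / 2)[ by rewrite sin_pihalf.
  rewrite (@integral_sin_substitution R (pi / 2)%R (fun t => marginal_cdf g1 t ^+ r * marginal_powR gk t)%R)//.
  - rewrite (@integral_itv_bndoo _ _ _ (fun phi => (beta_const 1 gk * cos phi `^ (alpha * k%:R) * marginal_cdf g1 (sin phi) ^+ r)%:E) true false); last first.
      apply/measurable_EFinP; apply: measurable_funTS; mfun; by apply: (measurableT_comp mF).
    apply: eq_integral => x; rewrite inE/= in_itv/= => xI; congr (_%:E).
    rewrite -mulrA (@marginal_powR_sin _ gk _ xI) mulrC; congr (_ * _ `^ _ * _)%R.
    by rewrite /gk; field.
  - by rewrite ltrNl -subr_gt0 opprK -mulr2n pmulrn_lgt0// divr_gt0 ?pi_gt0.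
  - by mfun; exact: measurable_marginal_powR.
  - by move=> t; rewrite mulr_ge0// marginal_powR_ge0.
  - move=> a b aN1 ab b1 x; have c2 := @continuous_marginal_powR _ gk _ _ aN1 b1.
    apply: cvgM; last by apply: c2.
    apply: (@continuous_comp _ _ _ (marginal_cdf g1 : subspace `[a, b] -> R) (fun t : R => t ^+ r)%R).
      exact: (continuous_marginal_cdf g11 aN1 b1).
    exact: exprn_continuous.
have c0 h : (0 <= marginal_density gk h)%R by exact: marginal_density_ge0.
have Fin : \int[leb]_h (marginal_cdf g1 h ^+ r * marginal_density gk h)%:E \is a fin_num.
  rewrite ge0_fin_numE; last by apply: integral_ge0 => h _; rewrite lee_fin mulr_ge0.
  apply: (@le_lt_trans _ _ (\int[leb]_h (marginal_density gk h)%:E)); last first.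
    by rewrite integral_marginal_density// ltry.
  apply: ge0_le_integral => //.
  - by move=> h _; rewrite lee_fin mulr_ge0.
  - by mfun; exact: measurable_marginal_density.
  - by mfun; exact: measurable_marginal_density.
  - move=> h _; rewrite lee_fin ler_piMl//.
    by rewrite exprn_ile1 ?marginal_cdf_ge0// marginal_cdf_le1.
have g1E : (2 * g1 + 1 = alpha)%R by rewrite /g1; field.
have -> : Ink n k alpha = (\int[leb]_(phi in `[(- (pi / 2))%R, (pi / 2)%R])
    (beta_const 1 gk * cos phi `^ (alpha * k%:R) * marginal_cdf g1 (sin phi) ^+ r))%R.
  apply: eq_Rintegral => x; rewrite inE/= in_itv/= => /andP[x1 x2].
  have := marginal_cdf_sin g11 x1 x2; rewrite g1E => ->.
  by [].
by rewrite /Rintegral -E fineK.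
Qed.

End Ink_integral.

(** * Null sets and hyperplanes *)

Section null_sets.
Context {R : realType}.
Local Open Scope ereal_scope.

(** Null sets are given as boolean functions with vanishing integral, the form in which iterated
    integrals produce them. *)
Lemma integral_null_ext d (T : measurableType d) (mu : {measure set T -> \bar R})
    (N : T -> bool) (f g : T -> \bar R) :
  measurable_fun setT N -> \int[mu]_x ((N x)%:R)%:E = 0 ->
  measurable_fun setT f -> measurable_fun setT g ->
  (forall x, 0 <= f x) -> (forall x, 0 <= g x) ->
  (forall x, ~~ N x -> f x = g x) -> \int[mu]_x f x = \int[mu]_x g x.
Proof.
move=> mN N0 mf mg f0 g0 fg; apply: ge0_ae_eq_integral => //.
have mNs : measurable [set x | N x].
  by have := mN measurableT [set true] I; rewrite setTI.
exists [set x | N x]; split => //.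
  have : \int[mu]_x (\1_[set x | N x] x)%:E = 0.
    rewrite -[RHS]N0; apply: eq_integral => x _; rewrite indicE; congr (nat_of_bool _)%:R%:E.
    by apply/idP/idP; rewrite inE.
  by rewrite integral_indic// setIT.
move=> x /= /not_implyP[_]; case: (boolP (N x)) => // /fg fgx.
by move=> /(_ fgx).
Qed.

Lemma integral_null_le d (T : measurableType d) (mu : {measure set T -> \bar R})
    (N : T -> bool) (f : T -> \bar R) :
  measurable_fun setT N -> \int[mu]_x ((N x)%:R)%:E = 0 ->
  measurable_fun setT f -> (forall x, 0 <= f x) ->
  (forall x, ~~ N x -> f x = 0) -> \int[mu]_x f x = 0.
Proof.
move=> mN N0 mf f0 fN; rewrite (@integral_null_ext _ _ mu N f (cst 0))//.
exact: integral0.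
Qed.

(** The property that puts i.i.d. points in general position. It is shared by the beta laws with
    beta > -1 and, in dimension at least 2, by the sphere. *)
Definition charges_no_hyperplane d (mu : set (coordinates R d) -> \bar R) :=
  forall (w : 'rV[R]_d) (c : R), w != 0%R ->
    \int[mu]_x ((dot (row_of x) w == c)%R%:R)%:E = 0.

Lemma dot_normalize d (w : 'rV[R]_d) : w != 0%R ->
  dot ((Num.sqrt (dot w w))^-1 *: w)%R ((Num.sqrt (dot w w))^-1 *: w)%R = 1%R.
Proof.
move=> w0; have ww0 : (0 < dot w w)%R by rewrite lt0r dot_eq0 w0 dot_ge0.
rewrite dotZl dotZr mulrA -expr2 exprVn sqr_sqrtr ?ltW// mulVf// gt_eqF//.
Qed.

(** In slices along the unit normal of the hyperplane, only the single height c/n contributes. The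
    Gaussian is a weight of finite positive mass for [integral_slice]. *)
Lemma lebesgue_power_no_hyperplane d : charges_no_hyperplane (@lebesgue_power R d).
Proof.
move=> w c w0; pose n := Num.sqrt (dot w w); pose th := (n^-1 *: w)%R.
have n0 : (0 < n)%R by rewrite sqrtr_gt0 lt0r dot_eq0 w0 dot_ge0.
have th1 : dot th th = 1%R by exact: dot_normalize.
have wE : w = (n *: th)%R by rewrite scalerA divff ?scale1r// gt_eqF.
clearbody th.
have := @integral_slice R d th (@gauss_fun R) (fun x => ((dot x w == c)%R%:R)%:E) th1
  (@measurable_gauss_fun R) (@gauss_fun_ge0 R).
rewrite integralT_gauss => H.
have {H} : (Num.sqrt pi)%:E * \int[lebesgue_power d]_x ((dot (row_of x) w == c)%R%:R)%:E = 0.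
  rewrite H; [|by rewrite /mfun_row; mside|by move=> x; rewrite lee_fin].
  transitivity (\int[lebesgue_measure]_(t in [set (c / n)%R]) (\int[lebesgue_power d]_x
     ((gauss_fun (dot (row_of x) th))%:E * ((dot (row_of x - dot (row_of x) th *: th + t *: th) w == c)%R%:R)%:E))).
    rewrite [RHS]integral_mkcond; apply: eq_integral => t _; rewrite patchE.
    case: ifPn => //; rewrite notin_setE/= => tc.
    rewrite integral0_eq// => x _; rewrite wE dotZr dotDl dotBl !dotZl th1.
    rewrite !mulr1 subrr add0r; case: eqP => [E|]; last by rewrite mule0.
    by exfalso; apply: tc; rewrite -E mulrAC divff ?mul1r// gt_eqF.
  by rewrite integral_set1.
move=> /eqP; rewrite mule_eq0 eqe gt_eqF ?sqrtr_gt0 ?pi_gt0//= => /eqP.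
by [].
Qed.

Lemma integral_beta_law d (beta : R) (f : coordinates R d -> \bar R) : (-1 < beta)%R ->
  measurable_fun setT f -> (forall x, 0 <= f x) ->
  \int[beta_law d beta]_x f x = \int[lebesgue_power d]_x (f x * (beta_density beta x)%:E).
Proof.
move=> beta1 mf f0; apply: integral_density => //.
- exact: measurable_beta_density.
- exact: beta_density_ge0.
- by move=> A mA; rewrite /= /beta_law gt_eqF.
Qed.

Lemma beta_law_no_hyperplane d (beta : R) : (-1 < beta)%R ->
  charges_no_hyperplane (beta_law d beta).
Proof.
move=> beta1 w c w0.
have mN : measurable_fun setT (fun x : coordinates R d => (dot (row_of x) w == c)%R) by mside.
rewrite integral_beta_law//; last by mside.
apply: (integral_null_le mN).
- exact: lebesgue_power_no_hyperplane.
- by apply: emeasurable_funM; [mside|apply/measurable_EFinP; exact: measurable_beta_density].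
- by move=> x; rewrite mule_ge0 ?lee_fin// beta_density_ge0.
- by move=> x /negbTE ->; rewrite mul0e.
Qed.

End null_sets.

(** * Gram determinants and general position *)

Section gram.
Context {R : realType}.

Definition gram m d (A : 'M[R]_(m, d)) : R := \det (A *m A^T).

(** v A A^T = 0 forces |v A|^2 = 0. The determinant expresses independence by a polynomial in the
    entries, which makes it measurable. *)
Lemma gram_neq0 m d (A : 'M[R]_(m, d)) : (gram A != 0) = row_free A.
Proof.
rewrite /gram -unitfE -unitmxE -row_free_unit; apply/idP/idP => [h|/row_freeP[B AB]].
  by rewrite /row_free eqn_leq rank_leq_row/= -{1}(eqP h) mxrankM_maxl.
apply: inj_row_free => v vAA.
have : dot (v *m A) (v *m A) == 0.
  by rewrite dotE trmx_mul !mulmxA -[v *m A *m A^T]mulmxA vAA mul0mx mxE.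
by rewrite dot_eq0 => /eqP vA; rewrite -[v]mulmx1 -AB mulmxA vA mul0mx.
Qed.

Lemma measurable_row_free d0 (T : measurableType d0) m d (A : T -> 'M[R]_(m, d)) :
  measurable_mx A -> measurable_fun setT (fun t => row_free (A t)).
Proof.
move=> mA; under eq_fun do rewrite -gram_neq0 /gram.
apply: measurable_neg; apply: measurable_fun_eqr; last exact: measurable_cst.
by apply: measurable_det; mfunx.
Qed.

Lemma row_free_col_mx_dot m d (A : 'M[R]_(m, d)) (v w : 'rV[R]_d) :
  row_free A -> A *m w^T = 0 -> dot v w != 0 -> row_free (col_mx A v).
Proof.
move=> fA Aw vw; apply: inj_row_free => u.
rewrite -[u]hsubmxK mul_row_col => uE.
have u20 : rsubmx u = 0.
  have : (lsubmx u *m A + rsubmx u *m v) *m w^T = 0 by rewrite uE mul0mx.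
  rewrite mulmxDl -!mulmxA Aw mulmx0 add0r => /(congr1 (fun M : 'M[R]_1 => M 0 0)).
  rewrite mxE big_ord1 -dotE [RHS]mxE => /eqP; rewrite mulf_eq0 (negbTE vw) orbF => /eqP h.
  by apply/rowP => i; rewrite ord1 [RHS]mxE; exact: h.
move: uE; rewrite u20 mul0mx addr0 => uA.
suff -> : lsubmx u = 0 by rewrite row_mx0.
by have /row_freeP[B AB] := fA; rewrite -[LHS]mulmx1 -AB mulmxA uA mul0mx.
Qed.

Lemma exists_orthogonal m d (A : 'M[R]_(m, d)) : (m < d)%N ->
  exists2 w : 'rV[R]_d, w != 0 & A *m w^T = 0.
Proof.
move=> md; have : kermx A^T != 0.
  rewrite -mxrank_eq0 mxrank_ker subn_eq0 -ltnNge.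
  by rewrite (leq_ltn_trans _ md)// mxrank_tr rank_leq_row.
move=> /rowV0Pn[w /sub_kermxP wA w0]; exists w => //.
by rewrite -[A]trmxK -trmx_mul wA trmx0.
Qed.

Definition shift_rows m d (x : 'rV[R]_d) (M : 'M[R]_(m, d)) : 'M[R]_(m, d) :=
  M - const_mx 1 *m x.

Lemma shift_rows_col_mx m1 m2 d (x : 'rV[R]_d) (A : 'M[R]_(m1, d)) (B : 'M[R]_(m2, d)) :
  shift_rows x (col_mx A B) = col_mx (shift_rows x A) (shift_rows x B).
Proof. by rewrite /shift_rows -col_mx_const mul_col_mx opp_col_mx add_col_mx. Qed.

Lemma shift_rows1 d (x v : 'rV[R]_d) : shift_rows x v = v - x.
Proof. by rewrite /shift_rows (mx11_scalar (const_mx 1)) mxE mul1mx. Qed.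

Lemma mx_of_cons d r (x : coordinates R d) (t : r.-tuple (coordinates R d)) :
  mx_of [tuple of x :: t] = col_mx (row_of x) (mx_of t) :> 'M[R]_(1 + r, d).
Proof.
apply/matrixP => i j; rewrite mxE (tnth_nth x); case: (split_ordP i) => k ->.
  by rewrite col_mxEu ord1 mxE.
by rewrite col_mxEd mxE (tnth_nth x).
Qed.

Local Open Scope ereal_scope.

(** Each new point almost surely misses a hyperplane through [x0] parallel to the rows collected so
    far. The matrix [A] absorbs these rows during the induction; its initial value is the row g or
    an empty matrix. *)
Lemma power_measure_row_free d (mu : {sigma_finite_measure set (coordinates R d) -> \bar R}) :
  charges_no_hyperplane mu ->
  forall r a (A : 'M[R]_(a, d)) (x0 : 'rV[R]_d), row_free A -> (a + r <= d)%N ->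
  \int[power_measure mu r]_t ((~~ row_free (col_mx A (shift_rows x0 (mx_of t))))%:R)%:E = 0.
Proof.
move=> nomu; elim => [|r IH] a A x0 fA ard.
  rewrite integral0_eq// => t _; suff -> : row_free (col_mx A (shift_rows x0 (mx_of t))) by [].
  apply: inj_row_free => u; rewrite -[u]hsubmxK mul_row_col => uE.
  have u20 : rsubmx u = 0%R by apply/rowP => -[].
  move: uE; rewrite u20 mul0mx addr0 => uA.
  suff -> : lsubmx u = 0%R by rewrite row_mx0.
  by have /row_freeP[B AB] := fA; rewrite -[LHS]mulmx1 -AB mulmxA uA mul0mx.
have mfree b (B : 'M[R]_(b, d)) k : measurable_fun setT (fun t : k.-tuple (coordinates R d) =>
    ((~~ row_free (col_mx B (shift_rows x0 (mx_of t))))%:R)%:E : \bar R).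
  mfun; apply: measurable_row_free => i j; rewrite -(splitK i); case: fintype.split => l /=.
    by under eq_fun do rewrite col_mxEu; mfun.
  under eq_fun do rewrite col_mxEd /shift_rows.
  have mM : measurable_mx (fun t : k.-tuple (coordinates R d) => (mx_of t - const_mx 1 *m x0)%R) by mfunx.
  exact: mM.
rewrite integral_power_cons//.
have [w w0 Aw] := @exists_orthogonal _ _ A (leq_trans (leq_ltn_trans (leq_addr r a) (ltnSn _)) (leq_trans (eq_leq (esym (addnS a r))) ard)).
apply: (integral_null_le (N := fun x => (dot (row_of x) w == dot x0 w)%R)).
- by mside.
- exact: nomu.
- apply: measurable_fun_integral; last by [].
  by apply: (measurableT_comp (mfree a A r.+1)); exact: measurable_fun_cons_tuple.
- by move=> x; exact: integral_ge0.
move=> x xw; rewrite -[RHS](IH (a + 1)%N (col_mx A (row_of x - x0)%R) x0); last 2 first.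
- by apply: (row_free_col_mx_dot (w := w)) => //; rewrite dotBl subr_eq0.
- by rewrite -addnA add1n.
apply: eq_integral => t _; congr (nat_of_bool (~~ _))%:R%:E.
have -> : shift_rows x0 (mx_of [tuple of x :: t]) = col_mx (row_of x - x0)%R (shift_rows x0 (mx_of t)) :> 'M[R]_(1 + r, d).
  transitivity (shift_rows x0 (col_mx (row_of x) (mx_of t))); first by rewrite -mx_of_cons.
  by rewrite shift_rows_col_mx shift_rows1.
transitivity (row_free (col_mx A (col_mx (row_of x - x0)%R (shift_rows x0 (mx_of t))) : 'M[R]_(a + (1 + r), d))); first by [].
rewrite col_mxA /row_free; congr (_ == _); last by rewrite addnA.
by rewrite (eqmx_cast _ _).
Qed.

End gram.

(** * Orthogonal projection of g on the span of the differences *)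

Section projection.
Context {R : realType} (d : nat) (g : 'rV[R]_d).

(* Coefficients of the orthogonal projection of g on the rows of D; the inverse of the Gram
   matrix is expanded because it is then visibly measurable in D. *)
Definition lam p (D : 'M[R]_(p, d)) : 'rV[R]_p :=
  (gram D)^-1 *: (g *m D^T *m \adj (D *m D^T)).

Definition resid p (D : 'M[R]_(p, d)) : 'rV[R]_d := g - lam D *m D.

Lemma lamP p (D : 'M[R]_(p, d)) : row_free D -> lam D *m (D *m D^T) = g *m D^T.
Proof.
move=> fD; rewrite /lam -scalemxAl -[g *m D^T *m _ *m _]mulmxA mul_adj_mx.
by rewrite mul_mx_scalar scalerA -/(gram D) mulVf ?scale1r// gram_neq0.
Qed.

Lemma lam_unique p (D : 'M[R]_(p, d)) (l : 'rV_p) : row_free D ->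
  l *m (D *m D^T) = g *m D^T -> l = lam D.
Proof.
move=> fD lE; have : D *m D^T \in unitmx by rewrite unitmxE unitfE -/(gram D) gram_neq0.
by move=> u; rewrite -[l](mulmxK u) lE -[lam D](mulmxK u) lamP.
Qed.

Lemma resid_orthogonal p (D : 'M[R]_(p, d)) : row_free D -> resid D *m D^T = 0.
Proof. by move=> fD; rewrite mulmxBl -mulmxA lamP// subrr. Qed.

Lemma dot_row_resid p (D : 'M[R]_(p, d)) i : row_free D -> dot (row i D) (resid D) = 0.
Proof.
move=> fD; rewrite dotC; transitivity ((resid D *m D^T) 0 i).
  by rewrite mxE; apply: eq_bigr => j _; rewrite !mxE.
by rewrite resid_orthogonal// mxE.
Qed.

Lemma row_freeZ p (D : 'M[R]_(p, d)) r : 0 < r -> row_free (r *: D) = row_free D.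
Proof. by move=> r0; rewrite /row_free (eqmx_scale _ (lt0r_neq0 r0)). Qed.

Lemma lamZ p (D : 'M[R]_(p, d)) r : 0 < r -> lam (r *: D) = r^-1 *: lam D.
Proof.
move=> r0; have rn := lt0r_neq0 r0; have [fD|nfD] := boolP (row_free D).
  apply/esym/lam_unique; first by rewrite row_freeZ.
  have -> : (r *: D)^T = r *: D^T by rewrite linearZ.
  rewrite -scalemxAl -[r *: D *m _]scalemxAl -!scalemxAr lamP// !scalerA.
  by rewrite mulrA mulVf// mul1r.
(* For dependent rows both sides are 0, the inverse of 0 being 0. *)
have g0 : gram D = 0 by apply/eqP; rewrite -[_ == _]negbK gram_neq0.
have gr0 : gram (r *: D) = 0 by apply/eqP; rewrite -[_ == _]negbK gram_neq0 row_freeZ.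
by rewrite /lam g0 gr0 !invr0 !scale0r scaler0.
Qed.

Lemma residZ p (D : 'M[R]_(p, d)) r : 0 < r -> resid (r *: D) = resid D.
Proof.
move=> r0; rewrite /resid lamZ// -scalemxAl -scalemxAr scalerA mulVf ?scale1r//.
exact: lt0r_neq0.
Qed.

Lemma row_free_dsub p (D : 'M[R]_(p, d)) : row_free (col_mx g D) -> row_free D.
Proof.
move=> /row_freeP[B gB]; apply: inj_row_free => v vD.
have : row_mx 0 v *m col_mx g D = 0 by rewrite mul_row_col mul0mx add0r.
move=> /(congr1 (mulmx^~ B)); rewrite -mulmxA gB mulmx1 mul0mx => /(congr1 rsubmx).
by rewrite row_mxKr => ->; apply/rowP => i; rewrite !mxE.
Qed.

Lemma resid_neq0 p (D : 'M[R]_(p, d)) : row_free (col_mx g D) -> resid D != 0.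
Proof.
move=> /row_freeP[B gB]; apply/eqP => r0.
have : row_mx 1%:M (- lam D) *m col_mx g D = 0 by rewrite mul_row_col mul1mx mulNmx.
move=> /(congr1 (mulmx^~ B)); rewrite -mulmxA gB mulmx1 mul0mx => /(congr1 lsubmx).
rewrite row_mxKl => /(congr1 (fun M : 'M[R]_1 => M 0 0)); rewrite !mxE/= => /eqP.
by rewrite oner_eq0.
Qed.

Lemma measurable_lam d0 (T : measurableType d0) p (D : T -> 'M[R]_(p, d)) :
  measurable_mx D -> measurable_mx (fun t => lam (D t)).
Proof.
move=> mD; rewrite /lam /gram; mfunx.
- by apply: measurable_det; mfunx.
- by apply: measurable_adj; mfunx.
Qed.

Lemma measurable_resid d0 (T : measurableType d0) p (D : T -> 'M[R]_(p, d)) :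
  measurable_mx D -> measurable_mx (fun t => resid (D t)).
Proof.
by move=> mD; rewrite /resid; mfunx; apply: measurable_lam.
Qed.

End projection.

(** * The mass of a face for beta points *)

Section face_law.
Context {R : realType}.
Local Open Scope ereal_scope.
Notation leb := (@lebesgue_measure R).

Definition diffs d p (t : p.+1.-tuple (coordinates R d)) : 'M[R]_(p, d) :=
  shift_rows (row_of (thead t)) (mx_of [tuple tnth t (lift ord0 i) | i < p]).

Lemma diffs_cons d p x (t : p.-tuple (coordinates R d)) :
  diffs [tuple of x :: t] = shift_rows (row_of x) (mx_of t).
Proof.
rewrite /diffs theadE; congr (shift_rows _ (mx_of _)); apply/eq_from_tnth => i.
by rewrite tnth_mktuple tnthS.
Qed.

Lemma row_diffs d p (t : p.+1.-tuple (coordinates R d)) i :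
  row i (diffs t) = (row_of (tnth t (lift ord0 i)) - row_of (thead t))%R.
Proof.
by apply/rowP => j; rewrite /diffs /shift_rows !mxE big_ord1 !mxE !tnth_mktuple mul1r.
Qed.

Lemma measurable_diffs d0 (T : measurableType d0) d p (f : T -> p.+1.-tuple (coordinates R d)) :
  measurable_fun setT f -> measurable_mx (fun t => diffs (f t)).
Proof.
move=> mf i j; have -> : (fun t => diffs (f t) i j) =
    (fun t => tnth (tnth (f t) (lift ord0 i)) j - tnth (tnth (f t) ord0) j)%R.
  by apply/funext => t; rewrite /diffs /shift_rows !mxE big_ord1 !mxE !tnth_mktuple mul1r.
have mt l : measurable_fun setT (fun t => tnth (tnth (f t) l) j : R).
  by apply: (measurableT_comp (measurable_tnth j)); apply: (measurableT_comp (measurable_tnth l)).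
by apply: measurable_funB; exact: mt.
Qed.

Lemma measurable_thead d0 (T : measurableType d0) d p (f : T -> p.+1.-tuple (coordinates R d)) :
  measurable_fun setT f -> measurable_fun setT (fun t => thead (f t)).
Proof. by move=> mf; apply: (measurableT_comp (measurable_tnth ord0)). Qed.

Lemma power_measure_col_mx_diffs d (mu : {sigma_finite_measure set (coordinates R d) -> \bar R})
    (g : 'rV[R]_d) q : charges_no_hyperplane mu -> g != 0%R -> (q < d)%N ->
  \int[power_measure mu q.+1]_t ((~~ row_free (col_mx g (diffs t)))%:R)%:E = 0.
Proof.
move=> nomu g0 pd; have fg : row_free g by rewrite /row_free rank_rV g0.
rewrite integral_power_cons//; last first.
  mfun; apply: measurable_row_free => i j; case: (split_ordP i) => l ->.
    by under eq_fun do rewrite col_mxEu; mfun.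
  by under eq_fun do rewrite col_mxEd; apply: measurable_diffs; mfun.
rewrite integral0_eq// => x _; under eq_integral do rewrite diffs_cons.
exact: power_measure_row_free.
Qed.

Variables (d : nat) (beta : R).
Hypothesis beta1 : (-1 < beta)%R.
Notation mu := (beta_law d beta).

Lemma integral_beta_power p (f : p.-tuple (coordinates R d) -> \bar R) :
  measurable_fun setT f -> (forall t, 0 <= f t) ->
  \int[power_measure mu p]_t f t = \int[power_measure (lebesgue_power d) p]_t
    (f t * (\prod_(i < p) beta_density beta (tnth t i))%:E).
Proof.
move=> mf f0; apply: integral_power_density => //.
- exact: measurable_beta_density.
- exact: beta_density_ge0.
- by move=> A mA; rewrite /= /beta_law gt_eqF.
Qed.

Lemma prod_beta_density p x (t : p.-tuple (coordinates R d)) :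
  (\prod_(i < p.+1) beta_density beta (tnth [tuple of x :: t] i) =
   beta_const d beta ^+ p.+1 * ball_kernel beta 1 (row_of x) (shift_rows (row_of x) (mx_of t)))%R.
Proof.
under eq_bigr do rewrite beta_densityE.
rewrite big_split/= prodr_const card_ord; congr (_ * _)%R.
rewrite big_ord_recl tnth0; congr (_ * _)%R; apply: eq_bigr => i _; rewrite tnthS.
have -> // : (row_of x + row i (shift_rows (row_of x) (mx_of t)) = row_of (tnth t i))%R.
by apply/rowP => j; rewrite /shift_rows !mxE big_ord1 !mxE mul1r subrKC.
Qed.

(** [ball_kernel_factorization] is used for [G] and for the constant 1; the comparison eliminates
    [K] and the normalizing constant. In other words, the height along theta is independent of the
    functional [psi] of the differences. *)
Lemma beta_power_factorization p (psi : 'M[R]_(p, d) -> R) (theta : 'M[R]_(p, d) -> 'rV[R]_d)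
    (gam := (((2 * beta + d%:R) * p.+1%:R - 1) / 2)%R) (G : R -> R) :
  (-1 < gam)%R ->
  mfun_mx psi -> measurable_mx (fun t => theta (mx_of t)) ->
  (forall D, 0 <= psi D)%R ->
  (forall D r, 0 < r -> psi (r *: D) = psi D)%R ->
  (forall D r, 0 < r -> theta (r *: D) = theta D)%R ->
  (forall D, psi D != 0 -> dot (theta D) (theta D) = 1 /\
     forall i, dot (row i D) (theta D) = 0)%R ->
  measurable_fun setT G -> (forall t, 0 <= G t)%R ->
  \int[power_measure mu p.+1]_t
    (psi (diffs t) * G (dot (row_of (thead t)) (theta (diffs t))))%:E =
  \int[power_measure mu p.+1]_t (psi (diffs t))%:E *
  \int[leb]_h (G h * marginal_density gam h)%:E.
Proof.
move=> gam1 mpsi mth psi0 psiZ thZ psith mG G0.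
have [K K0 KE] := ball_kernel_factorization beta mpsi mth psi0 psiZ thZ psith.
have mth' d0 (T : measurableType d0) (f : T -> 'M[R]_(p, d)) : measurable_mx f ->
   measurable_mx (fun t => theta (f t)).
  move=> mf i j; apply: (mfun_mx_comp (F := fun D => theta D i j)) => //.
  exact: mth.
have mpsi' d0 (T : measurableType d0) (f : T -> 'M[R]_(p, d)) : measurable_mx f ->
   measurable_fun setT (fun t => psi (f t)) by exact: mfun_mx_comp.
pose C := (beta_const d beta ^+ p.+1)%R.
have C0 : (0 <= C)%R by rewrite exprn_ge0// ltW// beta_const_gt0.
have main (H : R -> R) : measurable_fun setT H -> (forall t, 0 <= H t)%R ->
  \int[power_measure mu p.+1]_t
    (psi (diffs t) * H (dot (row_of (thead t)) (theta (diffs t))))%:E =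
  C%:E * (K * \int[leb]_h (H h * pospow gam (1 - h ^+ 2))%:E).
  move=> mH H0.
  have mH' d0 (T : measurableType d0) (f : T -> R) : measurable_fun setT f ->
    measurable_fun setT (fun t => H (f t)) by exact: (measurableT_comp mH).
  have md d0 (T : measurableType d0) (f : T -> p.+1.-tuple (coordinates R d)) :
      measurable_fun setT f -> measurable_mx (fun t => diffs (f t)) by exact: measurable_diffs.
  have mI : measurable_fun setT (fun t : p.+1.-tuple (coordinates R d) =>
    (psi (diffs t) * H (dot (row_of (thead t)) (theta (diffs t))))%:E).
    mfun; first by apply: mpsi'; apply: md; mfun.
    by apply: mH'; mfunx; [apply: measurable_thead; mfun|apply: mth'; apply: md; mfun].
  rewrite integral_beta_power//; last by move=> t; rewrite lee_fin mulr_ge0.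
  rewrite integral_power_cons; last 2 first.
  - apply: emeasurable_funM => //; mfun.
    apply: (measurableT_comp (@measurable_beta_density R d beta)).
    exact: measurable_tnth.
  - by move=> t; rewrite mule_ge0// lee_fin ?mulr_ge0// prodr_ge0// => i _; exact: beta_density_ge0.
  pose Q (x : 'rV[R]_d) (D : 'M[R]_(p, d)) := (psi D * H (dot x (theta D)) * ball_kernel beta 1 x D)%R.
  have Q0 x D : (0 <= Q x D)%R by rewrite mulr_ge0 ?ball_kernel_ge0// mulr_ge0.
  have mQ d0 (T : measurableType d0) (x : T -> 'rV[R]_d) (f : T -> 'M[R]_(p, d)) :
      measurable_mx f -> measurable_mx x -> measurable_fun setT (fun t => (Q (x t) (f t))%:E).
    move=> mf mx; rewrite /Q; mfun; first exact: mpsi'.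
      by apply: mH'; mfunx; exact: mth'.
    by apply: measurable_ball_kernel; mfunx.
  transitivity (\int[lebesgue_power d]_x (C%:E *
      \int[power_measure (lebesgue_power d) p]_t (Q (row_of x) (mx_of t))%:E)).
    apply: eq_integral => x _.
    (* For a fixed first point the other points are translated by it, so the differences become the
       integration variable. *)
    rewrite -(@integral_mx_shift R d p (- (const_mx 1 *m row_of x))%R (fun D => (Q (row_of x) D)%:E)); last 2 first.
    - by rewrite /mfun_mx; apply: mQ; mfunx.
    - by move=> D; rewrite lee_fin.
    rewrite -ge0_integralZl//; last 2 first.
    - by apply: mQ; mfunx.
    - by move=> t _; rewrite lee_fin.
    apply: eq_integral => t _; rewrite prod_beta_density diffs_cons theadE -EFinM -/(shift_rows _ _) -/C.
    by congr (_%:E); rewrite /Q; ring.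
  have mIQ : measurable_fun setT (fun x : coordinates R d =>
      \int[power_measure (lebesgue_power d) p]_t (Q (row_of x) (mx_of t))%:E).
    by apply: measurable_fun_integral; [apply: mQ; mfunx|move=> *; rewrite lee_fin].
  rewrite ge0_integralZl//; last 1 first.
  - by move=> x _; apply: integral_ge0 => t _; rewrite lee_fin.
  by rewrite tonelli ?KE//; [apply: mQ; mfunx|move=> *; rewrite lee_fin].
have c0 := beta_const_gt0 1 gam1.
have M1 : \int[power_measure mu p.+1]_t (psi (diffs t))%:E = C%:E * (K * ((beta_const 1 gam)^-1)%:E).
  have := main (cst 1%R) (@measurable_cst _ _ _ _ _ _) (fun=> ler01).
  under eq_integral do rewrite /= mulr1.
  by move=> ->; under eq_integral do rewrite /= mul1r; rewrite integral_pospow1.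
rewrite main// M1 -!muleA; congr (_ * (_ * _)).
rewrite -ge0_integralZl//; last 3 first.
- by mfun; exact: measurable_marginal_density.
- by move=> h _; rewrite lee_fin mulr_ge0// marginal_density_ge0.
- by rewrite lee_fin invr_ge0 ltW.
apply: eq_integral => h _; rewrite -EFinM /marginal_density; congr (_%:E).
by rewrite [RHS]mulrCA mulKf// gt_eqF.
Qed.

(** The case p = 0 of the factorization: a single point has no differences, and [theta] can be any
    fixed unit vector. *)
Lemma beta_law_marginal (theta : 'rV[R]_d) (G : R -> R) : (0 < d)%N ->
  dot theta theta = 1%R -> measurable_fun setT G -> (forall t, 0 <= G t)%R ->
  \int[mu]_x (G (dot (row_of x) theta))%:E =
  \int[leb]_h (G h * marginal_density ((2 * beta + d%:R - 1) / 2) h)%:E.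
Proof.
move=> d0 th1 mG G0.
have d1 : (1 <= d%:R :> R)%R by rewrite ler1n.
have gam1 : (-1 < ((2 * beta + d%:R) * 1%:R - 1) / 2)%R by rewrite mulr1; have b1 := beta1; lra.
pose psi (D : 'M[R]_(0, d)) : R := 1%R.
have mpsi : mfun_mx psi by rewrite /mfun_mx; mfun.
have mth : measurable_mx (fun t : 0.-tuple (coordinates R d) => theta) by move=> i j; exact: measurable_cst.
have psith : (forall D : 'M[R]_(0, d), psi D != 0 -> dot theta theta = 1 /\
     forall i, dot (row i D) theta = 0)%R by move=> D _; split => // -[].
have := @beta_power_factorization 0 psi (fun=> theta) G gam1 mpsi mth
  (fun=> ler01) (fun _ _ _ => erefl) (fun _ _ _ => erefl) psith mG G0.
rewrite mulr1 /psi => E.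
transitivity (\int[power_measure mu 1]_t (1 * G (dot (row_of (thead t)) theta))%:E).
  rewrite integral_power_cons; last 2 first.
  - mfun; apply: (measurableT_comp mG); mfunx; apply: measurable_thead; mfun.
  - by move=> t; rewrite mul1r lee_fin.
  apply: eq_integral => x _; rewrite integral_power0; first by rewrite theadE mul1r.
  by mfun; apply: (measurableT_comp mG); mfunx; apply: measurable_thead; apply: measurable_cons.
rewrite E (_ : \int[power_measure mu 1]__ 1 = 1) ?mul1e//.
by rewrite integral_cst// mul1e; exact/power_measureT/beta_lawT.
Qed.

Variable g : 'rV[R]_d.
Hypothesis g0 : g != 0%R.

(* Row i of diffs X is X_(i+1) - X_0, so the first k points X_0, .., X_(k-1) give the rows i with
   i.+1 < k. *)
Definition pos_coefs (k : nat) p (D : 'M[R]_(p, d)) : R :=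
  (\prod_(i < p | (k <= i.+1)%N) (0 <= lam g D 0 i)%R%:R)%R.

Lemma pos_coefs_ge0 k p (D : 'M[R]_(p, d)) : (0 <= pos_coefs k D)%R.
Proof. by rewrite prodr_ge0. Qed.

Lemma measurable_pos_coefs d0 (T : measurableType d0) k p (D : T -> 'M[R]_(p, d)) :
  measurable_mx D -> measurable_fun setT (fun t => pos_coefs k (D t)).
Proof.
move=> mD; have mL := measurable_lam g mD.
rewrite /pos_coefs; under eq_fun do rewrite -big_filter.
apply: measurable_prod => i _; apply: measurable_fun_nat_of_bool.
by apply: measurable_fun_ler => //; exact: mL.
Qed.

(** The residual of [g] is normal to the face. Given the face, each of the r other points falls
    below it with the marginal distribution function at its height, so the factorization applies
    with the r-th power of that function as [G], and [InkE] identifies the result. *)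
Lemma face_mass k p r : (p < d)%N ->
  \int[power_measure mu p.+1]_t \int[power_measure mu r]_u
    (pos_coefs k (diffs t) * \prod_(j < r) (dot (row_of (tnth u j)) (resid g (diffs t)) <
        dot (row_of (thead t)) (resid g (diffs t)))%R%:R)%:E =
  \int[power_measure mu p.+1]_t (pos_coefs k (diffs t))%:E *
  (Ink (p.+1 + r) p.+1 (2 * beta + d%:R))%:E.
Proof.
move=> pd; have d0 : (0 < d)%N by exact: leq_ltn_trans pd.
have d1 : (1 <= d%:R :> R)%R by rewrite ler1n.
set alpha := (2 * beta + d%:R)%R; have a1 : (-1 < alpha)%R by have b1 := beta1; rewrite /alpha; lra.
have as1 : (-1 < alpha * p.+1%:R)%R.
  (* With at least two points on the face p < d gives d >= 2, hence alpha >= 0; a single point only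
     requires alpha > -1. *)
  case: p pd => [|p] pd; first by rewrite mulr1.
  have d2 : (2 <= d%:R :> R)%R by rewrite (ler_nat _ 2); exact: leq_trans pd.
  by rewrite (lt_le_trans (ltrN10 R))// mulr_ge0//; have b1 := beta1; rewrite /alpha; lra.
pose gam := ((alpha * p.+1%:R - 1) / 2)%R; pose gam1 := ((alpha - 1) / 2)%R.
have gamN1 : (-1 < gam)%R by rewrite /gam; lra.
have gam1N1 : (-1 < gam1)%R by rewrite /gam1; lra.
pose theta (D : 'M[R]_(p, d)) := ((Num.sqrt (dot (resid g D) (resid g D)))^-1 *: resid g D)%R.
(* The first factor is almost surely 1; it ensures that the residual is nonzero, and theta a unit
   vector, wherever [psi] does not vanish. *)
pose psi (D : 'M[R]_(p, d)) := ((row_free (col_mx g D))%:R * pos_coefs k D)%R.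
have mcol d2 (T : measurableType d2) (D : T -> 'M[R]_(p, d)) : measurable_mx D -> measurable_mx (fun t => col_mx g (D t)).
  move=> mD i j; case: (split_ordP i) => l ->.
    by under eq_fun do rewrite col_mxEu; mfun.
  by under eq_fun do rewrite col_mxEd; exact: mD.
have mth d2 (T : measurableType d2) (D : T -> 'M[R]_(p, d)) : measurable_mx D -> measurable_mx (fun t => theta (D t)).
  by move=> mD; have mR := measurable_resid g mD; rewrite /theta; mfunx.
have mpsi d2 (T : measurableType d2) (D : T -> 'M[R]_(p, d)) : measurable_mx D -> measurable_fun setT (fun t => psi (D t)).
  by move=> mD; rewrite /psi; mfun; [apply: measurable_row_free; exact: mcol|exact: measurable_pos_coefs].
have mdf : measurable_mx (fun t : p.+1.-tuple (coordinates R d) => diffs t) by apply: measurable_diffs; mfun.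
have psi0 D : (0 <= psi D)%R by rewrite mulr_ge0// pos_coefs_ge0.
have psiZ D s : (0 < s)%R -> psi (s *: D)%R = psi D.
  move=> s0; rewrite /psi; congr ((nat_of_bool _)%:R * _)%R; last first.
    by apply: eq_bigr => i _; rewrite lamZ// mxE pmulr_rge0// invr_gt0.
  have E : (col_mx g (s *: D) = block_mx 1%:M 0 0 s%:M *m col_mx g D)%R.
    by rewrite mul_block_col mul1mx !mul0mx mul_scalar_mx addr0 add0r.
  rewrite /row_free E eqmxMfull// row_full_unit unitmxE det_lblock det1 det_scalar mul1r.
  by rewrite unitfE expf_neq0// gt_eqF.
have thZ D s : (0 < s)%R -> theta (s *: D)%R = theta D by move=> s0; rewrite /theta residZ.
have psith D : (psi D != 0 -> dot (theta D) (theta D) = 1 /\ forall i, dot (row i D) (theta D) = 0)%R.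
  rewrite /psi mulf_eq0 negb_or pnatr_eq0 eqb0 negbK => /andP[fD _]; split.
    exact/dot_normalize/resid_neq0.
  by move=> i; rewrite dotZr dot_row_resid ?mulr0//; exact: row_free_dsub fD.
have mG : measurable_fun setT (fun h => marginal_cdf gam1 h ^+ r)%R.
  by mfun; exact: measurable_marginal_cdf.
have G0 h : (0 <= marginal_cdf gam1 h ^+ r)%R by rewrite exprn_ge0// marginal_cdf_ge0.
have mpsi' : mfun_mx psi by rewrite /mfun_mx; apply: mpsi; mfunx.
have mth' : measurable_mx (fun t => theta (mx_of t)) by apply: mth; mfunx.
have := @beta_power_factorization p psi theta _ gamN1 mpsi' mth' psi0 psiZ thZ psith mG G0.
rewrite InkE// addKn -/gam -/gam1 => E.
have mthead : measurable_mx (fun t : p.+1.-tuple (coordinates R d) => row_of (thead t)).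
  by apply: measurable_row_of; apply: measurable_thead; mfun.
have mres : measurable_mx (fun t : p.+1.-tuple (coordinates R d) => resid g (diffs t)).
  exact: measurable_resid.
have mpos : measurable_fun setT (fun t : p.+1.-tuple (coordinates R d) => (pos_coefs k (diffs t))%:E).
  by mfun; exact: measurable_pos_coefs.
have mN : measurable_fun setT (fun t : p.+1.-tuple (coordinates R d) => ~~ row_free (col_mx g (diffs t))).
  by apply: measurable_neg; apply: measurable_row_free; exact: mcol.
have mpt : measurable_fun setT (fun t : p.+1.-tuple (coordinates R d) => (psi (diffs t))%:E).
  by mfun; exact: mpsi.
have mGt : measurable_fun setT (fun t : p.+1.-tuple (coordinates R d) =>
    (marginal_cdf gam1 (dot (row_of (thead t)) (theta (diffs t))) ^+ r)%R).
  by apply: (measurableT_comp mG); mfunx; exact: mth.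
have mass0 := power_measure_col_mx_diffs (beta_law_no_hyperplane beta1) g0 pd.
have <- : \int[power_measure mu p.+1]_t (psi (diffs t))%:E =
    \int[power_measure mu p.+1]_t (pos_coefs k (diffs t))%:E.
  apply: (integral_null_ext mN) => //.
  - by move=> t; rewrite lee_fin.
  - by move=> t; rewrite lee_fin pos_coefs_ge0.
  - by move=> t; rewrite negbK /psi => ->; rewrite mul1r.
rewrite -E; apply: (integral_null_ext mN); first exact: mass0.
- apply: measurable_fun_integral; last first.
    by move=> t u; rewrite lee_fin mulr_ge0 ?pos_coefs_ge0// prodr_ge0.
  have mz : measurable_mx (fun z : p.+1.-tuple (coordinates R d) * r.-tuple (coordinates R d) => resid g (diffs z.1)).
    by apply: measurable_resid; apply: measurable_diffs; mfun.
  have mz1 : measurable_mx (fun z : p.+1.-tuple (coordinates R d) * r.-tuple (coordinates R d) => row_of (thead z.1)).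
    by apply: measurable_row_of; apply: measurable_thead; mfun.
  mfunx.
  by apply: measurable_pos_coefs; apply: measurable_diffs; mfun.
- by mfun; exact: mpsi.
- by move=> t; apply: integral_ge0 => u _; rewrite lee_fin mulr_ge0 ?pos_coefs_ge0// prodr_ge0.
- by move=> t; rewrite lee_fin mulr_ge0.
move=> t; rewrite negbK => ft; set w := resid g (diffs t); set x0 := row_of (thead t).
have w0 : w != 0%R by exact: resid_neq0.
have ww0 : (0 < dot w w)%R by rewrite lt0r dot_eq0 w0 dot_ge0.
have thE (x : 'rV[R]_d) : dot x (theta (diffs t)) = ((Num.sqrt (dot w w))^-1 * dot x w)%R by rewrite dotZr.
rewrite EFinM /psi ft mul1r.
under eq_integral do rewrite EFinM.
rewrite ge0_integralZl//; last 3 first.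
- by mfunx.
- by move=> u _; rewrite lee_fin prodr_ge0.
- by rewrite lee_fin pos_coefs_ge0.
congr (_ * _).
rewrite (@integral_power_prod _ _ _ mu (fun x => (dot (row_of x) w < dot x0 w)%R%:R) (marginal_cdf gam1 (dot x0 (theta (diffs t)))))//; first by mside.
rewrite marginal_cdfE// -(@beta_law_marginal (theta (diffs t)) (fun h => (h < dot x0 (theta (diffs t)))%R%:R))//.
- apply: eq_integral => x _; congr (nat_of_bool _)%:R%:E.
  by rewrite !thE ltr_pM2l// invr_gt0 sqrtr_gt0.
- exact: dot_normalize.
- by mfun.
Qed.

End face_law.

(** * Karush-Kuhn-Tucker conditions and the partition into face events *)

Section least_squares_cone.
Context {R : realType} (d : nat) (g : 'rV[R]_d).

Lemma kermx_gram p (A : 'M[R]_(p, d)) : (kermx (A *m A^T) <= kermx A)%MS.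
Proof.
apply/sub_kermxP; set B := kermx _ *m A; have BB : B *m B^T = 0.
  by rewrite trmx_mul mulmxA -[B *m A^T]mulmxA mulmx_ker mul0mx.
apply/row_matrixP => i; rewrite row0; apply/eqP; rewrite -dot_eq0; apply/eqP.
transitivity ((B *m B^T) i i); last by rewrite BB mxE.
by rewrite mxE; apply: eq_bigr => j _; rewrite !mxE.
Qed.

(** A^T and A A^T have equal ranks, hence the same row space. This also covers dependent rows, which
    occur when rows are masked by zeros. *)
Lemma normal_equation p (A : 'M[R]_(p, d)) : exists l : 'rV_p, l *m (A *m A^T) = g *m A^T.
Proof.
have rA : (\rank A^T <= \rank (A *m A^T))%N.
  rewrite mxrank_tr; have := mxrankS (kermx_gram A); rewrite !mxrank_ker.
  have := rank_leq_row A; have := rank_leq_row (A *m A^T); lia.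
have sA : (A *m A^T <= A^T)%MS by exact: submxMl.
have AA : (A^T <= A *m A^T)%MS by rewrite -(mxrank_leqif_sup sA) eqn_leq mxrankS.
by have /submxP[l lE] := submx_trans (submxMl g A^T) AA; exists l.
Qed.

(** Minus one half of the partial derivative of |g - mu D|^2 in the i-th coefficient. *)
Definition slack q (D : 'M[R]_(q, d)) (mu : 'rV[R]_q) i : R := dot (row i D) (g - mu *m D).

Lemma dot_mulmx q (D : 'M[R]_(q, d)) (z : 'rV[R]_q) (y : 'rV[R]_d) :
  dot (z *m D) y = \sum_i z 0 i * dot (row i D) y.
Proof.
rewrite dotE -mulmxA mxE; apply: eq_bigr => i _; congr (_ * _).
by rewrite mxE; apply: eq_bigr => j _; rewrite !mxE.
Qed.

(** Monotonicity of the gradient of a quadratic form. Complementary slackness controls the signs of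
    the summands, which yields both existence and uniqueness below. *)
Lemma dot_slack q (D : 'M[R]_(q, d)) (mu nu : 'rV[R]_q) :
  dot ((mu - nu) *m D) ((mu - nu) *m D) =
  \sum_i (mu 0 i - nu 0 i) * (slack D nu i - slack D mu i).
Proof.
rewrite {1}dot_mulmx; apply: eq_bigr => i _; rewrite !mxE -dotBr; congr (_ * dot _ _).
by rewrite mulmxBl opprB [_ - g]addrC addrACA subrr add0r addrC.
Qed.

(* By induction on #|C|: first leave the sign of the coefficient of some i0 in C free; if it comes
   out negative, then the solution with i0 switched off has the right slack at i0. *)
Lemma active_set_solution q (D : 'M[R]_(q, d)) (C A : {set 'I_q}) : C \subset A ->
  exists mu : 'rV[R]_q, [/\ forall i, i \notin A -> mu 0 i = 0,
    forall i, i \in A -> i \notin C -> slack D mu i = 0 &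
    forall i, i \in C -> [/\ 0 <= mu 0 i, slack D mu i <= 0 & mu 0 i * slack D mu i = 0]].
Proof.
move: {2}#|C| (leqnn #|C|) => n; elim: n C A => [|n IH] C A.
  rewrite leqn0 cards_eq0 => /eqP -> _.
  (* Rows outside [A] are set to zero instead of being deleted, which keeps the index type. *)
  pose DA : 'M[R]_(q, d) := \matrix_(i, j) ((i \in A)%:R * D i j).
  have [l lE] := normal_equation DA; exists (\row_i ((i \in A)%:R * l 0 i)).
  have mE : \row_i ((i \in A)%:R * l 0 i) *m D = l *m DA.
    by apply/rowP => j; rewrite !mxE; apply: eq_bigr => i _; rewrite !mxE; ring.
  split=> [i /negbTE iA|i iA _|i]; last by rewrite inE.
    by rewrite mxE iA mul0r.
  rewrite /slack mE; have -> : row i D = row i DA.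
    by apply/rowP => j; rewrite !mxE iA mul1r.
  rewrite dotC; transitivity (((g - l *m DA) *m DA^T) 0 i).
    by rewrite mxE; apply: eq_bigr => j _; rewrite !mxE.
  by rewrite mulmxBl -mulmxA lE subrr mxE.
move=> Cn CA; have [C0|[i0 iC]] := set_0Vmem C.
  by apply: IH => //; rewrite C0 cards0.
have iA := fintype.subsetP CA _ iC.
have Cn' : (#|C :\ i0| <= n)%N by move: Cn; rewrite (cardsD1 i0) iC.
have [mu [mu0 muE muC]] := IH (C :\ i0) A Cn' (fintype.subset_trans (subsetDl _ _) CA).
have smu : slack D mu i0 = 0 by apply: muE; rewrite // !inE eqxx.
have [mui|mui] := leP 0 (mu 0 i0).
  exists mu; split => // [i iA' iC'|i iC'].
    by apply: muE => //; rewrite !inE (negbTE iC') andbF.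
  have [->|ii0] := eqVneq i i0; first by rewrite smu mulr0.
  by apply: muC; rewrite !inE ii0.
have [nu [nu0 nuE nuC]] := IH (C :\ i0) (A :\ i0) Cn' (finset.setSD _ CA).
have nui : nu 0 i0 = 0 by apply: nu0; rewrite !inE eqxx.
(* In [dot_slack] all terms but that of [i0] are at most 0, so this one dominates a square. As the
   coefficient of [i0] in [mu] is negative, the slack of [nu] at [i0] has the right sign. *)
have ge0 : 0 <= mu 0 i0 * slack D nu i0.
  apply: (le_trans (dot_ge0 ((mu - nu) *m D))).
  rewrite dot_slack (bigD1 i0)//= nui smu !subr0 gerDl; apply: sumr_le0 => i ii0.
  have [iA'|iA'] := boolP (i \in A); last first.
    by rewrite mu0// nu0 ?subrr ?mul0r// !inE (negbTE iA') andbF.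
  have [iC'|iC'] := boolP (i \in C); last first.
    by rewrite muE ?nuE ?subrr ?mulr0// !inE ?(negbTE iC') ?andbF// ii0.
  have iC1 : i \in C :\ i0 by rewrite !inE ii0.
  have [a1 a2 a3] := muC i iC1; have [b1 b2 b3] := nuC i iC1.
  rewrite mulrBl !mulrBr a3 b3 subr0 sub0r opprK.
  have h1 := mulr_ge0_le0 a1 b2; have h2 := mulr_ge0_le0 b1 a2; lra.
have snu : slack D nu i0 <= 0 by move: ge0; rewrite nmulr_rge0.
exists nu; split => [i iA'|i iA' iC'|i iC'].
- by apply: nu0; rewrite !inE (negbTE iA') andbF.
- have ii0 : i != i0 by apply: contra iC' => /eqP ->.
  by apply: nuE; rewrite !inE ?ii0// (negbTE iC') andbF.
have [->|ii0] := eqVneq i i0; first by rewrite nui mul0r.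
by apply: nuC; rewrite !inE ii0.
Qed.

Variable k : nat.

Definition free_rows q : {set 'I_q} := [set i : 'I_q | (i.+1 < k)%N].

(** With strict slack outside S and weak signs inside, S is exactly the set of rows of zero slack,
    and so is determined even if some coefficient on S vanishes. *)
Definition kkt q (D : 'M[R]_(q, d)) (S : {set 'I_q}) (mu : 'rV[R]_q) :=
  [/\ forall i, i \notin S -> mu 0 i = 0,
      forall i, i \in S -> (k <= i.+1)%N -> 0 <= mu 0 i,
      forall i, i \in S -> slack D mu i = 0 &
      forall i, i \notin S -> slack D mu i < 0].

Lemma kkt_exists q (D : 'M[R]_(q, d)) : exists (S : {set 'I_q}) mu, free_rows q \subset S /\ kkt D S mu.
Proof.
have [mu [_ muE muC]] := active_set_solution D (finset.subsetT (~: free_rows q)).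
exists [set i | slack D mu i == 0]%SET, mu; split.
  by apply/fintype.subsetP => i iF; rewrite inE muE// !inE negbK; rewrite inE in iF.
split => [i|i _ ki|i|i]; rewrite ?inE.
- move=> si; have iC : i \in ~: free_rows q by apply: contraR si => iC; rewrite muE// inE.
  by have [_ _ /eqP] := muC i iC; rewrite mulf_eq0 (negbTE si) orbF => /eqP.
- by have [] // := muC i; rewrite !inE -leqNgt.
- by move/eqP.
- move=> si; have iC : i \in ~: free_rows q by apply: contraR si => iC; rewrite muE// inE.
  by have [_ s0 _] := muC i iC; rewrite lt_neqAle si.
Qed.

(** By [dot_slack] both solutions have the same projection [mu *m D], hence the same slacks, and S
    is the zero set of the slack. *)
Lemma kkt_unique q (D : 'M[R]_(q, d)) (S S' : {set 'I_q}) mu nu : free_rows q \subset S ->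
  free_rows q \subset S' -> kkt D S mu -> kkt D S' nu -> S = S'.
Proof.
move=> FS FS' [mu0 muC muS muN] [nu0 nuC nuS nuN].
have bound i : (mu 0 i - nu 0 i) * (slack D nu i - slack D mu i) <= 0.
  have free (T : {set 'I_q}) : free_rows q \subset T -> i \notin T -> (k <= i.+1)%N.
    by move=> FT iT; rewrite leqNgt; apply: contra iT => ik; apply: (fintype.subsetP FT); rewrite inE.
  have [iS|iS] := boolP (i \in S); have [iS'|iS'] := boolP (i \in S').
  - by rewrite muS// nuS// subrr mulr0.
  - rewrite muS// nu0// !subr0; apply: mulr_ge0_le0; last exact/ltW/nuN.
    by apply: muC => //; exact: (free _ FS').
  - rewrite nuS// mu0// !sub0r mulrNN; apply: mulr_ge0_le0; last exact/ltW/muN.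
    by apply: nuC => //; exact: (free _ FS).
  - by rewrite mu0// nu0// subrr mul0r.
have : (mu - nu) *m D == 0.
  rewrite -dot_eq0 eq_le dot_ge0 andbT dot_slack; apply: sumr_le0 => i _; exact: bound.
rewrite mulmxBl subr_eq0 => /eqP E.
have slackE i : slack D mu i = slack D nu i by rewrite /slack E.
apply/setP => i; apply/idP/idP => iS; apply: contraT => iS'.
  by have := nuN i iS'; rewrite -slackE muS// ltxx.
by have := muN i iS'; rewrite slackE nuS// ltxx.
Qed.

Definition sel q (S : {set 'I_q}) (D : 'M[R]_(q, d)) : 'M[R]_(#|S|, d) :=
  rowsub (fun i => enum_val i) D.

(** The sign condition refers to the index within the selected rows, as [pos_coefs] does; by
    [enum_val_free] this agrees with the original index once S contains the free rows. *)
Definition face_event q (S : {set 'I_q}) (D : 'M[R]_(q, d)) : bool :=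
  [forall i : 'I_#|S|, (k <= i.+1)%N ==> (0 <= lam g (sel S D) 0 i)] &&
  [forall j in ~: S, dot (row j D) (resid g (sel S D)) < 0].

(** The enumeration of S is increasing and starts with all the free rows, so it fixes the indices
    below [k.-1] and sends the other ones to indices that are not below [k.-1]. *)
Lemma enum_val_free q (S : {set 'I_q}) (i : 'I_#|S|) : free_rows q \subset S ->
  (k <= (enum_val i).+1)%N = (k <= i.+1)%N.
Proof.
move=> FS; have Sq : (#|S| <= q)%N by rewrite -[leqRHS]card_ord max_card.
have iq := leq_trans (ltn_ord i) Sq; pose c := k.-1.
have sz : size (enum 'I_q) = q by rewrite size_enum_ord.
have enumSE : enum S = take c (enum 'I_q) ++ [seq j <- drop c (enum 'I_q) | j \in S].
  rewrite {1}/enum_mem -enumT -{1}[enum 'I_q](cat_take_drop c) filter_cat; congr (_ ++ _).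
  apply/all_filterP/allP => j jt; apply: (fintype.subsetP FS); rewrite inE.
  have : (j : nat) \in map val (take c (enum 'I_q)) by apply: map_f.
  by rewrite map_take val_enum_ord take_iota mem_iota /c; lia.
rewrite /enum_val (set_nth_default (Ordinal iq)) -?cardE//.
rewrite enumSE nth_cat size_take sz; case: ifPn => ic.
  by rewrite nth_take ?nth_enum_ord//; move: ic; case: ifP; lia.
set j := nth _ _ _; have ck : (c <= i)%N.
  by case: (ltnP c q) ic => cq; rewrite -leqNgt// leqNgt iq.
have jin : j \in [seq j <- drop c (enum 'I_q) | j \in S].
  apply: mem_nth; have iS : (i < size (enum S))%N by rewrite -cardE.
  rewrite ltn_subLR; last by rewrite leqNgt.
  by move: iS; rewrite enumSE size_cat size_take sz.
move: jin; rewrite mem_filter => /andP[_ jd].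
have : (j : nat) \in map val (drop c (enum 'I_q)) by apply: map_f.
by rewrite map_drop val_enum_ord drop_iota mem_iota /c; lia.
Qed.

Lemma row_free_rowsub p q (f : 'I_p -> 'I_q) (D : 'M[R]_(q, d)) : injective f ->
  row_free D -> row_free (rowsub f D).
Proof.
move=> fI fD; apply: inj_row_free => v; rewrite rowsubE mulmxA => vD.
have /row_free_inj : row_free D := fD => /(_ _ (v *m rowsub f 1%:M) 0) vE.
have {}vE : v *m rowsub f 1%:M = 0 by apply: vE; rewrite vD mul0mx.
apply/rowP => i; move/rowP : vE => /(_ (f i)); rewrite !mxE (bigD1 i)//= !mxE eqxx mulr1.
by rewrite big1 ?addr0// => j ji; rewrite !mxE (inj_eq fI) (negbTE ji) mulr0.
Qed.

(** The multipliers are the projection coefficients on the rows in S, extended by 0; left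
    multiplication by the selection matrix [E] performs the extension. *)
Lemma face_eventP q (S : {set 'I_q}) (D : 'M[R]_(q, d)) :
  free_rows q \subset S -> row_free D ->
  face_event S D <-> exists mu, kkt D S mu.
Proof.
move=> FS fD; pose E : 'M[R]_(#|S|, q) := rowsub (fun i => enum_val i) 1%:M.
have selE : sel S D = E *m D by rewrite /sel rowsubE.
have fS : row_free (sel S D) by apply: row_free_rowsub => //; exact: enum_val_inj.
have EN (l : 'rV[R]_#|S|) i : i \notin S -> (l *m E) 0 i = 0.
  move=> iS; rewrite !mxE big1// => j _; rewrite !mxE; case: eqP => [e|_]; last by rewrite mulr0.
  by move: iS; rewrite -e enum_valP.
have ES (l : 'rV[R]_#|S|) j : (l *m E) 0 (enum_val j) = l 0 j.
  rewrite !mxE (bigD1 j)//= !mxE eqxx mulr1 big1 ?addr0// => i ij.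
  by rewrite !mxE (inj_eq enum_val_inj) (negbTE ij) mulr0.
have in_S i : i \in S -> exists j : 'I_#|S|, i = enum_val j.
  by move=> iS; exists (enum_rank_in iS i); rewrite enum_rankK_in.
have slackE (l : 'rV[R]_#|S|) i : slack D (l *m E) i = dot (row i D) (g - l *m sel S D).
  by rewrite /slack -mulmxA -selE.
split=> [/andP[/forallP ev1 /forall_inP ev2]|[mu [mu0 muC muS muN]]].
  exists (lam g (sel S D) *m E); split => [i|i /in_S[j ->]|i /in_S[j ->]|i iS].
  - exact: EN.
  - by rewrite enum_val_free// ES => kj; have /implyP := ev1 j; exact.
  - by rewrite slackE -/(resid _ _) -(row_rowsub enum_val) -/(sel _ _) dot_row_resid.
  - by rewrite slackE; apply: ev2; rewrite inE.
pose l : 'rV[R]_#|S| := \row_j mu 0 (enum_val j).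
have muE : mu = l *m E.
  apply/rowP => i; have [/in_S[j ->]|iS] := boolP (i \in S); first by rewrite ES mxE.
  by rewrite EN// mu0.
have lE : l = lam g (sel S D).
  apply: lam_unique => //; apply/eqP; rewrite eq_sym -subr_eq0 mulmxA -mulmxBl; apply/eqP.
  apply/rowP => j; have := muS _ (enum_valP j); rewrite muE slackE dotC => s0.
  rewrite mxE [RHS]mxE -[RHS]s0; apply: eq_bigr => i _; by rewrite !mxE.
apply/andP; split.
  apply/forallP => i; apply/implyP => ki; rewrite -lE mxE; apply: muC; first exact: enum_valP.
  by rewrite enum_val_free.
apply/forall_inP => j; rewrite inE => jS; have := muN j jS.
by rewrite muE slackE lE.
Qed.

Lemma sum_face_event q (D : 'M[R]_(q, d)) : row_free D ->
  \sum_(S : {set 'I_q} | free_rows q \subset S) (face_event S D)%:R = 1 :> R.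
Proof.
move=> fD; have [S [mu [FS muS]]] := kkt_exists D.
have evS : face_event S D by apply/face_eventP => //; exists mu.
rewrite (bigD1 S)//= evS big1 ?addr0// => S' /andP[FS' SS'].
case: (boolP (face_event S' D)) => // /(face_eventP FS' fD)[nu nuS'].
by move: SS'; rewrite (kkt_unique FS' FS nuS' muS) eqxx.
Qed.

End least_squares_cone.

Lemma power_measure_diffs {R : realType} d
    (mu : {sigma_finite_measure set (coordinates R d) -> \bar R}) q :
  charges_no_hyperplane mu -> (q <= d)%N ->
  (\int[power_measure mu q.+1]_t ((~~ row_free (diffs t))%:R)%:E = 0)%E.
Proof.
move=> nomu qd; rewrite integral_power_cons//; last first.
  mfun; apply: measurable_row_free; apply: measurable_diffs; mfun.
rewrite integral0_eq// => x _; under eq_integral do rewrite diffs_cons.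
have f0 : row_free (0 : 'M[R]_(0, d)) by rewrite /row_free mxrank0.
have cE (A : 'M[R]_(0, d)) (B : 'M[R]_(q, d)) : col_mx A B = B.
  apply/matrixP => i j; rewrite mxE; case: splitP => [[]//|l il].
  by congr (B _ _); exact/val_inj.
rewrite -[RHS](power_measure_row_free nomu (row_of x) f0 qd).
by apply: eq_integral => t _; rewrite cE.
Qed.

(** * The recursion for the face probabilities *)

Section recursion.
Context {R : realType}.
Local Open Scope ereal_scope.
Variables (d : nat) (beta : R) (g : 'rV[R]_d) (k : nat).
Hypothesis beta1 : (-1 < beta)%R.
Hypothesis g0 : g != 0%R.
Hypothesis k0 : (0 < k)%N.
Notation mu := (beta_law d beta).

Lemma prod_nat_of_bool (I : finType) (P b : pred I) :
  (\prod_(i | P i) (b i)%:R = [forall i, P i ==> b i]%:R :> R)%R.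
Proof.
case: (boolP [forall i, P i ==> b i]) => [/forallP h|].
  by rewrite big1// => i Pi; have /implyP -> := h i.
rewrite negb_forall => /existsP[i]; rewrite negb_imply => /andP[Pi /negbTE bi].
by rewrite (bigD1 i)//= bi mul0r.
Qed.

Lemma face_eventE q (S : {set 'I_q}) (D : 'M[R]_(q, d)) :
  (face_event g k S D)%:R = (pos_coefs g k (sel S D) *
    \prod_(j < #|~: S|) (dot (row (enum_val j) D) (resid g (sel S D)) < 0)%R%:R)%R :> R.
Proof.
rewrite /face_event -mulnb natrM /pos_coefs prod_nat_of_bool; congr (_ * _)%R.
by rewrite -prod_nat_of_bool big_enum_val.
Qed.

(** Exchangeability: the base point and the points of S are moved to the front and the other points
    to the end, after which the integral splits into two blocks. *)
Lemma integral_face_event q (S : {set 'I_q}) :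
  \int[power_measure mu q.+1]_t ((face_event g k S (diffs t))%:R)%:E =
  \int[power_measure mu #|S|.+1]_t \int[power_measure mu #|~: S|]_u
    (pos_coefs g k (diffs t) * \prod_(j < #|~: S|) (dot (row_of (tnth u j)) (resid g (diffs t)) <
        dot (row_of (thead t)) (resid g (diffs t)))%R%:R)%:E.
Proof.
set s := #|S|; set r := #|~: S|.
pose fst_ (t : (s.+1 + r).-tuple (coordinates R d)) := reindex_tuple (@lshift s.+1 r) t.
pose F (t : (s.+1 + r).-tuple (coordinates R d)) : \bar R :=
  (pos_coefs g k (diffs (fst_ t)) * \prod_(j < r) (dot (row_of (tnth t (rshift s.+1 j))) (resid g (diffs (fst_ t))) <
        dot (row_of (thead (fst_ t))) (resid g (diffs (fst_ t))))%R%:R)%:E.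
(* S indexes differences, so the face consists of the base point at position 0 and [s] further
   points. *)
pose f0 (i : 'I_s.+1) : 'I_q.+1 := if unlift ord0 i is Some a then lift ord0 (enum_val a) else ord0.
pose f (i : 'I_(s.+1 + r)) : 'I_q.+1 := match fintype.split i with
  | inl a => f0 a | inr b => lift ord0 (enum_val b) end.
have mfst : measurable_fun setT fst_ by exact: measurable_reindex_tuple.
have mF : measurable_fun setT F.
  have md : measurable_mx (fun t => diffs (fst_ t)) by exact: measurable_diffs.
  have mr := measurable_resid g md.
  have mt : measurable_fun setT (fun t => thead (fst_ t)) by exact: measurable_thead.
  by rewrite /F; mfunx; exact: measurable_pos_coefs.
have F0 t : 0 <= F t.
  by rewrite lee_fin mulr_ge0 ?pos_coefs_ge0// prodr_ge0.
have finj : injective f.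
  move=> i j; rewrite /f /f0; case: (split_ordP i) => a ->; case: (split_ordP j) => b -> /=.
  - case: (unliftP ord0 a) => [a' ->|->]; case: (unliftP ord0 b) => [b' ->|->] //.
      by move=> /lift_inj/enum_val_inj ->.
  - case: (unliftP ord0 a) => [a' ->|->] // /lift_inj E.
    by have := enum_valP b; rewrite -E inE enum_valP.
  - case: (unliftP ord0 b) => [b' ->|->] // /lift_inj E.
    by have := enum_valP a; rewrite E inE enum_valP.
  - by move=> /lift_inj/enum_val_inj ->.
transitivity (\int[power_measure mu q.+1]_t F (reindex_tuple f t)).
  apply: eq_integral => t _; rewrite face_eventE /F.
  have tE i : tnth (fst_ (reindex_tuple f t)) i = tnth t (f0 i).
    by rewrite !tnth_mktuple /f (unsplitK (inl i)).
  have hE : thead (fst_ (reindex_tuple f t)) = thead t.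
    by rewrite /thead tE /f0 unlift_none.
  have -> : diffs (fst_ (reindex_tuple f t)) = sel S (diffs t).
    apply/row_matrixP => i; rewrite row_diffs row_rowsub row_diffs hE tE.
    by rewrite /f0 liftK.
  congr ((_ * _)%:E); apply: eq_bigr => j _; congr ((nat_of_bool _)%:R).
  rewrite row_diffs dotBl subr_lt0 hE; congr (dot (row_of _) _ < _)%R.
  by rewrite tnth_mktuple /f (unsplitK (inr j)).
rewrite integral_power_reindex//; last exact: beta_lawT.
rewrite (@integral_power_cat _ _ _ mu s.+1 r F mF F0).
apply: eq_integral => t _.
apply: eq_integral => u _.
rewrite /F; have -> : fst_ [tuple of t ++ u] = t.
  by apply/eq_from_tnth => i; rewrite tnth_mktuple tnth_lshift.
by congr ((_ * _)%:E); apply: eq_bigr => j _; rewrite tnth_rshift.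
Qed.

(* Meaningful for m > 0 only. *)
Definition face_prob m : R := fine (\int[power_measure mu m.-1.+1]_t (pos_coefs g k (diffs t))%:E).

Lemma pos_coefs_le1 p (D : 'M[R]_(p, d)) : (pos_coefs g k D <= 1)%R.
Proof. by rewrite /pos_coefs prod_nat_of_bool lern1 leq_b1. Qed.

Lemma face_probE p : (face_prob p.+1)%:E = \int[power_measure mu p.+1]_t (pos_coefs g k (diffs t))%:E.
Proof.
rewrite fineK// ge0_fin_numE; last by apply: integral_ge0 => t _; rewrite lee_fin pos_coefs_ge0.
have mp : measurable_fun setT (fun t : p.+1.-tuple (coordinates R d) => (pos_coefs g k (diffs t))%:E).
  by mfun; apply: measurable_pos_coefs; apply: measurable_diffs; mfun.
apply: (@le_lt_trans _ _ (\int[power_measure mu p.+1]_t (cst 1 t))).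
  apply: ge0_le_integral => //; first by move=> t _; rewrite lee_fin pos_coefs_ge0.
  by move=> t _; rewrite lee_fin pos_coefs_le1.
rewrite integral_cst// mul1e (_ : _ setT = 1) ?ltry//; exact/power_measureT/beta_lawT.
Qed.

Let alpha := (2 * beta + d%:R)%R.

(** The full set S is split off: no point remains outside it, and for q = d the residual vanishes,
    so that [face_mass], stated for fewer than d differences, does not apply. *)
Lemma sum_face_prob q : (q <= d)%N ->
  (\sum_(S : {set 'I_q} | free_rows k q \subset S)
    (face_prob #|S|.+1 * if #|S| == q then 1 else Ink q.+1 #|S|.+1 alpha) = 1)%R.
Proof.
move=> qd; pose N (t : q.+1.-tuple (coordinates R d)) := ~~ row_free (diffs t).
have mdf : measurable_mx (fun t : q.+1.-tuple (coordinates R d) => diffs t).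
  by apply: measurable_diffs; mfun.
have mN : measurable_fun setT N by apply: measurable_neg; exact: measurable_row_free.
have N0 : \int[power_measure mu q.+1]_t ((N t)%:R)%:E = 0.
  exact: (power_measure_diffs (beta_law_no_hyperplane beta1)).
have mE (S : {set 'I_q}) : measurable_fun setT
   (fun t : q.+1.-tuple (coordinates R d) => ((face_event g k S (diffs t))%:R)%:E : \bar R).
  have ms : measurable_mx (fun t : q.+1.-tuple (coordinates R d) => sel S (diffs t)).
    by move=> i j; under eq_fun do rewrite mxE; exact: mdf.
  have mr := measurable_resid g ms.
  apply/measurable_EFinP; under eq_fun do rewrite face_eventE.
  apply: measurable_funM; first exact: measurable_pos_coefs.
  mfunx; move=> i j; under eq_fun do rewrite mxE; exact: mdf.
pose l := [seq S <- index_enum {set 'I_q} | free_rows k q \subset (S : {set 'I_q})].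
have E1 : \int[power_measure mu q.+1]_t (\sum_(S <- l)
   ((face_event g k S (diffs t))%:R)%:E) = 1.
  transitivity (\int[power_measure mu q.+1]_t (cst 1 t)); last first.
    by rewrite integral_cst// mul1e; exact/power_measureT/beta_lawT.
  apply: (integral_null_ext mN) => //.
  - by apply: emeasurable_sum => S.
  - by move=> t; apply: sume_ge0 => S _; rewrite lee_fin.
  - by move=> t; rewrite negbK => ft; rewrite big_filter sumEFin sum_face_event.
apply: EFin_inj; rewrite -sumEFin -big_filter -/l -[RHS]E1 ge0_integral_sum//.
apply: eq_bigr => S _; rewrite integral_face_event EFinM face_probE.
case: eqP => [Sq|/eqP Sq].
  have r0 : #|~: S| = 0%N by have := cardsC S; rewrite card_ord Sq; lia.
  rewrite r0 mule1; apply: eq_integral => t _; rewrite integral_power0.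
    by rewrite big_ord0 mulr1.
  by under eq_fun do rewrite big_ord0; mfun.
have Slt : (#|S| < q)%N by rewrite ltn_neqAle Sq -[leqRHS]card_ord max_card.
rewrite face_mass//; last exact: leq_trans Slt qd.
by rewrite /alpha addSn cardsC card_ord.
Qed.

(** Complements of these sets are the subsets of size q - p of the q + 1 - k rows that are not free;
    there are k - 1 free rows. *)
Lemma card_supersets q p : (p <= q)%N -> (k <= q.+1)%N ->
  #|[set S : {set 'I_q} | (free_rows k q \subset S) && (#|S| == p)]%SET| = 'C(q.+1 - k, q - p).
Proof.
move=> pq kq; set F := free_rows k q.
have cF : #|~: F| = (q.+1 - k)%N.
  have -> : #|~: F| = #|[pred i : 'I_q | (k.-1 <= i)%N]|.
    by apply: eq_card => i; rewrite !inE -leqNgt /=; lia.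
  have := cardC [pred i : 'I_q | (i < k.-1)%N]; rewrite card_ord.
  rewrite (_ : #|[pred i : 'I_q | (i < k.-1)%N]| = k.-1); last first.
    have kq' : (k.-1 <= q)%N by lia.
    rewrite -sum1_card; under eq_bigl do rewrite inE.
    by rewrite -(big_ord_widen _ (fun=> 1%N)) ?sum1_card ?card_ord.
  rewrite (_ : #|predC _| = #|[pred i : 'I_q | (k.-1 <= i)%N]|); last first.
    by apply: eq_card => i; rewrite !inE /= -leqNgt.
  by lia.
rewrite -cF -cards_draws -[LHS](card_imset _ (inv_inj (@finset.setCK _))).
apply: eq_card => A; rewrite inE; apply/imsetP/andP => [[S]|[AF Aq]].
  rewrite inE => /andP[FS /eqP Sp] ->; rewrite finset.setCS FS; split=> //.
  by rewrite -(addKn p #|~: S|) -{1}Sp cardsC card_ord.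
exists (~: A); last by rewrite finset.setCK.
rewrite inE -finset.setCS finset.setCK AF /=.
by rewrite -(addKn #|A| #|~: A|) cardsC card_ord (eqP Aq) subKn.
Qed.

(** For k <= s both sides are the multinomial coefficient m! / (k! (m-s)! (s-k)!); for s < k both
    vanish. *)
Lemma bin_mul_sub m s : (s <= m)%N -> (k <= m)%N ->
  ('C(m, k) * 'C(m - k, m - s) = 'C(m, s) * 'C(s, k))%N.
Proof.
move=> sm km; have [ks|sk] := leqP k s; last first.
  rewrite (bin_small sk) muln0 [X in (_ * X)%N]bin_small ?muln0//.
  by rewrite ltn_sub2l//; exact: leq_trans km.
have e1 := bin_fact km; have ms : (m - s <= m - k)%N by lia.
have e2 := bin_fact ms; have e3 := bin_fact sm; have e4 := bin_fact ks.
have e5 : (m - k - (m - s) = s - k)%N by lia.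
rewrite e5 in e2.
have P0 : (0 < k`! * ((m - s)`! * (s - k)`!))%N by rewrite !muln_gt0 !fact_gt0.
apply/eqP; rewrite -(eqn_pmul2r P0); apply/eqP.
transitivity (m`!); first by rewrite -e1 -e2; ring.
by rewrite -e3 -e4; ring.
Qed.

(** The sets S are grouped by their number of points s = |S| + 1. The factor bin(m,k) turns the
    number of such sets into bin(m,s) bin(s,k), and the term s = m is isolated. *)
Lemma face_prob_recursion m : (k <= m)%N -> (m <= d.+1)%N ->
  ('C(m, k)%:R * face_prob m = 'C(m, k)%:R -
    \sum_(k <= s < m) 'C(m, s)%:R * Ink m s alpha * ('C(s, k)%:R * face_prob s))%R.
Proof.
move=> km md; have m0 : (0 < m)%N by exact: leq_trans km.
case: m m0 km md => // q _ kq qd.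
have := sum_face_prob qd.
pose G p : R := (face_prob p.+1 * if p == q then 1 else Ink q.+1 p.+1 alpha)%R.
have -> : (\sum_(S : {set 'I_q} | free_rows k q \subset S)
    (face_prob #|S|.+1 * if #|S| == q then 1 else Ink q.+1 #|S|.+1 alpha))%R =
    (\sum_(p < q.+1) 'C(q.+1 - k, q - p)%:R * G p)%R.
  have cq (S : {set 'I_q}) : (#|S| < q.+1)%N by rewrite ltnS -[leqRHS]card_ord max_card.
  rewrite (partition_big (fun S : {set 'I_q} => Ordinal (cq S)) xpredT)//=.
  apply: eq_bigr => p _; have pq : (p <= q)%N by rewrite -ltnS.
  rewrite -(card_supersets pq kq).
  rewrite (eq_bigr (fun=> G p)); last by move=> S /andP[_ /eqP <-].
  rewrite sumr_const mulr_natl; congr (_ *+ _)%R; apply: eq_card => S.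
  by rewrite inE unfold_in.
move=> /(congr1 (fun x => 'C(q.+1, k)%:R * x)%R); rewrite mulr1 mulr_sumr => E.
rewrite -[X in _ = (X - _)%R]E.
rewrite big_ord_recr/= subnn bin0 mul1r /G eqxx mulr1.
suff -> : (\sum_(i < q) 'C(q.+1, k)%:R * ('C(q.+1 - k, q - i)%:R * (face_prob i.+1 * (if i == q :> nat then 1 else Ink q.+1 i.+1 alpha))) =
  \sum_(k <= s < q.+1) 'C(q.+1, s)%:R * Ink q.+1 s alpha * ('C(s, k)%:R * face_prob s))%R.
  by rewrite [RHS]addrAC subrr add0r.
rewrite [RHS]big_nat_cond.
(* The terms with s < k vanish because of bin(s,k), so the sum may start at 1. *)
transitivity (\sum_(1 <= s < q.+1) 'C(q.+1, s)%:R * Ink q.+1 s alpha * ('C(s, k)%:R * face_prob s))%R.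
  rewrite big_add1/= big_mkord; apply: eq_bigr => i _.
  have iq := ltn_ord i; rewrite ltn_eqF//.
  have := @bin_mul_sub q.+1 i.+1 (ltnW iq) kq; rewrite subSS => /(congr1 (fun x => x%:R : R)).
  by rewrite !natrM mulrA => ->; ring.
rewrite (big_cat_nat k0 kq)/= big_nat big1 ?add0r; last first.
  by move=> i /andP[_ ik]; rewrite (bin_small ik) mul0r mulr0.
by rewrite big_nat_cond.
Qed.

End recursion.

(** * Unfolding a recursion into a sum over chains *)

Section chains.
Context {R : realType}.
Variables (N k : nat) (I : nat -> nat -> R).

(** [decreasing_chain] with the starting value m separated from the bound N of the type, so that the
    tail of a chain lives in the same type. *)
Definition chain_from m l (nu : {ffun 'I_l.+1 -> 'I_N.+1}) : bool :=
  [&& nu ord0 == m :> nat,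
      [forall i : 'I_l, (nu (lift ord0 i) < nu (widen_ord (leqnSn l) i))%N] &
      (k <= nu ord_max)%N].

Definition chain_sum l m : R :=
  \sum_(nu : {ffun 'I_l.+1 -> 'I_N.+1} | chain_from m nu)
    (\prod_(i < l) I (nu (widen_ord (leqnSn l) i)) (nu (lift ord0 i))) * 'C(nu ord_max, k)%:R.

Let cons_fun l (p : 'I_N.+1 * {ffun 'I_l.+1 -> 'I_N.+1}) : {ffun 'I_l.+2 -> 'I_N.+1} :=
  [ffun i => if unlift ord0 i is Some j then p.2 j else p.1].

Let cons_fun0 l p : @cons_fun l p ord0 = p.1.
Proof. by rewrite ffunE unlift_none. Qed.

Let cons_funS l p i : @cons_fun l p (lift ord0 i) = p.2 i.
Proof. by rewrite ffunE liftK. Qed.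

Let cons_fun_bij l : bijective (@cons_fun l).
Proof.
exists (fun nu : {ffun 'I_l.+2 -> 'I_N.+1} => (nu ord0, [ffun i : 'I_l.+1 => nu (lift ord0 i)])) => [[a f]|nu].
  by congr pair; [rewrite cons_fun0|apply/ffunP => i; rewrite ffunE cons_funS].
apply/ffunP => i; case: (unliftP ord0 i) => [j ->|->].
  by rewrite cons_funS ffunE.
by rewrite cons_fun0.
Qed.

Lemma chain_sum0 m : (m <= N)%N -> (k <= m)%N -> chain_sum 0 m = 'C(m, k)%:R.
Proof.
move=> mN km; rewrite /chain_sum (bigD1 [ffun=> inord m])/=; last first.
  rewrite /chain_from !ffunE inordK// eqxx km andbT /=; by apply/forallP => -[].
rewrite big_ord0 mul1r ffunE inordK// big1 ?addr0// => nu /andP[/and3P[/eqP nu0 _ _]].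
case/eqP; apply/ffunP => i; rewrite ord1 ffunE; apply: val_inj.
by rewrite /= inordK.
Qed.

Lemma chain_from_ge m l (nu : {ffun 'I_l.+1 -> 'I_N.+1}) : chain_from m nu -> (k <= nu ord0)%N.
Proof.
move=> /and3P[_ /forallP dec kmax].
have H j : (j <= l)%N -> (k <= nu (inord (l - j)))%N.
  elim: j => [_|j IH jl]; first by rewrite subn0 (_ : inord l = ord_max)//; apply: val_inj; rewrite /= inordK.
  have il : (l - j.+1 < l)%N by lia.
  have := dec (Ordinal il); rewrite (_ : widen_ord _ _ = inord (l - j.+1)); last first.
    by apply: val_inj; rewrite /= inordK//; lia.
  rewrite (_ : lift _ _ = inord (l - j)); last by apply: val_inj; rewrite /= inordK /bump/=; lia.
  by move=> /ltnW; apply: leq_trans; apply: IH; exact: ltnW.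
have := H l (leqnn l); rewrite subnn (_ : inord 0 = ord0)//.
by apply: val_inj; rewrite /= inordK.
Qed.

(** A chain of l + 1 steps from m is m followed by a chain of l steps from some j < m; [cons_fun] is
    this bijection. *)
Lemma chain_sumS l m : (m <= N)%N ->
  chain_sum l.+1 m = \sum_(k <= j < m) I m j * chain_sum l j.
Proof.
move=> mN; rewrite /chain_sum (reindex (@cons_fun l))/=; last exact/onW_bij/cons_fun_bij.
pose P (f : {ffun 'I_l.+1 -> 'I_N.+1}) := chain_from (f ord0) f && (f ord0 < m)%N.
pose G (f : {ffun 'I_l.+1 -> 'I_N.+1}) :=
  (\prod_(i < l) I (f (widen_ord (leqnSn l) i)) (f (lift ord0 i))) * 'C(f ord_max, k)%:R.
have maxE : ord_max = lift ord0 (ord_max : 'I_l.+1) by exact: val_inj.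
pose H (a : 'I_N.+1) (f : {ffun 'I_l.+1 -> 'I_N.+1}) : R := I m (f ord0) * G f.
transitivity (\sum_(p | (p.1 == inord m) && P p.2) H p.1 p.2).
  have PE (p : 'I_N.+1 * {ffun 'I_l.+1 -> 'I_N.+1}) :
      chain_from m (cons_fun p) = (p.1 == inord m) && P p.2.
    rewrite /chain_from cons_fun0 -val_eqE /= inordK//; case: eqP => //= pm.
    rewrite maxE cons_funS /P /chain_from eqxx /= andbC [RHS]andbAC [RHS]andbC; congr (_ && _).
    apply/forallP/andP => [h|[/forallP h h0] i].
      split; last by have := h ord0; rewrite cons_funS (_ : widen_ord _ _ = ord0) ?cons_fun0 ?pm//; exact: val_inj.
      apply/forallP => i; have := h (lift ord0 i); rewrite cons_funS.
      by rewrite (_ : widen_ord _ _ = lift ord0 (widen_ord (leqnSn l) i)) ?cons_funS//; exact: val_inj.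
    case: (unliftP ord0 i) => [j ->|->].
      rewrite cons_funS (_ : widen_ord _ _ = lift ord0 (widen_ord (leqnSn l) j)) ?cons_funS//; exact: val_inj.
    by rewrite cons_funS (_ : widen_ord _ _ = ord0) ?cons_fun0 ?pm//; exact: val_inj.
  rewrite (eq_bigl _ _ PE); apply: eq_bigr => p /andP[/eqP pm _].
  rewrite maxE cons_funS big_ord_recl /H /G mulrA; congr (_ * _ * _).
    by rewrite cons_funS (_ : widen_ord _ _ = ord0) ?cons_fun0 ?pm ?inordK//; exact: val_inj.
  apply: eq_bigr => i _; rewrite !cons_funS.
  by rewrite (_ : widen_ord _ _ = lift ord0 (widen_ord (leqnSn l) i)) ?cons_funS//; exact: val_inj.
rewrite -(pair_big (pred1 (inord m)) P H) big_pred1_eq/=.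
rewrite big_geq_mkord (big_ord_widen_cond N.+1 (fun j => true && (k <= j)%N) (fun j => I m j * chain_sum l j)); last exact: leqW.
rewrite (partition_big (fun f : {ffun 'I_l.+1 -> 'I_N.+1} => f ord0) (fun j : 'I_N.+1 => (k <= j)%N && (j < m)%N))/=; last first.
  by move=> f /andP[/chain_from_ge -> ->].
apply: eq_bigr => j /andP[kj jm]; rewrite mulr_sumr; apply: eq_big => [f|f /andP[_ /eqP fj]]; last by rewrite /H fj.
rewrite /P; apply/idP/idP => [/andP[/andP[h _] /eqP fj]|h]; first by rewrite -fj.
have /and3P[/eqP f0 _ _] := h; have f0j : f ord0 = j by exact: val_inj.
by rewrite f0j h jm eqxx.
Qed.

(** The expansion is proved with any number L > m - k of summands. In the induction one and the same
    L then serves all j < m, and the sums over j and over l can be exchanged. *)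
Lemma chain_expansion (B : nat -> R) n : (n <= N)%N ->
  (forall m, (k <= m <= n)%N -> B m = 'C(m, k)%:R - \sum_(k <= j < m) I m j * B j) ->
  (k <= n)%N -> B n = \sum_(l < (n - k).+1) (-1) ^+ l * chain_sum l n.
Proof.
move=> nN BE kn; suff H L m : (k <= m <= n)%N -> (m - k < L)%N ->
    B m = \sum_(l < L) (-1) ^+ l * chain_sum l m by apply: H; rewrite // kn leqnn.
elim: L m => // L IH m kmn mL; have /andP[km mn] := kmn.
have mN := leq_trans mn nN.
rewrite BE// big_ord_recl expr0 mul1r chain_sum0//; congr (_ + _).
transitivity (- \sum_(l < L) (-1) ^+ l * \sum_(k <= j < m) I m j * chain_sum l j).
  under [in RHS]eq_bigr do rewrite mulr_sumr.
  rewrite exchange_big/=; congr (- _); apply: eq_big_nat => j /andP[kj jm].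
  rewrite (IH j); last 2 first.
  - by rewrite kj (leq_trans (ltnW jm)).
  - by move: mL; rewrite !ltnS; apply: leq_trans; rewrite ltn_sub2r// (leq_ltn_trans kj).
  by rewrite mulr_sumr; apply: eq_bigr => l _; rewrite mulrCA.
rewrite -sumrN; apply: eq_bigr => l _; rewrite chain_sumS// exprS mulN1r mulNr.
by [].
Qed.

End chains.

(** * Convex combinations *)

Section convexity.
Context {R : realType} {d : nat}.
Local Notation V := 'rV[R]_d.
Implicit Types A F : set V.

Lemma convex_setP A : (@convex_set R V A) <->
  (forall x y t, 0 <= t -> t <= 1 -> A x -> A y -> A (t *: x + (1 - t) *: y)).
Proof.
split=> [cA x y t t0 t1 Ax Ay|cA x y t].
  by have := cA x y (Itv01 t0 t1); rewrite !inE; exact.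
by rewrite !inE => Ax Ay; exact: cA.
Qed.

Lemma conv_hull_convex A : @convex_set R V (conv_hull A).
Proof.
apply/convex_setP => x y t t0 t1 Ax Ay B [cB AB].
by move/convex_setP : (cB); apply => //; [exact: Ax|exact: Ay].
Qed.

Lemma sub_conv_hull A : A `<=` conv_hull A.
Proof. by move=> x Ax B [_]; exact. Qed.

(** Induction over lists, with normalized partial sums. Membership is required only at nonzero
    weights, so that a point of a face can be written with all the vertices of the simplex. *)
Lemma convex_combination A n (w : 'I_n -> R) (x : 'I_n -> V) :
  @convex_set R V A -> (forall i, 0 <= w i) -> (forall i, w i != 0 -> A (x i)) ->
  \sum_i w i = 1 -> A (\sum_i w i *: x i).
Proof.
move=> /convex_setP cA w0 wA w1.
suff H (s : seq 'I_n) : 0 < \sum_(i <- s) w i ->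
    A ((\sum_(i <- s) w i)^-1 *: \sum_(i <- s) w i *: x i).
  by have := H (index_enum 'I_n); rewrite w1 invr1 scale1r; apply; exact: ltr01.
elim: s => [|i s IH]; first by rewrite big_nil ltxx.
rewrite !big_cons; set W := \sum_(j <- s) w j; set z := \sum_(j <- s) w j *: x j.
have W0 : 0 <= W by exact: sumr_ge0.
have [wi0|wi0] := eqVneq (w i) 0; first by rewrite wi0 scale0r !add0r.
have wip : 0 < w i by rewrite lt_neqAle eq_sym wi0 w0.
have [Wz|Wz] := eqVneq W 0.
  move=> _; have z0 : z = 0.
    rewrite /z big_seq big1// => j js; suff -> : w j = 0 by rewrite scale0r.
    move/eqP : Wz; rewrite psumr_eq0// => /allP/(_ _ js)/=.
    by move=> /eqP.
  by rewrite z0 Wz !addr0 scalerA mulVf// scale1r; exact: wA.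
have Wp : 0 < W by rewrite lt_neqAle eq_sym Wz W0.
have sp : 0 < w i + W by rewrite addr_gt0.
move=> _; have := cA _ _ (w i / (w i + W)) _ _ (wA _ wi0) (IH Wp).
have -> : 1 - w i / (w i + W) = W / (w i + W) by field; exact: lt0r_neq0.
rewrite scalerA -mulrA mulrCA mulfV// mulr1 !(mulrC _ (_^-1)) -scalerA -scalerDr; apply.
  by rewrite mulr_ge0// invr_ge0 ltW.
by rewrite mulrC ler_pdivrMr// mul1r lerDl.
Qed.

Lemma aff_hull_min A B : affine_set B -> A `<=` B -> aff_hull A `<=` B.
Proof. exact: smallest_sub. Qed.

End convexity.

(** * The tangent cone of a simplex at a face *)

Section simplex.
Context {R : realType}.

Lemma lam_square p (g : 'rV[R]_p) (D : 'M[R]_p) : row_free D -> lam g D = g *m invmx D.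
Proof.
move=> fD; apply/esym/lam_unique => //.
by rewrite mulmxA mulmxKV// -row_free_unit.
Qed.

Variables (p : nat) (X : p.+1.-tuple (coordinates R p)).
Let D := diffs X.
Let x i := row_of (tnth X i).
Hypothesis fD : row_free D.
Variable k : nat.
Hypotheses (k0 : (0 < k)%N) (kp : (k <= p)%N).

(** Applied to y minus the vertex 0, these are the barycentric coordinates of y at the other
    vertices. *)
Let coef (y : 'rV[R]_p) := y *m invmx D.

Let coefK y : coef y *m D = y.
Proof. by rewrite /coef mulmxKV// -row_free_unit. Qed.

Let coefD y z : coef (y + z) = coef y + coef z.
Proof. exact: mulmxDl. Qed.

Let coefZ a y : coef (a *: y) = a *: coef y.
Proof. by rewrite /coef scalemxAl. Qed.

Let coef_row c : coef (c *m D) = c.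
Proof. by rewrite /coef mulmxK// -row_free_unit. Qed.

Let xS i : x (lift ord0 i) = x ord0 + row i D.
Proof. by rewrite /D row_diffs addrC subrK. Qed.

Let F := conv_hull [set x i | i in [set i : 'I_p.+1 | (i < k)%N]].
Let P := conv_hull [set x i | i in [set: 'I_p.+1]].

Let coef_xS i j : coef (x (lift ord0 i) - x ord0) 0 j = (i == j)%:R.
Proof.
have -> : x (lift ord0 i) - x ord0 = delta_mx 0 i *m D.
  by rewrite xS addrAC subrr add0r rowE.
by rewrite coef_row mxE eqxx eq_sym.
Qed.

Let hull_mem (S : set 'I_p.+1) (c : 'rV[R]_p) : S ord0 ->
  (forall i, 0 <= c 0 i) -> \sum_i c 0 i <= 1 -> (forall i, c 0 i != 0 -> S (lift ord0 i)) ->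
  conv_hull [set x i | i in S] (x ord0 + c *m D).
Proof.
move=> S0 c0 c1 cS; pose w i := if unlift ord0 i is Some j then c 0 j else 1 - \sum_i c 0 i.
have wS i : w (lift ord0 i) = c 0 i by rewrite /w liftK.
have wz : w ord0 = 1 - \sum_i c 0 i by rewrite /w unlift_none.
have w1 : \sum_i w i = 1.
  by rewrite big_ord_recl wz; under [X in _ + X]eq_bigr do rewrite wS; rewrite subrK.
have -> : x ord0 + c *m D = \sum_i w i *: x i.
  rewrite big_ord_recl; under [in RHS]eq_bigr do rewrite wS xS scalerDr.
  rewrite big_split/= -scaler_suml addrA -scalerDl wz subrK scale1r.
  by congr (_ + _); rewrite mulmx_sum_row.
apply: convex_combination => //; first exact: conv_hull_convex.
- by move=> i; rewrite /w; case: unliftP => // _; rewrite subr_ge0.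
- move=> i wi; apply: sub_conv_hull; exists i => //.
  move: wi; rewrite /w; case: unliftP => [j -> /cS//|-> _]; exact: S0.
Qed.

Let coef_aff t u v i : coef (t *: u + (1 - t) *: v - x ord0) 0 i =
  t * coef (u - x ord0) 0 i + (1 - t) * coef (v - x ord0) 0 i.
Proof.
have -> : t *: u + (1 - t) *: v - x ord0 = t *: (u - x ord0) + (1 - t) *: (v - x ord0).
  by apply/rowP => j; rewrite !mxE; ring.
by rewrite coefD !coefZ [LHS]mxE [X in X + _]mxE [X in _ + X]mxE.
Qed.

Let P_coef y : P y -> forall i, 0 <= coef (y - x ord0) 0 i.
Proof.
move=> Py i; apply: (Py [set y | 0 <= coef (y - x ord0) 0 i]); split=> /=.
  apply/convex_setP => u v t t0 t1 /= u0 v0.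
  by rewrite coef_aff addr_ge0// mulr_ge0// subr_ge0.
move=> _ [j _ <-] /=; case: (unliftP ord0 j) => [l ->|->]; first by rewrite coef_xS.
by rewrite subrr /coef mul0mx mxE.
Qed.

Let F_coef y : aff_hull F y -> forall i : 'I_p, (k <= i.+1)%N -> coef (y - x ord0) 0 i = 0.
Proof.
move=> Fy i ki; pose B := [set y | coef (y - x ord0) 0 i = 0].
have affB : affine_set B.
  move=> u v t; rewrite /B /= => u0 v0.
  by rewrite coef_aff u0 v0 !mulr0 addr0.
apply: (aff_hull_min affB) Fy => z; apply; split; first by apply/convex_setP => *; exact: affB.
move=> _ [j /= jk <-]; rewrite /B /=; case: (unliftP ord0 j) => [l jE|->].
  rewrite jE coef_xS; case: eqP => // li; move: jk; rewrite jE /= li /bump /=; lia.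
by rewrite subrr /coef mul0mx mxE.
Qed.

Let enorm_coord (v : 'rV[R]_p) i : `|v 0 i| <= enorm v.
Proof.
rewrite -sqrtr_sqr ler_wsqrtr// (bigD1 i)//= lerDl sumr_ge0// => j _; exact: sqr_ge0.
Qed.

(** A crude operator norm of [coef], from the Euclidean norm to the sum norm. *)
Let K : R := \sum_i \sum_j `|invmx D j i|.

Let coef_bound v : \sum_i `|coef v 0 i| <= enorm v * K.
Proof.
rewrite /K mulr_sumr; apply: ler_sum => i _; rewrite mxE mulr_sumr.
apply: (le_trans (ler_norm_sum _ _ _)); apply: ler_sum => j _.
by rewrite normrM ler_wpM2r.
Qed.

(** The barycenter of the face. The vertex 0 has no coordinate of its own and receives the remaining
    weight 1/k. *)
Let c0 : 'rV[R]_p := \row_i if (i.+1 < k)%N then k%:R^-1 else 0.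

Let kR : 0 < k%:R :> R. Proof. by rewrite ltr0n. Qed.

Let c0_sum : \sum_i c0 0 i = 1 - k%:R^-1.
Proof.
under eq_bigr do rewrite mxE; rewrite -big_mkcond/= sumr_const -[k%:R^-1 *+ _]mulr_natl.
have -> : #|[pred i : 'I_p | (i.+1 < k)%N]| = k.-1.
  rewrite -sum1_card; under eq_bigl do rewrite inE -[X in (_ < X)%N](prednK k0) ltnS.
  by rewrite -(big_ord_widen _ (fun=> 1%N)) ?sum1_card ?card_ord//; lia.
by rewrite -subn1 natrB// mulrBl mulfV ?gt_eqF// mul1r.
Qed.

Let f0 : 'rV[R]_p := x ord0 + c0 *m D.

Let relint_f0 : relint F f0.
Proof.
have kV : 0 < k%:R^-1 :> R by rewrite invr_gt0.
(* All k weights of the barycenter are 1/k, so a perturbation of sum norm below 1/k leaves them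
   nonnegative. *)
have F0 y : aff_hull F y -> enorm (y - f0) * K < k%:R^-1 -> F y.
  move=> Fy ye; have -> : y = x ord0 + coef (y - x ord0) *m D by rewrite coefK addrC subrK.
  have yx : y - x ord0 = c0 *m D + (y - f0) by rewrite addrCA; congr (_ + _); rewrite /f0 opprD addrCA subrr addr0.
  have dc : coef (y - x ord0) = c0 + coef (y - f0) by rewrite yx (coefD (c0 *m D)) coef_row.
  have bnd : \sum_i `|coef (y - f0) 0 i| < k%:R^-1 by exact: le_lt_trans (coef_bound _) ye.
  have bi i : `|coef (y - f0) 0 i| < k%:R^-1.
    apply: le_lt_trans bnd; rewrite (bigD1 i)//= lerDl; exact: sumr_ge0.
  apply: hull_mem => //=.
  - move=> i; have [ki|ki] := leqP k i.+1; first by rewrite F_coef.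
    rewrite dc mxE [c0 0 i]mxE ki; have := bi i; rewrite ltr_norml => /andP[h _]; lra.
  - rewrite dc; under eq_bigr do rewrite mxE; rewrite big_split/= c0_sum.
    have : \sum_i coef (y - f0) 0 i <= \sum_i `|coef (y - f0) 0 i|.
      by apply: ler_sum => i _; exact: ler_norm.
    by move=> h; lra.
  - move=> i ci; rewrite /bump leq0n add1n ltnNge; apply: contra ci => ki; by rewrite F_coef.
have K0 : 0 <= K by apply: sumr_ge0 => i _; exact: sumr_ge0.
have en0 : enorm (f0 - f0) = 0.
  rewrite subrr /enorm big1 ?sqrtr0// => i _; by rewrite mxE expr0n.
split; first by apply: hull_mem => //=; [move=> i; rewrite mxE; case: ifP => // _; exact: ltW|
  by rewrite c0_sum gerBl ltW|by move=> i; rewrite mxE; case: ifP => //; rewrite eqxx].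
(* K + 1 in place of K keeps the denominator positive. *)
exists (k%:R^-1 / (K + 1)); first by rewrite divr_gt0// ltr_wpDl.
move=> y Fy ye; apply: F0 => //.
have K1 : 0 < K + 1 by rewrite ltr_wpDl.
have en : 0 <= enorm (y - f0) by exact: sqrtr_ge0.
move: ye; rewrite ltr_pdivlMr// => ye; apply: le_lt_trans ye.
by rewrite ler_wpM2l// lerDl.
Qed.

(** The coordinates of index i with k <= i + 1 vanish on the affine hull of the face, so a direction
    into the simplex has them nonnegative. Conversely, at the barycenter the weights of the face are
    1/k, and a short enough step keeps these nonnegative as well. *)
Lemma tangent_cone_simplex y : tangent_cone F P y <->
  forall i : 'I_p, (k <= i.+1)%N -> 0 <= lam y D 0 i.
Proof.
split=> [[z [[Fz _] [e e0 Pz]]] i ki|h].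
  have Fz' : aff_hull F z by move=> B [_]; exact.
  rewrite lam_square// -/(coef y); have := P_coef Pz i.
  rewrite addrAC coefD mxE F_coef// add0r coefZ mxE pmulr_rge0//.
exists f0; split; first exact: relint_f0.
pose M := \sum_i `|coef y 0 i|; have M0 : 0 <= M by exact: sumr_ge0.
have kV : 0 < k%:R^-1 :> R by rewrite invr_gt0.
have M1 : 0 < M + 1 by rewrite ltr_wpDl.
(* A step of this length changes the weights by at most 1/k in sum norm. *)
pose e : R := k%:R^-1 / (M + 1); have e0 : 0 < e by rewrite divr_gt0.
have eM : e * M <= k%:R^-1.
  by rewrite /e mulrAC ler_pdivrMr// ler_wpM2l ?(ltW kV)// lerDl.
have cE i : (c0 + e *: coef y) 0 i = (if (i.+1 < k)%N then k%:R^-1 else 0) + e * coef y 0 i.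
  by rewrite mxE [X in X + _]mxE [X in _ + X]mxE.
exists e => //; have -> : f0 + e *: y = x ord0 + (c0 + e *: coef y) *m D.
  by rewrite mulmxDl -scalemxAl coefK addrA.
apply: hull_mem => //=.
- move=> i; rewrite cE.
  have [ki|ki] := leqP k i.+1.
    by rewrite add0r; apply: mulr_ge0; [exact: ltW|rewrite /coef -lam_square//; exact: h].
  have : - (e * coef y 0 i) <= e * M.
    rewrite -mulrN ler_pM2l// (le_trans (ler_norm _))// normrN.
    by rewrite /M (bigD1 i)//= lerDl; exact: sumr_ge0.
  by lra.
- have -> : \sum_i (c0 + e *: coef y) 0 i = 1 - k%:R^-1 + e * \sum_i coef y 0 i.
    rewrite -c0_sum mulr_sumr -big_split/=; apply: eq_bigr => i _; by rewrite cE [c0 0 i]mxE.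
  have : e * \sum_i coef y 0 i <= e * M.
    by rewrite ler_pM2l//; apply: ler_sum => i _; exact: ler_norm.
  by move=> h'; lra.
Qed.

(** The cone contains the basis of differences, so its solid angle is measured on the sphere of the
    whole space. *)
Lemma lin_hull_tangent_cone : lin_hull (tangent_cone F P) = setT.
Proof.
apply/seteqP; split => // y _ B [[B0 linB] TB].
have Brow i : B (row i D).
  apply: TB; apply/tangent_cone_simplex => j _; rewrite lam_square// rowE.
  by rewrite -/(coef _) coef_row mxE eqxx; case: eqP.
rewrite -[y]coefK mulmx_sum_row; apply: (big_ind B) => //.
- by move=> u v Bu Bv; have := linB 1 u v Bu Bv; rewrite scale1r.
- by move=> i _; have := linB (coef y 0 i) _ _ (Brow i) B0; rewrite addr0.
Qed.

Lemma face_neq_simplex : F <> P.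
Proof.
move=> FP; have pp : (p.-1 < p)%N by rewrite prednK//; exact: leq_trans kp.
pose i := Ordinal pp; have Pi : P (x (lift ord0 i)) by apply: sub_conv_hull; exists (lift ord0 i).
have ki : (k <= i.+1)%N by rewrite /= prednK//; exact: leq_trans kp.
have : aff_hull F (x (lift ord0 i)) by rewrite FP => B [_]; exact.
by move=> /F_coef/(_ i ki)/eqP; rewrite coef_xS eqxx oner_eq0.
Qed.

End simplex.

(** * Integrals of functions not known to be measurable *)

Section null_modification.
Context d (T : measurableType d) {R : realType} (mu : {measure set T -> \bar R}).
Local Open Scope ereal_scope.

(** The integral of a nonnegative function is a supremum over simple functions below it, hence
    monotone for arbitrary functions. *)
Lemma ge0_le_integral_nonmeasurable (f g : T -> \bar R) :
  (forall x, 0 <= f x) -> (forall x, f x <= g x) -> \int[mu]_x f x <= \int[mu]_x g x.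
Proof.
move=> f0 fg; have g0 x : 0 <= g x by exact: le_trans (fg x).
rewrite !ge0_integralTE//; apply: le_ereal_sup => _ [h hf <-]; exists h => // x.
exact: le_trans (hf x) (fg x).
Qed.

(** [f] lies between [g] set to 0 on [N] and [g] set to +oo on [N], two measurable functions with
    the integral of [g]. It is meant for [simplex_angle]. *)
Lemma integral_null_ext_nonmeasurable (N : T -> bool) (f g : T -> \bar R) :
  measurable_fun setT N -> \int[mu]_x ((N x)%:R)%:E = 0 -> measurable_fun setT g ->
  (forall x, 0 <= f x) -> (forall x, 0 <= g x) ->
  (forall x, ~~ N x -> f x = g x) -> \int[mu]_x f x = \int[mu]_x g x.
Proof.
move=> mN N0 mg f0 g0 fg; apply/eqP; rewrite eq_le; apply/andP; split.
  rewrite (@integral_null_ext _ _ _ mu N g (fun x => g x + +oo * ((N x)%:R)%:E))//.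
  - apply: ge0_le_integral_nonmeasurable => // x; have [Nx|Nx] := boolP (N x).
      by rewrite mule1 addey ?leey// gt_eqF// (lt_le_trans _ (g0 x)).
    by rewrite mule0 adde0 fg.
  - by apply: emeasurable_funD => //; apply: emeasurable_funM => //; mfun.
  - by move=> x; rewrite adde_ge0// mule_ge0// lee_fin.
  - by move=> x /negbTE ->; rewrite mule0 adde0.
rewrite (@integral_null_ext _ _ _ mu N g (fun x => g x * ((~~ N x)%:R)%:E))//.
- apply: ge0_le_integral_nonmeasurable => x; first by rewrite mule_ge0// lee_fin.
  by have [Nx|Nx] := boolP (N x); rewrite ?mule0 ?mule1// fg.
- by apply: emeasurable_funM => //; mfun; exact: measurable_neg.
- by move=> x; rewrite mule_ge0// lee_fin.
- by move=> x ->; rewrite mule1.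
Qed.

End null_modification.

(** * The cone measure on the sphere *)

Section sphere_law.
Context {R : realType}.
Local Open Scope ereal_scope.

(** The beta law of exponent 0 is the uniform law in the ball. *)
Lemma sphere_lawE d (A : set (coordinates R d)) : measurable A ->
  sphere_law d A = beta_law d 0 (@direction R d @^-1` A).
Proof.
move=> mA; have b1 : (-1 < 0 :> R)%R by rewrite ltrN10.
have mdA : measurable (@direction R d @^-1` A).
  by rewrite -[X in measurable X]setTI; exact: measurable_direction.
have E (B : set (coordinates R d)) : measurable B -> beta_law d 0 B =
    (beta_const d 0)%:E * lebesgue_power d (B `&` open_ball d).
  move=> mB; rewrite /= /beta_law eq_sym oppr_eq0 oner_eq0.
  under eq_integral do rewrite /beta_density powRr0 mulr1 EFinM.
  rewrite ge0_integralZl//; last 3 first.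
  - by rewrite integral_indic//; [rewrite setIC|exact: measurable_open_ball].
  - by apply/measurable_EFinP; apply: measurable_funTS; apply: measurable_indic; exact: measurable_open_ball.
  - by rewrite lee_fin ltW// beta_const_gt0.
have := beta_lawT d b1; rewrite E// setTI => V1.
have Vfin : lebesgue_power d (@open_ball R d) \is a fin_num.
  by rewrite ge0_fin_numE// lebesgue_power_open_ball.
have c0 := beta_const_gt0 d b1.
rewrite E// /sphere_law /=; congr (_%:E * _).
have V1' : (beta_const d 0 * fine (lebesgue_power d (@open_ball R d)) = 1)%R.
  by apply: EFin_inj; rewrite EFinM fineK.
by rewrite -[RHS]invrK; congr (_^-1)%R; rewrite -[RHS]mulr1 -V1' mulKf// gt_eqF.
Qed.

Lemma integral_sphere_law d (f : coordinates R d -> \bar R) :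
  measurable_fun setT f -> (forall x, 0 <= f x) ->
  \int[sphere_law d]_x f x = \int[beta_law d 0]_x f (direction x).
Proof.
move=> mf f0; pose nu0 := [the {measure set _ -> \bar R} of pushforward (beta_law d 0) (@direction R d)].
pose nu := nu0 (@measurable_direction R d).
rewrite (@eq_measure_integral _ _ _ _ nu); last by move=> A mA _; exact: sphere_lawE.
rewrite ge0_integral_pushforward//; exact: measurable_direction.
Qed.

Lemma sphere_lawT d : sphere_law d setT = 1 :> \bar R.
Proof. by rewrite sphere_lawE// preimage_setT beta_lawT// ltrN10. Qed.

(** [direction] maps the origin to itself, so that 0 is attained; but only from the origin, which
    lies in a coordinate hyperplane. *)
Lemma sphere_law_neq0 d : (0 < d)%N ->
  \int[sphere_law d]_u ((row_of u == 0%R)%:R)%:E = 0 :> \bar R.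
Proof.
move=> d0; have mE : measurable_fun setT (fun u : coordinates R d => ((row_of u == 0%R)%:R)%:E : \bar R).
  rewrite (_ : (fun u => _) = (fun u => ((dot (row_of u) (row_of u) == 0)%R%:R)%:E)).
    by mfunx.
  by apply/funext => u; rewrite dot_eq0.
rewrite integral_sphere_law//; pose i0 := Ordinal d0.
pose N (u : coordinates R d) := dot (row_of u) (delta_mx 0%R i0 : 'rV[R]_d) == 0%R :> R.
have N0 : \int[beta_law d 0]_u ((N u)%:R)%:E = 0 :> \bar R.
  apply: beta_law_no_hyperplane; first exact: ltrN10.
  by apply/eqP => /rowP/(_ i0); rewrite !mxE !eqxx => /eqP; rewrite oner_eq0.
apply: (@integral_null_le _ _ _ _ N) => //.
- by rewrite /N; mfunx.
- exact: (measurableT_comp mE (@measurable_direction R d)).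
move=> u Nu; case: eqP => // u0; suff : N u by rewrite (negbTE Nu).
have uE : tnth u i0 = 0%R.
  apply/eqP; have /rowP/(_ i0) := u0; rewrite !mxE tnth_mktuple => /eqP.
  rewrite mulf_eq0 invr_eq0 => /orP[|//]; rewrite sqrtr_eq0 => h.
  have : (row_of u 0 i0 ^+ 2 <= 0)%R.
    by apply: le_trans h; rewrite (bigD1 i0)//= lerDl sumr_ge0// => j _; exact: sqr_ge0.
  by rewrite mxE real_exprn_even_le0//= num_real.
by rewrite /N /dot (bigD1 i0)//= !mxE uE mul0r add0r big1// => j ji; rewrite !mxE (negbTE ji) andbF mulr0.
Qed.

End sphere_law.

Lemma measurable_fun_pos_coefs {R : realType} d d0 (T : measurableType d0) k p
    (g : T -> 'rV[R]_d) (D : T -> 'M[R]_(p, d)) : measurable_mx g -> measurable_mx D ->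
  measurable_fun setT (fun t => pos_coefs (g t) k (D t)).
Proof.
move=> mg mD; have mL : measurable_mx (fun t => lam (g t) (D t)).
  rewrite /lam /gram; mfunx; first by apply: measurable_det; mfunx.
  by apply: measurable_adj; mfunx.
rewrite /pos_coefs; under eq_fun do rewrite -big_filter.
apply: measurable_prod => i _; apply: measurable_fun_nat_of_bool.
by apply: measurable_fun_ler => //; exact: mL.
Qed.

(** * The expected angle as an integral over directions *)

Section angle_integral.
Context {R : realType}.
Local Open Scope ereal_scope.
Variable p : nat.
Hypothesis p0 : (0 < p)%N.

(** The basis is a choice, known only through [basisB]; its size [m] is a different term from [p],
    so directions enter as u M with u on the sphere of R^m. *)
Let B := some_orthonormal_basis [set: 'rV[R]_p].
Let m := tag B.
Let M : 'M[R]_(m, p) := tagged B.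

Let basisB : orthonormal_basis setT B.
Proof.
apply: (xgetPex _ _); exists (Tagged (fun m => 'M[R]_(m, p)) (1%:M : 'M[R]_p)%R); split => /=.
  by rewrite mul1mx trmx1.
by apply/seteqP; split => // v _; exists v => //; rewrite mulmx1.
Qed.

Let m0 : (0 < m)%N.
Proof.
have [_ rB] := basisB; rewrite lt0n; apply/eqP => mE.
have [v _ vE] : range (fun v : 'rV_m => v *m M)%R (delta_mx 0%R (Ordinal p0) : 'rV[R]_p) by rewrite rB.
have : (\rank (v *m M)%R <= m)%N.
  by rewrite (leq_trans (mxrankM_maxr _ _))// rank_leq_row.
by rewrite vE mxrank_delta mE.
Qed.

Let uM0 (u : 'rV[R]_m) : u != 0%R -> (u *m M)%R != 0%R.
Proof.
have [MM _] := basisB; apply: contra => /eqP uM; rewrite -[u]mulmx1 -MM mulmxA.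
by rewrite -/M uM mul0mx.
Qed.

Variables (k : nat) (beta : R).
Hypotheses (k0 : (0 < k)%N) (kp : (k <= p)%N).
Notation mu := (beta_law p beta).
Hypothesis muT : mu setT = 1.
Hypothesis nomu : charges_no_hyperplane mu.

Lemma simplex_angleE (X : p.+1.-tuple (coordinates R p)) : row_free (diffs X) ->
  (simplex_angle k X)%:E = \int[sphere_law m]_u (pos_coefs (row_of u *m M)%R k (diffs X))%:E.
Proof.
move=> fX; rewrite /simplex_angle /internal_angle asboolF; last exact: face_neq_simplex.
rewrite /solid_angle lin_hull_tangent_cone// -/B -/m -/M.
set A := [set u | _].
have mp : measurable_fun setT (fun u : coordinates R m => pos_coefs (row_of u *m M)%R k (diffs X)).
  by apply: measurable_fun_pos_coefs; mfunx.
have AE u : pos_coefs (row_of u *m M)%R k (diffs X) = \1_A u.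
  rewrite /pos_coefs prod_nat_of_bool indicE; congr (nat_of_bool _)%:R%R.
  apply/forallP/idP => [h|]; last rewrite inE.
    rewrite inE; apply/tangent_cone_simplex => // i ki; have := h i; rewrite ki implyTb.
    by [].
  by move=> /(tangent_cone_simplex fX k0 kp) h i; apply/implyP => /h.
have mA : measurable A.
  have -> : A = (fun u : coordinates R m => pos_coefs (row_of u *m M)%R k (diffs X)) @^-1` [set 1%R].
    apply/seteqP; split=> u /=; rewrite AE indicE.
      by move=> Au; rewrite mem_set.
    by case: (boolP (u \in A)) => [/set_mem//|_] /eqP; rewrite eq_sym oner_eq0.
  by rewrite -[X in measurable X]setTI; apply: mp => //; exact: measurable_set1.
rewrite fineK; last exact: fin_num_measure.
under eq_integral do rewrite AE.
by rewrite integral_indic// setIT.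
Qed.

Let mp d0 (T : measurableType d0) (f : T -> p.+1.-tuple (coordinates R p)) (g : T -> coordinates R m) :
  measurable_fun setT f -> measurable_fun setT g ->
  measurable_fun setT (fun z => (pos_coefs (row_of (g z) *m M)%R k (diffs (f z)))%:E).
Proof.
move=> mf mg; apply/measurable_EFinP; apply: measurable_fun_pos_coefs; first by mfunx.
exact: measurable_diffs.
Qed.

Lemma Jnk_integral : (Jnk p.+1 k beta)%:E =
  \int[sphere_law m]_u \int[power_measure mu p.+1]_X
    (pos_coefs (row_of u *m M)%R k (diffs X))%:E.
Proof.
rewrite tonelli; last 2 first.
- by apply: mp.
- by move=> *; rewrite lee_fin pos_coefs_ge0.
have angle_ge0 (X : p.+1.-tuple (coordinates R p)) : 0 <= (simplex_angle k X)%:E.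
  rewrite lee_fin /simplex_angle /internal_angle; case: ifP => // _.
  by rewrite /solid_angle fine_ge0.
have E : \int[power_measure mu p.+1]_X (simplex_angle k X)%:E =
   \int[power_measure mu p.+1]_X \int[sphere_law m]_u (pos_coefs (row_of u *m M)%R k (diffs X))%:E.
  apply: (@integral_null_ext_nonmeasurable _ _ _ _ (fun X => ~~ row_free (diffs X))) => //.
  - by apply: measurable_neg; apply: measurable_row_free; apply: measurable_diffs; mfun.
  - exact: power_measure_diffs.
  - apply: measurable_fun_integral; first by apply: mp.
    by move=> *; rewrite lee_fin pos_coefs_ge0.
  - by move=> X; apply: integral_ge0 => u _; rewrite lee_fin pos_coefs_ge0.
  - by move=> X; rewrite negbK => /simplex_angleE.
rewrite /Jnk ltn_eqF// /Rintegral /= E fineK// ge0_fin_numE; last first.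
  by apply: integral_ge0 => X _; apply: integral_ge0 => u _; rewrite lee_fin pos_coefs_ge0.
apply: (@le_lt_trans _ _ (\int[power_measure mu p.+1]_X (cst 1 X))).
  apply: ge0_le_integral_nonmeasurable => X.
    by apply: integral_ge0 => u _; rewrite lee_fin pos_coefs_ge0.
  apply: (@le_trans _ _ (\int[sphere_law m]_u (cst 1 u))).
    apply: ge0_le_integral_nonmeasurable => u; first by rewrite lee_fin pos_coefs_ge0.
    by rewrite lee_fin pos_coefs_le1.
  by rewrite integral_cst// mul1e (_ : _ setT = 1)//; exact: sphere_lawT.
rewrite integral_cst// mul1e (_ : _ setT = 1) ?ltry//; exact: power_measureT.
Qed.

Lemma Jnk_const c : (forall g : 'rV[R]_p, g != 0%R ->
    \int[power_measure mu p.+1]_X (pos_coefs g k (diffs X))%:E = c%:E) ->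
  Jnk p.+1 k beta = c.
Proof.
move=> gc; apply: EFin_inj; rewrite Jnk_integral.
transitivity (\int[sphere_law m]_u (cst c%:E u)); last first.
  by rewrite integral_cst// (_ : _ setT = 1) ?mule1//; exact: sphere_lawT.
have c0 : 0 <= c%:E.
  have d0 : (delta_mx 0%R (Ordinal p0) : 'rV[R]_p) != 0%R.
    by apply/eqP => /rowP/(_ (Ordinal p0)); rewrite !mxE !eqxx => /eqP; rewrite oner_eq0.
  by rewrite -(gc _ d0); apply: integral_ge0 => X _; rewrite lee_fin pos_coefs_ge0.
apply: (@integral_null_ext _ _ _ _ (fun u : coordinates R m => row_of u == 0%R)) => //.
- rewrite (_ : (fun u => _) = (fun u => (dot (row_of u) (row_of u) == 0%R :> R))); first by mfunx.
  by apply/funext => u; rewrite dot_eq0.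
- exact: sphere_law_neq0.
- apply: measurable_fun_integral; first by apply: mp.
  by move=> *; rewrite lee_fin pos_coefs_ge0.
- by move=> u; apply: integral_ge0 => X _; rewrite lee_fin pos_coefs_ge0.
- by move=> u u0; rewrite gc//; exact: uM0.
Qed.

End angle_integral.

(** * The formula for beta > -1 *)

Section chain_formula.
Context {R : realType}.

Definition chain_formula n k (alpha : R) : R :=
  \sum_(l < (n - k).+1) (-1) ^+ l * chain_sum n k (fun i j => bbI i j alpha) l n.

(** The independence of [g] is obtained here: the recursion has a unique solution, and [g] does not
    occur in its coefficients. *)
Lemma face_prob_chain_formula p k (beta : R) (g : 'rV[R]_p) :
  (0 < k <= p)%N -> -1 < beta -> g != 0 ->
  face_prob beta g k p.+1 = chain_formula p.+1 k (2 * beta + p%:R) / 'C(p.+1, k)%:R.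
Proof.
move=> /andP[k0 kp] beta1 g0; set alpha := 2 * beta + p%:R.
have p0 : (0 < p)%N by exact: leq_trans kp.
(* In fact alpha > -1, so the conventional value in [bbI] does not occur. *)
have aN1 : alpha != -1.
  have p1 : 1 <= p%:R :> R by rewrite ler1n.
  by rewrite gt_eqF// /alpha; lra.
have C0 : 0 < 'C(p.+1, k)%:R :> R by rewrite ltr0n bin_gt0 leqW.
apply: (canRL (mulfK (lt0r_neq0 C0))); rewrite mulrC.
apply: (@chain_expansion _ p.+1 k _ (fun m => 'C(m, k)%:R * face_prob beta g k m) p.+1) => //; last exact: leqW.
move=> m /andP[km mp]; rewrite face_prob_recursion//; congr (_ - _).
by apply: eq_big_nat => s _; rewrite /bbI (negbTE aN1) !andbF.
Qed.

Lemma bbJ_chain_formula p k (beta : R) : -1 < beta -> (0 < k <= p)%N ->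
  bbJ p.+1 k beta = chain_formula p.+1 k (2 * beta + p%:R).
Proof.
move=> beta1 kp'; have /andP[k0 kp] := kp'.
have p0 : (0 < p)%N by exact: leq_trans kp.
have C0 : 0 < 'C(p.+1, k)%:R :> R by rewrite ltr0n bin_gt0 leqW.
rewrite /bbJ (gt_eqF beta1) !andbF.
rewrite (@Jnk_const _ p p0 k beta k0 kp (beta_lawT p beta1) (beta_law_no_hyperplane beta1)
  (chain_formula p.+1 k (2 * beta + p%:R) / 'C(p.+1, k)%:R)); first by rewrite mulrC divfK// gt_eqF.
by move=> g g0; rewrite -face_probE// (face_prob_chain_formula kp').
Qed.

Lemma bbJ_diag n (beta : R) : (0 < n)%N ->
  bbJ n n beta = 1 /\ (forall alpha : R, chain_formula n n alpha = 1).
Proof.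
move=> n0; split=> [|alpha].
  rewrite /bbJ /Jnk eqxx binn mul1r; case: ifP => //.
by rewrite /chain_formula subnn big_ord1 expr0 mul1r chain_sum0// binn.
Qed.

End chain_formula.

(** * The direction of a beta point is uniform *)

Section direction_law.
Context {R : realType}.
Local Open Scope ereal_scope.
Notation leb := (@lebesgue_measure R).

Lemma enormZ d (r : R) (v : 'rV[R]_d) : (0 <= r)%R -> enorm (r *: v) = (r * enorm v)%R.
Proof.
move=> r0; apply/eqP; rewrite -(@eqrXn2 _ 2)// ?mulr_ge0 ?sqrtr_ge0//.
by rewrite exprMn !enorm_sqr dotZl dotZr mulrA expr2.
Qed.

Lemma enorm_eq0 d (v : 'rV[R]_d) : (enorm v == 0%R) = (v == 0%R).
Proof. by rewrite -dot_eq0 -enorm_sqr expf_eq0. Qed.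

Lemma measurable_enorm_comp d0 (T : measurableType d0) d (f : T -> 'rV[R]_d) :
  measurable_mx f -> measurable_fun setT (fun t => enorm (f t)).
Proof.
move=> mf; rewrite /enorm; apply: measurable_fun_sqrt; apply: measurable_sum => i.
by apply: measurable_funX; exact: mf.
Qed.

Lemma lebesgue_power_neq0 d : (0 < d)%N ->
  \int[lebesgue_power d]_u ((row_of u == 0%R)%:R)%:E = 0 :> \bar R.
Proof.
move=> d0; pose i0 := Ordinal d0; pose w : 'rV[R]_d := delta_mx 0%R i0.
have w0 : w != 0%R by apply/eqP => /rowP/(_ i0); rewrite !mxE !eqxx => /eqP; rewrite oner_eq0.
apply: (@integral_null_le _ _ _ _ (fun u => dot (row_of u) w == 0%R)) => //.
- by mfunx.
- exact: lebesgue_power_no_hyperplane.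
- rewrite (_ : (fun u => _) = (fun u => ((dot (row_of u) (row_of u) == 0)%R%:R)%:E)); first by mfunx.
  by apply/funext => u; rewrite dot_eq0.
- move=> u uw; case: eqP => // u0; by move: uw; rewrite u0 dot0l eqxx.
Qed.

(* Tonelli and the substitutions x -> x / t and t -> |x| t turn int H(x) a(|x|) dx int t^(d-1) b(t) dt
   into int H(x) b(|x|) dx times a constant that depends on a only. *)
Lemma radial_exchange d (H : 'rV[R]_d -> \bar R) (a b : R -> R) : (0 < d)%N ->
  mfun_row H -> (forall v, 0 <= H v) -> (forall r v, (0 < r)%R -> H (r *: v)%R = H v) ->
  measurable_fun setT a -> measurable_fun setT b ->
  (forall t, (0 <= a t)%R) -> (forall t, (0 <= b t)%R) ->
  (\int[lebesgue_power d]_x (H (row_of x) * (a (enorm (row_of x)))%:E)) *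
    \int[leb]_t ((0 < t)%R%:R * t ^+ d.-1 * b t)%:E =
  (\int[lebesgue_power d]_x (H (row_of x) * (b (enorm (row_of x)))%:E)) *
    \int[leb]_t ((0 < t)%R%:R * t^-1 ^+ d.+1 * a t^-1)%:E.
Proof.
move=> d0 mH H0 HZ ma mb a0 b0.
have mH' d1 (T : measurableType d1) (f : T -> 'rV[R]_d) : measurable_mx f ->
    measurable_fun setT (fun t => H (f t)) by exact: mfun_row_comp.
have ma' d1 (T : measurableType d1) (f : T -> R) : measurable_fun setT f ->
    measurable_fun setT (fun t => a (f t)) by exact: (measurableT_comp ma).
have mb' d1 (T : measurableType d1) (f : T -> R) : measurable_fun setT f ->
    measurable_fun setT (fun t => b (f t)) by exact: (measurableT_comp mb).
pose N (x : coordinates R d) := enorm (row_of x).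
have N0 x : (0 <= N x)%R by exact: sqrtr_ge0.
have mN d1 (T : measurableType d1) (f : T -> coordinates R d) : measurable_fun setT f ->
    measurable_fun setT (fun t => N (f t)).
  by move=> mf; apply: measurable_enorm_comp; mfunx.
have mz : measurable_fun setT (fun x : coordinates R d => row_of x == 0%R).
  rewrite (_ : (fun u => _) = (fun u => (dot (row_of u) (row_of u) == 0)%R)); first by mfunx.
  by apply/funext => u; rewrite dot_eq0.
have z0 := lebesgue_power_neq0 d0.
pose kb (t : R) : R := ((0 < t)%R%:R * t ^+ d.-1 * b t)%R.
pose ka (t : R) : R := ((0 < t)%R%:R * t^-1 ^+ d.+1 * a t^-1)%R.
have mkb : measurable_fun setT kb by rewrite /kb; mfun.
have mV : measurable_fun setT (fun t : R => t^-1)%R by apply: measurable_invr; exact: measurable_id.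
have mka : measurable_fun setT ka by have maV := ma' _ _ _ mV; rewrite /ka; mfun.
have kb0 t : (0 <= kb t)%R.
  rewrite /kb; case: (ltP 0%R t) => t0; last by rewrite !mul0r.
  by rewrite !mulr_ge0// exprn_ge0// ltW.
have ka0 t : (0 <= ka t)%R.
  rewrite /ka; case: (ltP 0%R t) => t0; last by rewrite !mul0r.
  by rewrite !mulr_ge0// exprn_ge0// invr_ge0 ltW.
rewrite -/(\int[leb]_t (kb t)%:E) -/(\int[leb]_t (ka t)%:E).
have mkb' d1 (T : measurableType d1) (f : T -> R) : measurable_fun setT f ->
    measurable_fun setT (fun t => kb (f t)) by exact: (measurableT_comp mkb).
have mka' d1 (T : measurableType d1) (f : T -> R) : measurable_fun setT f ->
    measurable_fun setT (fun t => ka (f t)) by exact: (measurableT_comp mka).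
have scale (F : R -> R) (s : R) : (0 < s)%R -> measurable_fun setT F -> (forall t, (0 <= F t)%R) ->
    \int[leb]_t (s * F (s * t))%:E = \int[leb]_t (F t)%:E.
  move=> s0 mF F0; have mF' : measurable_fun setT (fun t => (F t)%:E) by mfun.
  have := @integral_affine R s 0%R (fun t => (F t)%:E) (lt0r_neq0 s0) mF' F0.
  under eq_integral do rewrite addr0; move=> E.
  under eq_integral do rewrite EFinM.
  rewrite ge0_integralZl//; last 3 first.
  - by apply/measurable_EFinP; apply: (measurableT_comp mF); mfun.
  - by move=> t _; rewrite lee_fin.
  - by rewrite lee_fin ltW.
  by rewrite E muleA -EFinM ger0_norm ?invr_ge0 ?(ltW s0)// mulfV ?mul1e// gt_eqF.
(* The t-integral of k is unchanged by a rescaling that depends on x; s is the identity on one side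
   of the claim and the inverse on the other. *)
have fubini (k al s : R -> R) : measurable_fun setT k -> (forall t, (0 <= k t)%R) ->
    measurable_fun setT al -> (forall t, (0 <= al t)%R) ->
    measurable_fun setT s -> (forall t, (0 < t)%R -> (0 < s t)%R) ->
    (forall t, (0 <= t)%R -> (0 <= s t)%R) ->
    (\int[lebesgue_power d]_x (H (row_of x) * (al (N x))%:E)) * \int[leb]_t (k t)%:E =
    \int[leb]_t \int[lebesgue_power d]_x (H (row_of x) * (s (N x) * k (s (N x) * t) * al (N x))%:E).
  move=> mk k0 mal al0 ms s0 s0'.
  have mk' d1 (T : measurableType d1) (f : T -> R) : measurable_fun setT f ->
    measurable_fun setT (fun t => k (f t)) by exact: (measurableT_comp mk).
  have mal' d1 (T : measurableType d1) (f : T -> R) : measurable_fun setT f ->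
    measurable_fun setT (fun t => al (f t)) by exact: (measurableT_comp mal).
  have ms' d1 (T : measurableType d1) (f : T -> R) : measurable_fun setT f ->
    measurable_fun setT (fun t => s (f t)) by exact: (measurableT_comp ms).
  have mint : measurable_fun setT (fun z : coordinates R d * R =>
      H (row_of z.1) * (s (N z.1) * k (s (N z.1) * z.2) * al (N z.1))%:E).
    apply: emeasurable_funM; first by apply: mH'; mfunx.
    mfunx; [apply: ms'|apply: mk'; mfunx; apply: ms'|apply: mal']; apply: mN; mfun.
  have int0 x t : 0 <= H (row_of x) * (s (N x) * k (s (N x) * t) * al (N x))%:E.
    by rewrite mule_ge0// lee_fin !mulr_ge0// s0'.
  rewrite -tonelli// -ge0_integralZr//; last 3 first.
  - apply: emeasurable_funM; first by apply: mH'; mfunx.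
    by mfun; apply: mal'; apply: mN; mfun.
  - by move=> x _; rewrite mule_ge0// lee_fin.
  - by apply: integral_ge0 => t _; rewrite lee_fin.
  apply: (@integral_null_ext _ _ _ _ (fun x => row_of x == 0%R)) => //.
  - apply: emeasurable_funM; last exact: measurable_cst.
    apply: emeasurable_funM; first by apply: mH'; mfunx.
    by mfun; apply: mal'; apply: mN; mfun.
  - exact: measurable_fun_integral.
  - move=> x; rewrite mule_ge0//; first by rewrite mule_ge0// lee_fin.
    by apply: integral_ge0 => t _; rewrite lee_fin.
  - by move=> x; exact: integral_ge0.
  move=> x; rewrite -enorm_eq0 => xn; have Nx : (0 < s (N x))%R.
    by apply: s0; rewrite lt_neqAle eq_sym xn N0.
  rewrite -(scale k _ Nx mk k0) -muleA -ge0_integralZl//; last 3 first.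
  - by mfun; apply: mk'; mfun.
  - by move=> t _; rewrite lee_fin mulr_ge0// ltW.
  - by rewrite lee_fin.
  rewrite -ge0_integralZl//; last 2 first.
  - by apply/measurable_EFinP; mfun; apply: mk'; mfun.
  - by move=> t _; rewrite mule_ge0// lee_fin ?mulr_ge0// ltW.
  by apply: eq_integral => t _; congr (_ * _); rewrite -EFinM; congr (_%:E); rewrite mulrC.
have V0 (t : R) : (0 < t)%R -> (0 < t^-1)%R by rewrite invr_gt0.
have V0' (t : R) : (0 <= t)%R -> (0 <= t^-1)%R by rewrite invr_ge0.
etransitivity; first exact: (fubini kb a id mkb kb0 ma a0 (@measurable_id _ _ _) (fun _ h => h) (fun _ h => h)).
apply/esym; etransitivity; first exact: (fubini ka b (fun r => r^-1)%R mka ka0 mb b0 mV V0 V0').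
apply/esym.
apply: eq_integral => t _; have [t0|t0] := ltP 0%R t; last first.
  rewrite !integral0_eq// => x _.
    rewrite /ka ltNge (_ : ((N x)^-1 * t <= 0)%R) ?mul0r ?mulr0 ?mul0r ?mule0//.
    by rewrite mulr_ge0_le0// invr_ge0.
  rewrite /kb ltNge (_ : (N x * t <= 0)%R) ?mul0r ?mulr0 ?mul0r ?mule0//.
  by rewrite mulr_ge0_le0.
pose F (v : 'rV[R]_d) := H v * (enorm v * kb (enorm v * t) * a (enorm v))%:E.
have mF : mfun_row F.
  rewrite /mfun_row /F; apply: emeasurable_funM; first by apply: mH'; mfunx.
  by mfun; [|apply: mkb'; mfun|apply: ma'; mfun]; exact: mN.
have F0 v : 0 <= F v.
  rewrite mule_ge0// lee_fin; apply: mulr_ge0 => //; apply: mulr_ge0 => //; exact: sqrtr_ge0.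
have tV : (0 < t^-1)%R by rewrite invr_gt0.
have := integral_row_scale tV mF F0; rewrite invrK => E.
have td0 : (t ^+ d != 0)%R by rewrite expf_neq0// gt_eqF.
transitivity ((t^-1 ^+ d)%:E * ((t ^+ d)%:E * \int[lebesgue_power d]_x F (row_of x))).
  by rewrite muleA -EFinM exprVn mulVf// mul1e.
rewrite -E -ge0_integralZl//; last 2 first.
- by move: mF; rewrite /mfun_row => mF; apply: (mfun_row_comp (F := F)); mfunx.
- by rewrite lee_fin exprn_ge0// ltW.
apply: eq_integral => x _; rewrite /F HZ// muleCA -EFinM; congr (_ * _%:E).
rewrite enormZ ?(ltW tV)// -/(N x).
have -> : (t^-1 * N x * t = N x)%R by rewrite mulrAC mulVf ?mul1r// gt_eqF.
have [Nx|Nx] := eqVneq (N x) 0%R.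
  by rewrite Nx invr0 !(mulr0, mul0r).
have Np : (0 < N x)%R by rewrite lt_neqAle eq_sym Nx N0.
rewrite /kb /ka Np pmulr_rgt0 ?invr_gt0// t0 !mul1r.
have -> : ((N x)^-1 * t)^-1%R = (t^-1 * N x)%R by rewrite invfM invrK mulrC.
rewrite exprMn -[d in RHS]prednK// !exprS -[d in LHS]prednK// exprS.
rewrite [d.-1.+1.-1]/=; set A := a _; set B := b _; set e := (t^-1 ^+ _)%R; set f := (N x ^+ _)%R.
move: Nx; set n := N x => Nx; set u : R := (t^-1)%R.
rewrite [RHS](_ : _ = (n^-1 * n) * (u * (u * e) * (n * f) * A * B))%R; last by ring.
by rewrite mulVf//; ring.
Qed.

(** The factor produced by [radial_exchange] has to be finite and positive in order to be cancelled;
    bounds over ]0, 1[ and ]1/2, 1[ show this. *)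
Lemma radial_mass_bounds d (C : R) : (0 < C)%R ->
  exists2 r : R, (0 < r)%R &
    \int[leb]_t ((0 < t)%R%:R * t ^+ d * (C * pospow 0 (1 - t ^+ 2)))%:E = r%:E.
Proof.
move=> C0; pose F (t : R) := ((0 < t)%R%:R * t ^+ d * (C * pospow 0 (1 - t ^+ 2)))%R.
have mF : measurable_fun setT (fun t => (F t)%:E) by rewrite /F; mfun; apply: measurable_pospow; mfun.
have F0 t : (0 <= F t)%R.
  rewrite /F; case: (ltP 0%R t) => t0; last by rewrite !mul0r.
  by rewrite mul1r mulr_ge0 ?exprn_ge0// ?(ltW t0)// mulr_ge0 ?pospow_ge0// ltW.
have hi : \int[leb]_t (F t)%:E <= C%:E.
  apply: (@le_trans _ _ (\int[leb]_(t in `]0%R, 1%R[) (cst C%:E t))); last first.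
    by rewrite integral_cst//= lebesgue_measure_itv/= lte_fin ltr01 -EFinB subr0 mule1.
  rewrite [leRHS]integral_mkcond; apply: ge0_le_integral => //.
  - by move=> t _; rewrite lee_fin.
  - apply/measurable_restrict => //; exact: measurable_itv.
  move=> t _; rewrite patchE; case: ifPn => [|].
    rewrite inE/= in_itv/= => /andP[t0 t1]; rewrite lee_fin /F t0 mul1r.
    rewrite mulrCA ler_piMr ?(ltW C0)// mulr_ile1 ?exprn_ge0 ?(ltW t0) ?pospow_ge0//.
      by rewrite exprn_ile1// ltW.
    by rewrite /pospow powRr0 mul1r lern1 leq_b1.
  rewrite notin_setE/= in_itv/= => /negP; rewrite negb_and -!leNgt /F => /orP[t0|t1].
    by rewrite ltNge t0 !mul0r.
  by rewrite pospow_le0 ?mulr0 ?mulr0// subr_le0 exprn_ege1.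
have lo : (C * 2^-1 ^+ d / 2)%:E <= \int[leb]_t (F t)%:E.
  apply: (@le_trans _ _ (\int[leb]_(t in `]2^-1%R, 1%R[) (cst (C * 2^-1 ^+ d)%:E t))).
    rewrite integral_cst//= lebesgue_measure_itv/= lte_fin invf_lt1// ltr1n/= -EFinB -EFinM lee_fin.
    by rewrite ler_pM2l ?mulr_gt0 ?exprn_gt0//; lra.
  rewrite integral_mkcond; apply: ge0_le_integral => //.
  - by move=> t _; rewrite patchE; case: ifP => // _; rewrite lee_fin mulr_ge0 ?exprn_ge0// ltW.
  - apply/measurable_restrict => //; exact: measurable_itv.
  move=> t _; rewrite patchE; case: ifPn => [|]; last by rewrite lee_fin.
  rewrite inE/= in_itv/= => /andP[t0 t1]; rewrite lee_fin /F.
  have tp : (0 < t)%R by apply: lt_trans t0.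
  rewrite tp mul1r /pospow powRr0 mul1r subr_gt0 exprn_ilt1 ?(ltW tp)// mulr1 mulrC.
  by rewrite ler_pM2r// lerXn2r// ?nnegrE ?invr_ge0// ltW.
have fin : \int[leb]_t (F t)%:E \is a fin_num.
  rewrite ge0_fin_numE; first by rewrite (le_lt_trans hi)// ltry.
  by apply: integral_ge0 => t _; rewrite lee_fin.
exists (fine (\int[leb]_t (F t)%:E)); last by rewrite fineK.
rewrite -lte_fin fineK// (lt_le_trans _ lo)// lte_fin.
by rewrite divr_gt0// mulr_gt0// exprn_gt0.
Qed.

(** All beta densities are radial, so by [radial_exchange] the laws of the direction for two
    exponents are proportional; exponent 0 defines the sphere law. *)
Lemma integral_beta_law_direction d (beta : R) (f : coordinates R d -> \bar R) :
  (0 < d)%N -> (-1 < beta)%R -> measurable_fun setT f -> (forall x, 0 <= f x) ->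
  \int[beta_law d beta]_x f (direction x) = \int[sphere_law d]_x f x.
Proof.
move=> d0 beta1 mf f0; rewrite [RHS](integral_sphere_law mf f0).
have b01 : (-1 < 0 :> R)%R by rewrite ltrN10.
pose w (b : R) (t : R) := (beta_const d b * pospow b (1 - t ^+ 2))%R.
have mw b : measurable_fun setT (w b) by rewrite /w; mfun; apply: measurable_pospow; mfun.
have w0 b t : (-1 < b)%R -> (0 <= w b t)%R.
  by move=> b1; rewrite mulr_ge0 ?pospow_ge0// ltW// beta_const_gt0.
have WE b (h : coordinates R d -> \bar R) : (-1 < b)%R -> measurable_fun setT h -> (forall x, 0 <= h x) ->
   \int[beta_law d b]_x h x = \int[lebesgue_power d]_x (h x * (w b (enorm (row_of x)))%:E).
  move=> b1 mh h0; rewrite integral_beta_law//; apply: eq_integral => x _.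
  by rewrite beta_densityE /w enorm_sqr.
pose H (v : 'rV[R]_d) := f (of_row ((enorm v)^-1 *: v)).
have HE x : f (direction x) = H (row_of x).
  by congr f; apply/eq_from_tnth => i; rewrite !tnth_mktuple !mxE.
have HZ r v : (0 < r)%R -> H (r *: v)%R = H v.
  move=> r0; rewrite /H enormZ ?(ltW r0)// scalerA invfM mulrAC mulVf ?mul1r//.
  by rewrite gt_eqF.
have mH : mfun_row H.
  rewrite /mfun_row /H; apply: (measurableT_comp mf).
  apply: measurable_of_row => i j; under eq_fun do rewrite mxE.
  have mr : measurable_mx (fun x : coordinates R d => row_of x) by mfunx.
  by apply: measurable_funM; [apply: measurable_invr; exact: measurable_enorm_comp|exact: mr].
have mHr : measurable_fun setT (fun x : coordinates R d => H (row_of x)).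
  by move: mH; rewrite /mfun_row => mH; apply: (mfun_row_comp (F := H)); mfunx.
have H0 v : 0 <= H v by exact: f0.
under eq_integral do rewrite HE; under [RHS]eq_integral do rewrite HE.
have [r r0 rE] := radial_mass_bounds d.-1 (beta_const_gt0 d b01).
have X (h : 'rV[R]_d -> \bar R) : mfun_row h -> (forall v, 0 <= h v) ->
    (forall r v, (0 < r)%R -> h (r *: v)%R = h v) ->
    \int[beta_law d beta]_x h (row_of x) * r%:E = \int[beta_law d 0]_x h (row_of x) *
    \int[leb]_t ((0 < t)%R%:R * t^-1 ^+ d.+1 * w beta t^-1)%:E.
  move=> mh h0 hZ; have mhr : measurable_fun setT (fun x : coordinates R d => h (row_of x)).
    by move: (mh); rewrite /mfun_row => mh'; apply: (mfun_row_comp (F := h)); mfunx.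
  rewrite (WE beta)// (WE 0%R)// -rE.
  exact: (@radial_exchange d h (w beta) (w 0%R) d0 mh h0 hZ (mw _) (mw _) (fun t => w0 _ t beta1) (fun t => w0 _ t b01)).
(* The function 1, of total mass 1 under both laws, identifies the factor. *)
have rk : r%:E = \int[leb]_t ((0 < t)%R%:R * t^-1 ^+ d.+1 * w beta t^-1)%:E.
  have m1 : @mfun_row R d _ (\bar R) (fun=> 1) by rewrite /mfun_row; mfun.
  have := X (fun=> 1) m1 (fun=> lee01) (fun _ _ _ => erefl).
  have T1 b : (-1 < b)%R -> \int[beta_law d b]_x (1 : \bar R) = 1.
    by move=> b1; rewrite integral_cst// mul1e; exact: beta_lawT.
  by rewrite !T1// !mul1e.
have cancel (x y : \bar R) : x * r%:E = y * r%:E -> x = y.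
  move=> /(congr1 (fun z => z * (r^-1)%:E)).
  by rewrite -!muleA -EFinM mulfV ?gt_eqF// !mule1.
by apply: cancel; have := X H mH H0 HZ; rewrite -rk.
Qed.

End direction_law.

(** * General position of points on the sphere *)

Section sphere_null_sets.
Context {R : realType}.
Local Open Scope ereal_scope.
Notation leb := (@lebesgue_measure R).

Lemma integral_sqr_eq (s : R) : \int[leb]_t ((t ^+ 2 == s)%R%:R)%:E = 0.
Proof.
have pt (a : R) : \int[leb]_t ((t == a)%R%:R)%:E = 0.
  transitivity (\int[leb]_t (\1_[set a] t)%:E).
    apply: eq_integral => t _; rewrite indicE; congr ((nat_of_bool _)%:R%:E).
    by apply/eqP/idP => [->|]; rewrite inE.
  by rewrite integral_indic//= setIT lebesgue_measure_set1.
apply/eqP; rewrite eq_le integral_ge0 ?andbT; last by move=> t _; rewrite lee_fin.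
apply: (@le_trans _ _ (\int[leb]_t (((t == Num.sqrt s)%R%:R)%:E + ((t == - Num.sqrt s)%R%:R)%:E))).
  apply: ge0_le_integral => //.
  - by mfun.
  - by apply: emeasurable_funD; mfun.
  move=> t _; rewrite -EFinD lee_fin; case: eqP => [ts|_]; last by rewrite addr_ge0.
  have : (`|t| == Num.sqrt s)%R by rewrite -ts sqrtr_sqr.
  by rewrite eqr_norml => /andP[/orP[] -> _]; rewrite ?lerDl ?lerDr.
rewrite ge0_integralD//; first by rewrite !pt adde0.
- by mfun.
- by mfun.
Qed.

(** As d > 1 there is a unit vector th orthogonal to [w]; along each line in this direction the
    equation prescribes the square of the parameter and has at most two solutions. *)
Lemma lebesgue_power_cone d (w : 'rV[R]_d) (c : R) : (1 < d)%N -> c != 0%R ->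
  \int[lebesgue_power d]_x ((dot (row_of x) w ^+ 2 == c ^+ 2 * dot (row_of x) (row_of x))%R%:R)%:E = 0.
Proof.
move=> d1 c0; have [v v0 wv] := @exists_orthogonal R 1 d w d1.
pose th := ((Num.sqrt (dot v v))^-1 *: v)%R.
have th1 : dot th th = 1%R by exact: dot_normalize.
have thw : dot th w = 0%R by rewrite dotC dotE /th linearZ/= -scalemxAr wv scaler0 mxE.
clearbody th.
pose F (x : 'rV[R]_d) : \bar R := ((dot x w ^+ 2 == c ^+ 2 * dot x x)%R%:R)%:E.
have mF : mfun_row F by rewrite /mfun_row /F; mside.
have F0 x : 0 <= F x by rewrite lee_fin.
have := @integral_slice R d th (@gauss_fun R) F th1 (@measurable_gauss_fun R) (@gauss_fun_ge0 R) mF F0.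
rewrite integralT_gauss => H.
have {H} : (Num.sqrt pi)%:E * \int[lebesgue_power d]_x F (row_of x) = 0.
  rewrite H tonelli; last 2 first.
  - apply: emeasurable_funM.
      by apply/measurable_EFinP; apply: (measurableT_comp (@measurable_gauss_fun R)); mfunx.
    by move: mF; rewrite /mfun_row => mF; apply: (mfun_row_comp (F := F)); mfunx.
  - by move=> *; rewrite mule_ge0// lee_fin gauss_fun_ge0.
  rewrite integral0_eq// => x _.
  set y := (row_of x - dot (row_of x) th *: th)%R.
  have yth : dot y th = 0%R by rewrite dotBl dotZl th1 mulr1 subrr.
  clearbody y.
  have FE t : F (y + t *: th)%R = ((t ^+ 2 == dot y w ^+ 2 / c ^+ 2 - dot y y)%R%:R)%:E.
    have c2 : (c ^+ 2 != 0)%R by rewrite expf_neq0.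
    have E1 : dot (y + t *: th) w = dot y w by rewrite dotDl dotZl thw mulr0 addr0.
    have E2 : dot (y + t *: th) (y + t *: th) = (dot y y + t ^+ 2)%R.
      by rewrite dotDl !dotDr !dotZl !dotZr [dot th _]dotC yth th1; ring.
    rewrite /F E1 E2; congr ((nat_of_bool _)%:R%:E); apply/eqP/eqP => h.
      by rewrite h [(c ^+ 2 * _)%R]mulrC mulfK// addrC addKr.
    by rewrite h; field.
  under eq_integral do rewrite FE.
  rewrite ge0_integralZl//.
  - by rewrite integral_sqr_eq mule0.
  - by mfun.
  - by rewrite lee_fin gauss_fun_ge0.
move=> /eqP; rewrite mule_eq0 eqe gt_eqF ?sqrtr_gt0 ?pi_gt0//= => /eqP.
by [].
Qed.

Lemma row_of_direction d (x : coordinates R d) :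
  row_of (direction x) = ((enorm (row_of x))^-1 *: row_of x)%R.
Proof. by apply/rowP => i; rewrite !mxE tnth_mktuple. Qed.

(** A point whose direction lies in the hyperplane satisfies <x,w>^2 = c^2 |x|^2, a null cone for c
    != 0; for c = 0 it lies in a hyperplane through the origin. In dimension 1 the sphere has
    atoms. *)
Lemma sphere_law_no_hyperplane d : (1 < d)%N -> charges_no_hyperplane (@sphere_law R d).
Proof.
move=> d1 w c w0.
have mI : measurable_fun setT (fun u : coordinates R d => ((dot (row_of u) w == c)%R%:R)%:E : \bar R) by mfunx.
rewrite integral_sphere_law//.
have mD : measurable_fun setT (fun u : coordinates R d =>
    ((dot (row_of (direction u)) w == c)%R%:R)%:E : \bar R).
  exact: (measurableT_comp mI (@measurable_direction R d)).
rewrite integral_beta_law ?ltrN10//.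
have mdens : measurable_fun setT (fun x : coordinates R d =>
    ((dot (row_of (direction x)) w == c)%R%:R)%:E * (beta_density 0 x)%:E).
  by apply: emeasurable_funM => //; apply/measurable_EFinP; exact: measurable_beta_density.
have dens0 (x : coordinates R d) : 0 <= ((dot (row_of (direction x)) w == c)%R%:R)%:E * (beta_density 0 x)%:E.
  by rewrite mule_ge0// lee_fin beta_density_ge0.
have [c0|c0] := eqVneq c 0%R.
  apply: (@integral_null_le _ _ _ _ (fun x => dot (row_of x) w == 0%R)) => //.
  - by mfunx.
  - exact: lebesgue_power_no_hyperplane.
  move=> x xw; rewrite row_of_direction dotZl c0 mulf_eq0 (negbTE xw) orbF invr_eq0 enorm_eq0.
  by case: eqP => [x0|]; [move: xw; rewrite x0 dot0l eqxx|rewrite mul0e].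
apply: (@integral_null_le _ _ _ _ (fun x => dot (row_of x) w ^+ 2 == c ^+ 2 * dot (row_of x) (row_of x))%R) => //.
- by mfunx.
- exact: lebesgue_power_cone.
move=> x xq; rewrite row_of_direction dotZl; case: eqP => [xc|]; last by rewrite mul0e.
case/eqP: xq; rewrite -xc exprMn -enorm_sqr.
have [e0|e0] := eqVneq (enorm (row_of x)) 0%R.
  by move: c0; rewrite -xc e0 invr0 mul0r eqxx.
by rewrite mulrAC -exprMn mulVf// expr1n mul1r.
Qed.

Lemma integral_power_pushforward d1 d2 (T1 : measurableType d1) (T2 : measurableType d2)
    (l1 : {sigma_finite_measure set T1 -> \bar R}) (l2 : {sigma_finite_measure set T2 -> \bar R})
    (h : T1 -> T2) n (f : n.-tuple T2 -> \bar R) : measurable_fun setT h ->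
  (forall g, measurable_fun setT g -> (forall x, 0 <= g x) -> \int[l1]_x g (h x) = \int[l2]_x g x) ->
  measurable_fun setT f -> (forall t, 0 <= f t) ->
  \int[power_measure l1 n]_t f [tuple h (tnth t i) | i < n] = \int[power_measure l2 n]_t f t.
Proof.
move=> mh hE.
have mH k : measurable_fun setT (fun t : k.-tuple T1 => [tuple h (tnth t i) | i < k]).
  apply/measurable_fun_tnthP => i; rewrite /comp.
  by under eq_fun do rewrite tnth_mktuple; apply: (measurableT_comp mh); exact: measurable_tnth.
elim: n f => [|n IH] f mf f0.
  rewrite !integral_power0//; last by apply: (measurableT_comp mf); exact: mH.
  by congr f; apply/val_inj; case: (mktuple _) => -[].
rewrite integral_power_cons//; last by apply: (measurableT_comp mf); exact: mH.
rewrite [in RHS]integral_power_cons//.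
have mI : measurable_fun setT (fun x => \int[power_measure l2 n]_t f [tuple of x :: t]).
  apply: measurable_fun_integral => //.
  by apply: (measurableT_comp mf); exact: measurable_fun_cons_tuple.
rewrite -(hE _ mI); last by move=> x; exact: integral_ge0.
apply: eq_integral => x _.
have mfc : measurable_fun setT (fun t : n.-tuple T2 => f [tuple of h x :: t]).
  by apply: (measurableT_comp mf); apply: measurable_cons.
rewrite -(IH _ mfc)//; apply: eq_integral => t _; congr f; apply/eq_from_tnth => i.
by rewrite tnth_mktuple; case: (unliftP ord0 i) => [j ->|->]; rewrite ?tnthS ?tnth0 ?tnth_mktuple.
Qed.

(** The coefficients [lam] times the square of the Gram determinant: the same signs, but polynomial
    in the points. *)
Definition coef_num d p (g : 'rV[R]_d) (D : 'M[R]_(p, d)) : 'rV[R]_p :=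
  gram D *: (g *m D^T *m \adj (D *m D^T)).

Lemma measurable_coef_num d0 (T : measurableType d0) d p (g : 'rV[R]_d) (D : T -> 'M[R]_(p, d)) :
  measurable_mx D -> measurable_mx (fun t => coef_num g (D t)).
Proof.
move=> mD; rewrite /coef_num /gram; mfunx; first by apply: measurable_det; mfunx.
by apply: measurable_adj; mfunx.
Qed.

Lemma lam_ge0 d p (g : 'rV[R]_d) (D : 'M[R]_(p, d)) i :
  (0 <= lam g D 0 i)%R = (0 <= coef_num g D 0 i)%R.
Proof.
rewrite /lam /coef_num !mxE; set z := (\sum_j _)%R.
have [->|g0] := eqVneq (gram D) 0%R; first by rewrite invr0 !mul0r.
have g2 : (0 < gram D ^+ 2)%R by rewrite lt_neqAle eq_sym expf_neq0// sqr_ge0.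
have -> : (gram D * z = gram D ^+ 2 * ((gram D)^-1 * z))%R by rewrite expr2 -mulrA mulVKf.
by rewrite [RHS]pmulr_rge0.
Qed.

Lemma pos_coefsE d p (g : 'rV[R]_d) k (D : 'M[R]_(p, d)) :
  pos_coefs g k D = (\prod_(i < p | (k <= i.+1)%N) (0 <= coef_num g D 0 i)%R%:R)%R.
Proof. by apply: eq_bigr => i _; rewrite lam_ge0. Qed.

(** If coefficient i vanishes, [g] is in the span of the other q differences. This contradicts the
    general position of [g] and of the q + 1 points that remain when point i + 1 is dropped. *)
Lemma power_measure_coef_num q (mu : {sigma_finite_measure set (coordinates R q.+1) -> \bar R})
    (g : 'rV[R]_q.+1) (i : 'I_q.+1) : charges_no_hyperplane mu -> mu setT = 1 -> g != 0%R ->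
  \int[power_measure mu q.+2]_t ((coef_num g (diffs t) 0 i == 0)%R%:R)%:E = 0.
Proof.
move=> nomu muT g0.
pose f (j : 'I_q.+1) : 'I_q.+2 := lift (lift ord0 i) j.
have fE (t : q.+2.-tuple (coordinates R q.+1)) : diffs (reindex_tuple f t) = row' i (diffs t).
  apply/row_matrixP => j; rewrite row_diffs.
  have -> : row j (row' i (diffs t)) = row (lift i j) (diffs t) by apply/rowP => l; rewrite !mxE.
  rewrite row_diffs /thead !tnth_mktuple.
  have -> : f (lift ord0 j) = lift ord0 (lift i j) by apply: val_inj; rewrite /= /bump; lia.
  by have -> : f ord0 = ord0 by apply: val_inj.
have mdf : measurable_mx (fun t : q.+2.-tuple (coordinates R q.+1) => diffs t).
  by apply: measurable_diffs; mfun.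
have N1 := power_measure_diffs nomu (leqnn q.+1).
have mcol : measurable_fun setT (fun t : q.+1.-tuple (coordinates R q.+1) => ~~ row_free (col_mx g (diffs t))).
  apply: measurable_neg; apply: measurable_row_free => a b; case: (split_ordP a) => l ->.
    by under eq_fun do rewrite col_mxEu; mfun.
  by under eq_fun do rewrite col_mxEd; apply: measurable_diffs; mfun.
have N2 : \int[power_measure mu q.+2]_t ((~~ row_free (col_mx g (diffs (reindex_tuple f t))))%:R)%:E = 0.
  rewrite (@integral_power_reindex _ _ _ mu _ _ f (fun t => ((~~ row_free (col_mx g (diffs t)))%:R)%:E))//.
  - exact: power_measure_col_mx_diffs.
  - by move=> a b /lift_inj.
  - by mfun.
have mcn := measurable_coef_num g mdf.
have mN1 : measurable_fun setT (fun t : q.+2.-tuple (coordinates R q.+1) => ~~ row_free (diffs t)).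
  by apply: measurable_neg; exact: measurable_row_free.
have mN2 : measurable_fun setT (fun t : q.+2.-tuple (coordinates R q.+1) => ~~ row_free (col_mx g (diffs (reindex_tuple f t)))).
  exact: (measurableT_comp mcol (measurable_reindex_tuple f)).
pose G t : \bar R := ((~~ row_free (col_mx g (diffs (reindex_tuple f t))) && (coef_num g (diffs t) 0 i == 0)%R)%:R)%:E.
have mG : measurable_fun setT G.
  apply/measurable_EFinP/measurable_fun_nat_of_bool/measurable_and => //.
  by mfun; exact: mcn.
transitivity (\int[power_measure mu q.+2]_t G t).
  apply: (integral_null_ext mN1 N1) => //; first by mfun; exact: mcn.
    by move=> t; rewrite lee_fin.
  move=> t; rewrite negbK => fD.
  rewrite /G; congr ((nat_of_bool _)%:R%:E).
  case: eqP => [cn|_]; rewrite ?andbT ?andbF//; apply/esym/negP => fcol.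
  have gr : gram (diffs t) != 0%R by rewrite gram_neq0.
  have lam0 : (lam g (diffs t) 0 i = 0)%R.
    move: cn; rewrite /coef_num /lam !mxE => /eqP; rewrite mulf_eq0 (negbTE gr)/= => /eqP ->.
    by rewrite mulr0.
  have gE : g = (lam g (diffs t) *m diffs t)%R.
    by rewrite lam_square// mulmxKV// -row_free_unit.
  pose l := col' i (lam g (diffs t)).
  have lE : (lam g (diffs t) *m diffs t = l *m row' i (diffs t))%R.
    rewrite !mulmx_sum_row (bigD1_ord i)//= lam0 scale0r add0r; apply: eq_bigr => j _.
    have -> : (l 0 j = lam g (diffs t) 0 (lift i j))%R by rewrite mxE.
    by congr (_ *: _)%R; apply/rowP => a; rewrite !mxE.
  move: fcol; rewrite fE => fcol.
  have : (row_mx (1%:M : 'M[R]_1) (- l) *m col_mx g (row' i (diffs t)) = 0)%R.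
    by rewrite mul_row_col mul1mx mulNmx -lE -gE subrr.
  rewrite -(mul0mx _ (col_mx g (row' i (diffs t)))) => /(row_free_inj fcol)/(congr1 lsubmx).
  rewrite row_mxKl => /(congr1 (fun M : 'M[R]_1 => M 0 0)%R); rewrite !mxE/= => /eqP.
  by rewrite oner_eq0.
apply: (integral_null_le mN2 N2) => // t; first by rewrite lee_fin.
by rewrite /G => /negbTE ->.
Qed.

End sphere_null_sets.

(** * Concentration near the sphere as beta -> -1 *)

Section concentration.
Context {R : realType}.
Local Open Scope ereal_scope.
Notation leb := (@lebesgue_measure R).

Lemma powR_le1_anti (a x y : R) : (0 < a)%R -> (a <= 1)%R -> (x <= y)%R -> (a `^ y <= a `^ x)%R.
Proof.
move=> a0 a1 xy; rewrite /powR gt_eqF// ler_expR -subr_ge0 -mulrBl.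
by apply: mulr_le0; [rewrite subr_le0|exact: ln_le0].
Qed.

Lemma powR_ge1_mono (a x y : R) : (1 <= a)%R -> (x <= y)%R -> (a `^ x <= a `^ y)%R.
Proof.
move=> a1 xy; have a0 : (0 < a)%R by exact: lt_le_trans a1.
by rewrite /powR gt_eqF// ler_expR ler_wpM2r// ln_ge0.
Qed.

Lemma Gamma_inv_ge (N : nat) : ((N.+1)%:R / 2 * expR (-1) <= Gamma (N.+1%:R^-1 : R))%R.
Proof.
set s : R := (N.+1%:R^-1)%R; have s0 : (0 < s)%R by rewrite invr_gt0.
(* Chosen so that e^s = 1/2: the integral of t^(s-1) over [e, 1] is then 1/(2 s) = (N + 1)/2, and
   e^(-t) >= e^(-1) there. *)
pose e : R := (2^-1 ^+ N.+1)%R; have e0 : (0 < e)%R by rewrite exprn_gt0.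
have e1 : (e < 1)%R by rewrite exprn_ilt1// invf_lt1// ltr1n.
have es : (e `^ s = 2^-1)%R.
  by rewrite /e -powR_mulrn// -powRrM mulfV// powRr1.
rewrite -lee_fin -GammaE//.
apply: (@le_trans _ _ (\int[leb]_(t in `[e, 1%R]) ((expR (-1))%:E * (t `^ (s - 1))%:E))).
  rewrite ge0_integralZl//; last 2 first.
  - apply/measurable_EFinP; apply: measurable_funTS; exact: measurable_powR.
  - by move=> t _; rewrite lee_fin powR_ge0.
  rewrite integral_powR// es -EFinM lee_fin mulrC ler_pM2l ?expR_gt0//.
  by rewrite /s invrK mulrC ler_pM2r//; lra.
rewrite integral_mkcond; apply: ge0_le_integral => //.
- by move=> t _; rewrite patchE; case: ifP => // _; rewrite -EFinM lee_fin mulr_ge0 ?expR_ge0 ?powR_ge0.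
- apply/measurable_restrict => //; apply: emeasurable_funM => //.
  apply/measurable_EFinP; apply: measurable_funTS; exact: measurable_powR.
- by mfun; apply: measurable_pospow; mfun.
move=> t _; rewrite patchE; case: ifPn => [|_]; last by rewrite lee_fin mulr_ge0 ?pospow_ge0 ?expR_ge0.
rewrite inE/= in_itv/= => /andP[t1 t2]; have t0 := lt_le_trans e0 t1.
by rewrite -EFinM lee_fin pospow_gt0E// mulrC ler_wpM2l ?powR_ge0// ler_expR lerN2.
Qed.

(** A bound uniform in s: t^(a+s-1) is at most 1 for t <= 1 and at most t^a for t > 1. *)
Lemma Gamma_le (a s : R) : (1 <= a)%R -> (0 < s)%R -> (s <= 1)%R ->
  (Gamma (a + s) <= Gamma 1 + Gamma (a + 1))%R.
Proof.
move=> a1 s0 s1; have as0 : (0 < a + s)%R by lra.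
have m (b : R) : measurable_fun setT (fun t : R => (pospow b t * expR (- t))%:E).
  by mfun; apply: measurable_pospow; mfun.
have a0 : (0 < a + 1)%R by lra.
rewrite -lee_fin EFinD -(GammaE as0) -(GammaE ltr01) -(GammaE a0).
rewrite -ge0_integralD//; last 4 first.
- by move=> t _; rewrite lee_fin mulr_ge0 ?pospow_ge0 ?expR_ge0.
- exact: m.
- by move=> t _; rewrite lee_fin mulr_ge0 ?pospow_ge0 ?expR_ge0.
- exact: m.
apply: ge0_le_integral => //.
- by move=> t _; rewrite lee_fin mulr_ge0 ?pospow_ge0 ?expR_ge0.
- exact: m.
- by apply: emeasurable_funD; exact: m.
move=> t _; rewrite -EFinD lee_fin -mulrDl ler_wpM2r ?expR_ge0//.
have [t0|t0] := leP t 0%R; first by rewrite !pospow_le0// addr0.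
rewrite !pospow_gt0E// subrr powRr0 addrK; have [t1|t1] := leP t 1%R.
  rewrite (@le_trans _ _ 1%R)// ?lerDl ?powR_ge0//.
  by rewrite -[leRHS](powRr0 t) powR_le1_anti//; lra.
by rewrite (@le_trans _ _ (t `^ a)%R)// ?lerDr// powR_ge1_mono ?(ltW t1)//; lra.
Qed.

Definition beta_seq (N : nat) : R := (-1 + N.+1%:R^-1)%R.

Lemma beta_seq_gtN1 N : (-1 < beta_seq N)%R.
Proof. by rewrite /beta_seq ltrDl invr_gt0. Qed.

(** The pole of Gamma at 0 in the denominator makes the constant tend to 0 like 1/N. The condition
    on d gives d/2 >= 1, as [Gamma_le] requires. *)
Lemma beta_const_seq d : (1 < d)%N ->
  exists2 K : R, (0 <= K)%R & forall N, (beta_const d (beta_seq N) <= K / N.+1%:R)%R.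
Proof.
move=> d1; have d2 : (1 <= d%:R / 2 :> R)%R.
  by rewrite ler_pdivlMr// mul1r (ler_nat R 2 d).
pose M := (Gamma 1 + Gamma (d%:R / 2 + 1) : R)%R.
pose P : R := (pi `^ (d%:R / 2) * expR (-1))%R.
have P0 : (0 < P)%R by rewrite mulr_gt0 ?powR_gt0 ?pi_gt0 ?expR_gt0.
have M0 : (0 <= M)%R by rewrite addr_ge0 ?Gamma_ge0.
exists (2 * M / P)%R; first by rewrite (divr_ge0 (mulr_ge0 _ M0) (ltW P0)).
move=> N.
set s : R := (N.+1%:R^-1)%R; have s0 : (0 < s)%R by rewrite invr_gt0.
have s1 : (s <= 1)%R by rewrite invf_le1// ler1n.
rewrite /beta_const; have -> : (d%:R / 2 + beta_seq N + 1 = d%:R / 2 + s)%R.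
  by rewrite /beta_seq -/s; ring.
have -> : (beta_seq N + 1 = s)%R by rewrite /beta_seq -/s; ring.
have G0 : (0 < Gamma s)%R by exact: Gamma_gt0.
have pi0 : (0 < pi `^ (d%:R / 2) :> R)%R by rewrite powR_gt0 ?pi_gt0.
rewrite ler_pdivrMr ?mulr_gt0//; apply: (le_trans (Gamma_le d2 s0 s1)); rewrite -/M.
have N0 : (0 < N.+1%:R :> R)%R by [].
have := Gamma_inv_ge N; rewrite -/s => Gs.
have ME : M = (2 * M / P / N.+1%:R * (pi `^ (d%:R / 2) * (N.+1%:R / 2 * expR (-1))))%R.
  rewrite /P; field; rewrite !gt_eqF ?expR_gt0//.
rewrite [leLHS]ME ler_wpM2l ?ler_pM2l//.
by rewrite mulr_ge0 ?invr_ge0// (divr_ge0 (mulr_ge0 _ M0) (ltW P0)).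
Qed.

(** With the value 1 off the open ball, a total defect below 1 forces all points into the ball; the
    beta laws with beta > -1 do not charge the complement. *)
Definition defect d (v : 'rV[R]_d) : R := if (dot v v < 1)%R then (1 - dot v v)%R else 1%R.

Lemma defect_ge0 d (v : 'rV[R]_d) : (0 <= defect v)%R.
Proof. by rewrite /defect; case: ifP => // v1; rewrite subr_ge0 ltW. Qed.

Lemma measurable_defect d0 (T : measurableType d0) d (f : T -> 'rV[R]_d) :
  measurable_mx f -> measurable_fun setT (fun t => defect (f t)).
Proof.
move=> mf; have -> : (fun t => defect (f t)) = (fun t => pospow 1 (1 - dot (f t) (f t)) +
    (1 <= dot (f t) (f t))%R%:R)%R.
  apply/funext => t; rewrite /defect; case: ltP => h.
    by rewrite pospow_gt0E ?subr_gt0// powRr1 ?addr0// subr_ge0 ltW.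
  by rewrite pospow_le0 ?add0r// subr_le0.
by mfunx; apply: measurable_pospow; mfunx.
Qed.

(** The factor 1 - |x|^2 raises the exponent of the density to beta + 1 > 0, so the integrand is at
    most c_(d,beta) on a ball of volume 1/c_(d,0). *)
Lemma integral_defect d (beta : R) : (-1 < beta)%R ->
  \int[beta_law d beta]_x (defect (row_of x))%:E <= (beta_const d beta / beta_const d 0)%:E.
Proof.
move=> beta1; have md : measurable_fun setT (fun x : coordinates R d => (defect (row_of x))%:E).
  by apply/measurable_EFinP; apply: measurable_defect; mfunx.
have mp (b : R) : measurable_fun setT (fun x : coordinates R d => (pospow b (1 - dot (row_of x) (row_of x)))%:E).
  by mfunx; apply: measurable_pospow; mfunx.
have c0 := beta_const_gt0 d beta1.
have b01 : (-1 < 0 :> R)%R by rewrite ltrN10.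
rewrite integral_beta_law//; last by move=> x; rewrite lee_fin defect_ge0.
rewrite EFinM -(integral_pospow_ball d b01) -ge0_integralZl//; last 2 first.
- by move=> x _; rewrite lee_fin pospow_ge0.
- by rewrite lee_fin ltW.
apply: ge0_le_integral => //.
- by move=> x _; rewrite mule_ge0// lee_fin ?defect_ge0 ?beta_density_ge0.
- by apply: emeasurable_funM => //; apply/measurable_EFinP; exact: measurable_beta_density.
- by apply: emeasurable_funM.
move=> x _; rewrite beta_densityE -!EFinM lee_fin mulrCA ler_wpM2l ?(ltW c0)//.
rewrite /defect; case: ltP => h; last by rewrite pospow_le0 ?mulr0 ?pospow_ge0// subr_le0.
rewrite !pospow_gt0E ?subr_gt0// powRr0; set r := (1 - _)%R.
have r0 : (0 < r)%R by rewrite subr_gt0.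
have r1 : (r <= 1)%R by rewrite gerBl dot_ge0.
rewrite -{1}(@powRr1 _ r) ?(ltW r0)// -powRD; last by rewrite (gt_eqF r0) implybT.
by rewrite -[leRHS](powRr0 r) powR_le1_anti//; lra.
Qed.

End concentration.

(** * Polynomials move little under radial projection *)

Section radial_lipschitz.
Context {R : realType} (n d : nat).
Local Notation points := (n.-tuple (coordinates R d)).
Implicit Types (X : points) (F G : points -> R).

Definition directions X : points := [tuple direction (tnth X i) | i < n].

Definition total_defect X : R := \sum_i defect (row_of (tnth X i)).

Lemma total_defect_ge0 X : 0 <= total_defect X.
Proof. by apply: sumr_ge0 => i _; exact: defect_ge0. Qed.

Definition in_balls X := forall i, enorm (row_of (tnth X i)) <= 1.

Lemma enorm_direction (x : coordinates R d) : enorm (row_of (direction x)) <= 1.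
Proof.
rewrite row_of_direction enormZ ?invr_ge0 ?sqrtr_ge0//.
have [->|x0] := eqVneq (enorm (row_of x)) 0; first by rewrite mulr0.
by rewrite mulVf.
Qed.

Lemma in_balls_directions X : in_balls (directions X).
Proof. by move=> i; rewrite tnth_mktuple enorm_direction. Qed.

(* Bounded on the product of the closed balls, and moved by at most a multiple of the defect
   when the points are pushed radially to the sphere. *)
Definition radially_lipschitz F := exists2 L : R, 0 <= L &
  (forall X, in_balls X -> `|F X| <= L) /\
  (forall X, in_balls X -> `|F X - F (directions X)| <= L * total_defect X).

Lemma radially_lipschitz_cst c : radially_lipschitz (fun=> c).
Proof.
by exists `|c| => //; split=> // X _; rewrite subrr normr0 mulr_ge0// total_defect_ge0.
Qed.

(** With N = |x| in ]0, 1], |x_j - x_j/N| <= 1 - N <= 1 - N^2; at the origin nothing moves, as its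
    direction is 0. *)
Lemma radially_lipschitz_coord i j : radially_lipschitz (fun X => tnth (tnth X i) j).
Proof.
have coord (x : coordinates R d) : `|tnth x j| <= enorm (row_of x).
  have -> : tnth x j = row_of x 0 j by rewrite mxE.
  rewrite -sqrtr_sqr.
  by rewrite ler_wsqrtr// (bigD1 j)//= lerDl sumr_ge0// => l _; exact: sqr_ge0.
exists 1 => //; split=> X XB; first exact: le_trans (coord _) (XB i).
rewrite mul1r (@le_trans _ _ (defect (row_of (tnth X i))))//; last first.
  by rewrite /total_defect (bigD1 i)//= lerDl sumr_ge0// => l _; exact: defect_ge0.
rewrite tnth_mktuple; set x := tnth X i; have := XB i; rewrite -/x => xB.
have := coord x; set N := enorm (row_of x) in xB *; move=> xj.
have N0 : 0 <= N by exact: sqrtr_ge0.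
rewrite tnth_mktuple -/N; have [N00|Nn] := eqVneq N 0.
  have -> : tnth x j = 0 by apply/eqP; rewrite -normr_le0 -N00.
  by rewrite mulr0 subrr normr0 defect_ge0.
have Np : 0 < N by rewrite lt_neqAle eq_sym Nn.
rewrite -{1}[tnth x j]mul1r -mulrBl normrM.
have -> : `|1 - N^-1| = (1 - N) / N.
  by rewrite ler0_norm; [field|rewrite subr_le0 invf_ge1].
rewrite (@le_trans _ _ (1 - N))//.
  by rewrite -mulrA ler_piMr ?subr_ge0// mulrC ler_pdivrMr// mul1r.
have N2 : dot (row_of x) (row_of x) = N ^+ 2 by rewrite enorm_sqr.
rewrite /defect N2; case: ifP => _; last by rewrite gerBl.
by rewrite lerD2l lerN2 expr2 ler_piMr.
Qed.

Lemma radially_lipschitzD F G : radially_lipschitz F -> radially_lipschitz G ->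
  radially_lipschitz (fun X => F X + G X).
Proof.
move=> [L L0 [FL FD]] [M M0 [GM GD]]; exists (L + M); first exact: addr_ge0.
split=> X XB; first by rewrite (le_trans (ler_normD _ _))// lerD ?FL ?GM.
by rewrite mulrDl opprD addrACA (le_trans (ler_normD _ _))// lerD ?FD ?GD.
Qed.

Lemma radially_lipschitzM F G : radially_lipschitz F -> radially_lipschitz G ->
  radially_lipschitz (fun X => F X * G X).
Proof.
move=> [L L0 [FL FD]] [M M0 [GM GD]]; exists (L * M + L * M); first by rewrite addr_ge0// mulr_ge0.
have LM : 0 <= L * M by exact: mulr_ge0.
split=> X XB.
  by rewrite normrM (@le_trans _ _ (L * M)) ?lerDl// ler_pM// ?FL ?GM.
have -> : F X * G X - F (directions X) * G (directions X) =
    F X * (G X - G (directions X)) + (F X - F (directions X)) * G (directions X) by ring.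
rewrite (le_trans (ler_normD _ _))// !normrM mulrDl lerD//.
  by rewrite -mulrA ler_pM// ?FL ?GD.
by rewrite mulrAC ler_pM// ?FD ?GM//; exact: in_balls_directions.
Qed.

Lemma radially_lipschitz_sum (I : Type) (r : seq I) (F : I -> points -> R) :
  (forall i, radially_lipschitz (F i)) -> radially_lipschitz (fun X => \sum_(i <- r) F i X).
Proof.
move=> FL; elim: r => [|i r IH].
  by under eq_fun do rewrite big_nil; exact: radially_lipschitz_cst.
by under eq_fun do rewrite big_cons; exact: radially_lipschitzD.
Qed.

Lemma radially_lipschitz_prod (I : Type) (r : seq I) (F : I -> points -> R) :
  (forall i, radially_lipschitz (F i)) -> radially_lipschitz (fun X => \prod_(i <- r) F i X).
Proof.
move=> FL; elim: r => [|i r IH].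
  by under eq_fun do rewrite big_nil; exact: radially_lipschitz_cst.
by under eq_fun do rewrite big_cons; exact: radially_lipschitzM.
Qed.

Definition radially_lipschitz_mx a b (M : points -> 'M[R]_(a, b)) :=
  forall i j, radially_lipschitz (fun X => M X i j).

Lemma radially_lipschitz_mulmx a b c (M : points -> 'M[R]_(a, b)) (M' : points -> 'M[R]_(b, c)) :
  radially_lipschitz_mx M -> radially_lipschitz_mx M' ->
  radially_lipschitz_mx (fun X => M X *m M' X).
Proof.
move=> ML M'L i j; under eq_fun do rewrite mxE; apply: radially_lipschitz_sum => l.
exact: radially_lipschitzM.
Qed.

Lemma radially_lipschitz_tr a b (M : points -> 'M[R]_(a, b)) :
  radially_lipschitz_mx M -> radially_lipschitz_mx (fun X => (M X)^T).
Proof. by move=> ML i j; under eq_fun do rewrite mxE; exact: ML. Qed.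

Lemma radially_lipschitz_det a (M : points -> 'M[R]_a) :
  radially_lipschitz_mx M -> radially_lipschitz (fun X => \det (M X)).
Proof.
move=> ML; apply: radially_lipschitz_sum => s; apply: radially_lipschitzM.
  exact: radially_lipschitz_cst.
by apply: radially_lipschitz_prod => i; exact: ML.
Qed.

Lemma radially_lipschitz_adj a (M : points -> 'M[R]_a) :
  radially_lipschitz_mx M -> radially_lipschitz_mx (fun X => \adj (M X)).
Proof.
move=> ML i j; under eq_fun do rewrite mxE /cofactor; apply: radially_lipschitzM.
  exact: radially_lipschitz_cst.
by apply: radially_lipschitz_det => k l; under eq_fun do rewrite !mxE; exact: ML.
Qed.

End radial_lipschitz.

Lemma radially_lipschitz_coef_num {R : realType} d q (g : 'rV[R]_d) i :
  radially_lipschitz (fun X : q.+1.-tuple (coordinates R d) => coef_num g (diffs X) 0 i).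
Proof.
have dL : radially_lipschitz_mx (fun X : q.+1.-tuple (coordinates R d) => diffs X).
  move=> a b; have -> : (fun X : q.+1.-tuple (coordinates R d) => diffs X a b) =
      (fun X => tnth (tnth X (lift ord0 a)) b + (-1) * tnth (tnth X ord0) b).
    by apply/funext => X; rewrite /diffs /shift_rows !mxE big_ord1 !mxE !tnth_mktuple mul1r mulN1r.
  apply: radially_lipschitzD; first exact: radially_lipschitz_coord.
  by apply: radially_lipschitzM; [exact: radially_lipschitz_cst|exact: radially_lipschitz_coord].
have gL : radially_lipschitz_mx (fun X : q.+1.-tuple (coordinates R d) => g).
  by move=> a b; exact: radially_lipschitz_cst.
have GL := radially_lipschitz_mulmx dL (radially_lipschitz_tr dL).
have NL := radially_lipschitz_mulmx (radially_lipschitz_mulmx gL (radially_lipschitz_tr dL))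
  (radially_lipschitz_adj GL).
have -> : (fun X : q.+1.-tuple (coordinates R d) => coef_num g (diffs X) 0 i) =
    (fun X => \det (diffs X *m (diffs X)^T) * (g *m (diffs X)^T *m \adj (diffs X *m (diffs X)^T)) 0 i).
  by apply/funext => X; rewrite /coef_num mxE.
by apply: radially_lipschitzM; [exact: radially_lipschitz_det|exact: NL].
Qed.

Lemma sign_change_norm {R : realDomainType} (a b : R) :
  (0 <= a) != (0 <= b) -> `|b| <= `|a - b|.
Proof.
case: (lerP 0 a) => a0; case: (lerP 0 b) => b0 // _.
  by rewrite ltr0_norm// ler_normr lerDr a0.
by rewrite distrC ger0_norm// ler_normr lerDl oppr_ge0 (ltW a0).
Qed.

Lemma dist_le1 {R : realDomainType} (a b : R) :
  0 <= a <= 1 -> 0 <= b <= 1 -> `|a - b| <= 1.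
Proof. by move=> /andP[a1 a2] /andP[b1 b2]; rewrite ler_norml; apply/andP; split; lra. Qed.

Lemma eq_pos_coefs {R : realType} m d (g : 'rV[R]_d) k (A B : 'M[R]_(m, d)) :
  (forall i, (0 <= coef_num g A 0 i) = (0 <= coef_num g B 0 i)) ->
  pos_coefs g k A = pos_coefs g k B.
Proof. by move=> h; rewrite !pos_coefsE; apply: eq_bigr => i _; rewrite h. Qed.

(** * Passing to the sphere *)

Section sphere_limit.
Context {R : realType}.
Local Open Scope ereal_scope.
Variables (q k : nat).
Let d := q.+1.
Hypothesis q0 : (0 < q)%N.
Variable g : 'rV[R]_d.
Hypothesis g0 : g != 0%R.
Notation sigma := (@sphere_law R d).
Let phi (X : q.+2.-tuple (coordinates R d)) : R := pos_coefs g k (diffs X).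
Let Q (i : 'I_d) (X : q.+2.-tuple (coordinates R d)) : R := (coef_num g (diffs X) 0 i)%R.
Let small (e : R) (X : q.+2.-tuple (coordinates R d)) : R := (\sum_i (`|Q i X| <= e)%R%:R)%R.

Let mphi : measurable_fun setT phi.
Proof. by apply: measurable_pos_coefs; apply: measurable_diffs; mfun. Qed.

Let mQ i : measurable_fun setT (Q i).
Proof. by apply: measurable_coef_num; apply: measurable_diffs; mfun. Qed.

Let phi01 X : (0 <= phi X <= 1)%R.
Proof. by rewrite pos_coefs_ge0 pos_coefs_le1. Qed.

Let msmall1 e i : measurable_fun setT (fun X => (`|Q i X| <= e)%R).
Proof.
apply: measurable_fun_ler; last exact: measurable_cst.
by apply: measurableT_comp; [exact: normr_measurable|exact: mQ].
Qed.

Let msmall e : measurable_fun setT (small e).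
Proof. by apply: measurable_sum => i; apply: measurable_fun_nat_of_bool; exact: msmall1. Qed.

Let small_ge0 e X : (0 <= small e X)%R.
Proof. exact: sumr_ge0. Qed.

(** A sample is compared with its own directions. If [phi] differs, then either the total defect is
    at least delta, or a polynomial changes sign while moving by at most L delta, hence is that
    small at the directions. The term [total_defect X / delta] is the pointwise form of Markov's
    inequality. *)
Let coupling : exists2 L : R, (0 <= L)%R & forall X (delta : R), (0 < delta)%R -> (delta <= 1)%R ->
  (`|phi X - phi (directions X)| <= small (L * delta) (directions X) + total_defect X / delta)%R.
Proof.
have Qlip (i : 'I_d) : exists L : R, (0 <= L)%R /\
    forall X, in_balls X -> (`|Q i X - Q i (directions X)| <= L * total_defect X)%R.
  by have [L L0 [_ LQ]] := @radially_lipschitz_coef_num R d q.+1 g i; exists L.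
have [L HL] := choice Qlip.
exists (\sum_i L i)%R; first by apply: sumr_ge0 => i _; have [] := HL i.
move=> X delta delta0 delta1.
have b1 : (`|phi X - phi (directions X)| <= 1)%R.
  exact: dist_le1 (phi01 X) (phi01 (directions X)).
have [Sd|Sd] := leP delta (total_defect X).
  apply: (le_trans b1); apply: ler_wpDl; first exact: small_ge0.
  by rewrite ler_pdivlMr// mul1r.
have XB : in_balls X.
  move=> i; have e0 : (0 <= enorm (row_of (tnth X i)))%R by exact: sqrtr_ge0.
  rewrite -(@ler_pXn2r _ 2) ?nnegrE// expr1n enorm_sqr leNgt; apply/negP => h.
  have : (1 <= total_defect X)%R.
    rewrite /total_defect (bigD1 i)//= /defect ltNge (ltW h)/= lerDl.
    by apply: sumr_ge0 => j _; exact: defect_ge0.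
  by move=> S1; have := lt_le_trans Sd (le_trans delta1 S1); rewrite ltxx.
have [->|phiN] := eqVneq (phi X) (phi (directions X)).
  rewrite subrr normr0 addr_ge0 ?small_ge0// divr_ge0 ?(ltW delta0)//; exact: total_defect_ge0.
have [i Qi] : exists i : 'I_d, (0 <= Q i X)%R != (0 <= Q i (directions X))%R.
  apply/existsP; apply: contraNT phiN; rewrite negb_exists => /forallP h.
  by apply/eqP; apply: eq_pos_coefs => i; have := h i; rewrite negbK => /eqP.
have QL : (`|Q i (directions X)| <= (\sum_j L j) * delta)%R.
  have [Li0 Li] := HL i; have LiS : (L i <= \sum_j L j)%R.
    by rewrite (bigD1 i)//= lerDl sumr_ge0// => j _; have [] := HL j.
  apply: (@le_trans _ _ (L i * total_defect X)%R); last first.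
    by rewrite ler_pM// ?total_defect_ge0// ltW.
  by apply: le_trans (Li X XB); exact: sign_change_norm.
apply: (le_trans b1); apply: ler_wpDr; first by rewrite divr_ge0 ?total_defect_ge0// ltW.
by rewrite /small (bigD1 i)//= QL lerDl; exact: sumr_ge0.
Qed.

Let sigma_no : charges_no_hyperplane sigma.
Proof. by apply: sphere_law_no_hyperplane; rewrite ltnS. Qed.

Let sigmaT : sigma setT = 1. Proof. exact: sphere_lawT. Qed.

Let powerT : power_measure sigma q.+2 setT = 1.
Proof. exact: power_measureT. Qed.

Let t (e : R) : R := fine (\int[power_measure sigma q.+2]_X (small e X)%:E).

Let tE e : (t e)%:E = \int[power_measure sigma q.+2]_X (small e X)%:E.
Proof.
rewrite /t fineK// ge0_fin_numE; last by apply: integral_ge0 => X _; rewrite lee_fin small_ge0.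
apply: (@le_lt_trans _ _ (\int[power_measure sigma q.+2]_X (cst d%:R%:E X))).
  apply: ge0_le_integral_nonmeasurable => X; rewrite lee_fin ?small_ge0//.
  rewrite /small -[X in X%:R](card_ord d) -sum1_card natr_sum.
  by apply: ler_sum => i _; rewrite lern1 leq_b1.
by rewrite integral_cst// (_ : _ setT = 1) ?mule1 ?ltry//; exact: powerT.
Qed.

Let small_le e X : (small e X <= d%:R)%R.
Proof.
rewrite /small -[X in X%:R](card_ord d) -sum1_card natr_sum.
by apply: ler_sum => i _; rewrite lern1 leq_b1.
Qed.

(** The number of small coefficients converges pointwise to the number of vanishing ones, which is
    almost surely 0, and is bounded by d. *)
Let t_cvg0 (L : R) : (0 <= L)%R -> t (L * harmonic m)%R @[m --> \oo] --> (0 : R)%R.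
Proof.
move=> L0; pose f X : R := (\sum_i (Q i X == 0)%R%:R)%R.
have mQ0 i : measurable_fun setT (fun X => (Q i X == 0)%R).
  by apply: measurable_fun_eqr => //; exact: mQ.
have f0 : \int[power_measure sigma q.+2]_X (f X)%:E = 0.
  under eq_integral do rewrite /f -sumEFin.
  rewrite ge0_integral_sum//; last first.
    by move=> i; apply/measurable_EFinP; apply: measurable_fun_nat_of_bool.
  by rewrite big1// => i _; exact: power_measure_coef_num.
have m1 m : measurable_fun setT (fun X => (small (L * harmonic m) X)%:E).
  by apply/measurable_EFinP; exact: msmall.
have mf : measurable_fun setT (fun X => (f X)%:E).
  by apply/measurable_EFinP; apply: measurable_sum => i; apply: measurable_fun_nat_of_bool; exact: mQ0.
have Lh : (L * harmonic m)%R @[m --> \oo] --> (0 : R)%R.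
  by rewrite -[X in _ --> X](mulr0 L); apply: cvgM; [exact: cvg_cst|exact: cvg_harmonic].
have ptw X : (small (L * harmonic m) X)%:E @[m --> \oo] --> (f X)%:E.
  apply: cvg_EFin; first by near=> m.
  apply: cvg_big => [|i _]; first exact: add_continuous.
  apply: cvg_near_cst.
  have [->|Qi] := eqVneq (Q i X) 0%R.
    by near=> m; rewrite normr0 mulr_ge0// harmonic_ge0.
  have Qp : (0 < `|Q i X|)%R by rewrite normr_gt0.
  have : \forall m \near \oo, (L * harmonic m < `|Q i X|)%R by exact: (cvgr_lt _ Lh).
  by apply: filterS => m h; rewrite leNgt h.
have gi : (power_measure sigma q.+2).-integrable setT (cst d%:R%:E).
  apply/integrableP; split => //; rewrite integral_cst// (_ : _ setT = 1); last exact: powerT.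
  by rewrite mule1 ltry.
have dom m X : `|(small (L * harmonic m) X)%:E| <= cst d%:R%:E X.
  by rewrite /= lee_fin ger0_norm ?small_ge0 ?small_le.
have [_ _ cv] := @dominated_convergence _ _ _ (power_measure sigma q.+2) setT measurableT
  (fun m X => (small (L * harmonic m) X)%:E) (fun X => (f X)%:E) (cst d%:R%:E) m1 mf
  (aeW _ (fun X _ => ptw X)) gi (aeW _ (fun X m _ => dom m X)).
move: cv; rewrite f0 => cv; apply: (@fine_cvg _ _ _ _ _ 0%R).
by move: cv; apply: cvg_trans; apply: near_eq_cvg; near=> m; rewrite /= -tE.
Unshelve. all: by end_near.
Qed.

(** The error has a term for small coefficients, with threshold governed by m, and a defect term
    [C m * harmonic N]. Letting N tend to infinity for fixed m removes the second, and then m the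
    first. *)
Lemma face_prob_sphere_limit (A : R) :
  face_prob (beta_seq N : R) g k q.+2 @[N --> \oo] --> A ->
  \int[power_measure sigma q.+2]_X (pos_coefs g k (diffs X))%:E = A%:E.
Proof.
move=> aA; have [L L0 coup] := coupling.
have d1 : (1 < d)%N by rewrite ltnS.
have [K K0 cK] := @beta_const_seq R d d1.
have c0 : (0 < beta_const d 0 :> R)%R by rewrite beta_const_gt0 ?ltrN10.
pose mu N := beta_law d (beta_seq N : R).
have mdir : measurable_fun setT (@direction R d) by exact: measurable_direction.
have mdirs : measurable_fun setT (fun X : q.+2.-tuple (coordinates R d) => directions X).
  apply/measurable_fun_tnthP => i; rewrite /comp; under eq_fun do rewrite tnth_mktuple.
  by apply: (measurableT_comp mdir); exact: measurable_tnth.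
(* The directions of a beta sample form the same spherical sample in law for every N, so [b] below
   does not depend on N. *)
have push N (F : q.+2.-tuple (coordinates R d) -> \bar R) : measurable_fun setT F -> (forall X, 0 <= F X) ->
    \int[power_measure (mu N) q.+2]_X F (directions X) = \int[power_measure sigma q.+2]_X F X.
  move=> mF F0; apply: integral_power_pushforward => // h mh h0.
  by apply: integral_beta_law_direction => //; exact: beta_seq_gtN1.
have mdef : measurable_fun setT (fun x : coordinates R d => (defect (row_of x))%:E).
  by apply/measurable_EFinP; apply: measurable_defect; mfunx.
have defT N : \int[power_measure (mu N) q.+2]_X (total_defect X)%:E <= (q.+2%:R * K / beta_const d 0 * harmonic N)%:E.
  under eq_integral do rewrite /total_defect -sumEFin.
  rewrite ge0_integral_sum//; last 2 first.
  - by move=> i; apply/measurable_EFinP; apply: measurable_defect; mfunx.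
  - by move=> i X _; rewrite lee_fin defect_ge0.
  apply: (@le_trans _ _ (\sum_(i < q.+2) (K / beta_const d 0 * harmonic N)%:E)); last first.
    by rewrite sumEFin lee_fin sumr_const card_ord -[leLHS]mulr_natl !mulrA.
  apply: lee_sum => i _.
  have := @integral_power_reindex _ _ _ (mu N) 1 q.+2 (fun=> i) (fun X => (defect (row_of (thead X)))%:E).
  move=> E; have -> : \int[power_measure (mu N) q.+2]_X (defect (row_of (tnth X i)))%:E = \int[mu N]_x (defect (row_of x))%:E.
    transitivity (\int[power_measure (mu N) q.+2]_X (defect (row_of (thead (reindex_tuple (fun _ : 'I_1 => i) X))))%:E).
      by apply: eq_integral => X _; rewrite /thead tnth_mktuple.
    rewrite E; last 4 first.
    - exact/beta_lawT/beta_seq_gtN1.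
    - by move=> a b _; rewrite [a]ord1 [b]ord1.
    - by apply: (measurableT_comp mdef); apply: measurable_thead; mfun.
    - by move=> X; rewrite lee_fin defect_ge0.
    rewrite integral_power_cons; last 2 first.
    - by apply: (measurableT_comp mdef); apply: measurable_thead; mfun.
    - by move=> X; rewrite lee_fin defect_ge0.
    apply: eq_integral => x _; rewrite integral_power0; first by rewrite theadE.
    by apply: (measurableT_comp mdef); apply: measurable_thead; exact: measurable_cons.
  apply: (le_trans (integral_defect d (beta_seq_gtN1 N))); rewrite lee_fin.
  by rewrite [leRHS]mulrAC ler_pM2r ?invr_gt0//; exact: cK.
pose b : R := fine (\int[power_measure sigma q.+2]_X (phi X)%:E).
have bE : b%:E = \int[power_measure sigma q.+2]_X (phi X)%:E.
  rewrite fineK// ge0_fin_numE; last by apply: integral_ge0 => X _; have /andP[] := phi01 X.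
  apply: (@le_lt_trans _ _ (\int[power_measure sigma q.+2]_X (cst 1 X))).
    by apply: ge0_le_integral_nonmeasurable => X; have /andP[] := phi01 X.
  by rewrite integral_cst// (_ : _ setT = 1) ?mule1 ?ltry//; exact: powerT.
rewrite -/phi -bE; congr (_%:E).
(* The bound [defT] divided by delta = [harmonic m], up to the factor [harmonic N]. *)
pose C m : R := (q.+2%:R * K / beta_const d 0 * m.+1%:R)%R.
have mtd : measurable_fun setT (fun X : q.+2.-tuple (coordinates R d) => total_defect X).
  by apply: measurable_sum => i; apply: measurable_defect; mfunx.
have err N m : \int[power_measure (mu N) q.+2]_X (small (L * harmonic m) (directions X) + total_defect X / harmonic m)%:E
    <= (t (L * harmonic m) + C m * harmonic N)%:E.
  under eq_integral do rewrite EFinD.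
  rewrite ge0_integralD//; last 4 first.
  - by move=> X _; rewrite lee_fin small_ge0.
  - by apply/measurable_EFinP; exact: (measurableT_comp (msmall _) mdirs).
  - by move=> X _; rewrite lee_fin divr_ge0 ?total_defect_ge0 ?harmonic_ge0.
  - by apply/measurable_EFinP; apply: measurable_funM.
  rewrite (push N (fun X => (small (L * harmonic m) X)%:E)); last 2 first.
  - by apply/measurable_EFinP; exact: msmall.
  - by move=> X; rewrite lee_fin small_ge0.
  rewrite -tE [leRHS]EFinD leeD2l//.
  under eq_integral do rewrite mulrC EFinM.
  rewrite ge0_integralZl//; last 3 first.
  - by apply/measurable_EFinP.
  - by move=> X _; rewrite lee_fin total_defect_ge0.
  - by rewrite lee_fin invr_ge0 harmonic_ge0.
  rewrite /C /harmonic invrK.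
  apply: (@le_trans _ _ (m.+1%:R%:E * (q.+2%:R * K / beta_const d 0 * harmonic N)%:E)).
    by apply: lee_wpmul2l => //; exact: defT.
  by rewrite -EFinM lee_fin mulrA [X in (X * _ <= _)%R]mulrC.
have hm1 m : (harmonic m <= 1 :> R)%R by rewrite /harmonic invf_le1 ?ltr0n// ler1n.
have hm0 m : (0 < harmonic m :> R)%R by exact: harmonic_gt0.
have mphid : measurable_fun setT (fun X => phi (directions X)) by exact: (measurableT_comp mphi mdirs).
have merr m : measurable_fun setT (fun X => small (L * harmonic m) (directions X) + total_defect X / harmonic m)%R.
  by apply: measurable_funD; [exact: (measurableT_comp (msmall _) mdirs)|exact: measurable_funM].
have err0 m X : (0 <= small (L * harmonic m) (directions X) + total_defect X / harmonic m)%R.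
  by rewrite addr_ge0 ?small_ge0// divr_ge0 ?total_defect_ge0 ?harmonic_ge0.
have phi0 X : (0 <= phi X)%R by have /andP[] := phi01 X.
have aE N : (face_prob (beta_seq N) g k q.+2)%:E = \int[power_measure (mu N) q.+2]_X (phi X)%:E.
  by rewrite face_probE// beta_seq_gtN1.
have bN N : b%:E = \int[power_measure (mu N) q.+2]_X (phi (directions X))%:E.
  apply: (etrans bE); apply/esym/(push N (fun X => (phi X)%:E)); last by move=> X; rewrite lee_fin.
  by apply/measurable_EFinP; exact: mphi.
have up N m : (face_prob (beta_seq N) g k q.+2 <= b + (t (L * harmonic m) + C m * harmonic N))%R.
  rewrite -lee_fin EFinD (bN N) (aE N).
  apply: le_trans; last by apply: leeD2l; exact: (err N m).
  rewrite -ge0_integralD//; last 4 first.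
  - by move=> X _; rewrite lee_fin.
  - by apply/measurable_EFinP; exact: mphid.
  - by move=> X _; rewrite lee_fin.
  - by apply/measurable_EFinP; exact: merr.
  apply: ge0_le_integral_nonmeasurable => X; first by rewrite lee_fin phi0.
  rewrite -EFinD lee_fin -lerBlDl.
  exact: le_trans (ler_norm _) (coup X _ (hm0 m) (hm1 m)).
have dn N m : (b <= face_prob (beta_seq N) g k q.+2 + (t (L * harmonic m) + C m * harmonic N))%R.
  rewrite -lee_fin EFinD (bN N) (aE N).
  apply: le_trans; last by apply: leeD2l; exact: (err N m).
  rewrite -ge0_integralD//; last 4 first.
  - by move=> X _; rewrite lee_fin.
  - by apply/measurable_EFinP; exact: mphi.
  - by move=> X _; rewrite lee_fin.
  - by apply/measurable_EFinP; exact: merr.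
  apply: ge0_le_integral_nonmeasurable => X; first by rewrite lee_fin phi0.
  rewrite -EFinD lee_fin -lerBlDl.
  by apply: le_trans (coup X _ (hm0 m) (hm1 m)); rewrite distrC; exact: ler_norm.
clear - up dn aA L0 t_cvg0.
have hC m : (t (L * harmonic m) + C m * harmonic N)%R @[N --> \oo] --> t (L * harmonic m)%R.
  rewrite -[X in _ --> X]addr0 -[X in (_ + X)%R](mulr0 (C m)).
  by apply: cvgD; [exact: cvg_cst|apply: cvgM; [exact: cvg_cst|exact: cvg_harmonic]].
have upA m : (A <= b + t (L * harmonic m))%R.
  apply: (ler_cvg_to aA (cvgD (cvg_cst b) (hC m))); by near=> N; exact: up.
have dnA m : (b <= A + t (L * harmonic m))%R.
  apply: (ler_cvg_to (cvg_cst b) (cvgD aA (hC m))); by near=> N; exact: dn.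
have tc (x : R) : (x + t (L * harmonic m))%R @[m --> \oo] --> x.
  by rewrite -[X in _ --> X]addr0; apply: cvgD; [exact: cvg_cst|exact: t_cvg0].
apply/eqP; rewrite eq_le; apply/andP; split.
  by apply: (ler_cvg_to (cvg_cst b) (tc A)); near=> m; exact: dnA.
by apply: (ler_cvg_to (cvg_cst A) (tc b)); near=> m; exact: upA.
Unshelve. all: by end_near.
Qed.

End sphere_limit.

(** * Continuity of the marginal densities in their parameter *)

Section marginal_continuity.
Context {R : realType}.
Local Open Scope ereal_scope.
Notation leb := (@lebesgue_measure R).

Lemma cvg_pospow (gam : nat -> R) (gam0 r : R) :
  gam N @[N --> \oo] --> gam0 -> (pospow (gam N) r)%R @[N --> \oo] --> (pospow gam0 r)%R.
Proof.
move=> gc; have [r0|r0] := ltP 0%R r; last first.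
  by rewrite pospow_le0//; under eq_fun do rewrite pospow_le0//; exact: cvg_cst.
rewrite pospow_gt0E//; under eq_fun do rewrite pospow_gt0E//.
rewrite /powR gt_eqF//; apply: continuous_cvg; first exact: continuous_expR.
by apply: cvgM => //; exact: cvg_cst.
Qed.

(** alpha >= 0 corresponds to gam >= -1/2, and the integrable arcsine weight (1 - t^2)^(-1/2)
    dominates all of these. *)
Lemma pospow_le_inv_sqrt (gam r : R) : (- 2^-1 <= gam)%R -> (r <= 1)%R ->
  (pospow gam r <= pospow (- 2^-1) r)%R.
Proof.
move=> g1 r1; have [r0|r0] := ltP 0%R r; last by rewrite !pospow_le0.
by rewrite !pospow_gt0E//; exact: powR_le1_anti.
Qed.

Variables (gam : nat -> R) (gam0 : R).
Hypotheses (gam_ge : forall N, (- 2^-1 <= gam N)%R) (gam0_ge : (- 2^-1 <= gam0)%R).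
Hypothesis gam_cvg : gam N @[N --> \oo] --> gam0.

Let gt_half (x : R) : (- 2^-1 <= x)%R -> (-1 < x)%R.
Proof. lra. Qed.

(** The factor [w] may vary with N because in [Ink] it is a power of a distribution function that
    depends on alpha. *)
Lemma cvg_integral_pospow (w : nat -> R -> R) (w0 : R -> R) :
  (forall N, measurable_fun setT (w N)) -> measurable_fun setT w0 ->
  (forall N t, (0 <= w N t <= 1)%R) -> (forall t, w N t @[N --> \oo] --> w0 t) ->
  fine (\int[leb]_t (w N t * pospow (gam N) (1 - t ^+ 2))%:E) @[N --> \oo] -->
  fine (\int[leb]_t (w0 t * pospow gam0 (1 - t ^+ 2))%:E).
Proof.
move=> mw mw0 w01 wc.
have mp (x : R) : measurable_fun setT (fun t : R => pospow x (1 - t ^+ 2)%R).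
  by apply: measurable_pospow; mfun.
pose D (t : R) := (pospow (- 2^-1) (1 - t ^+ 2))%:E.
have D0 t : 0 <= D t by rewrite lee_fin pospow_ge0.
have gi : leb.-integrable setT D.
  apply/integrableP; split; first by apply/measurable_EFinP; exact: mp.
  under eq_integral do rewrite gee0_abs//.
  by rewrite integral_pospow1 ?ltry//; lra.
have ptw t : (w N t * pospow (gam N) (1 - t ^+ 2))%:E @[N --> \oo] --> (w0 t * pospow gam0 (1 - t ^+ 2))%:E.
  apply: cvg_EFin; first by near=> N.
  by apply: cvgM; [exact: wc|exact: cvg_pospow].
have dom N t : `|(w N t * pospow (gam N) (1 - t ^+ 2))%:E| <= D t.
  have /andP[a1 a2] := w01 N t.
  rewrite lee_fin ger0_norm ?(mulr_ge0 a1 (pospow_ge0 _ _))//.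
  apply: (@le_trans _ _ (1 * pospow (gam N) (1 - t ^+ 2))%R); first by rewrite ler_wpM2r ?pospow_ge0.
  by rewrite mul1r pospow_le_inv_sqrt// gerBl sqr_ge0.
have mfN N : measurable_fun setT (fun t => (w N t * pospow (gam N) (1 - t ^+ 2))%:E).
  by apply/measurable_EFinP; exact: measurable_funM.
have mf0 : measurable_fun setT (fun t => (w0 t * pospow gam0 (1 - t ^+ 2))%:E).
  by apply/measurable_EFinP; exact: measurable_funM.
have [||i0 _ cv] := @dominated_convergence _ _ _ leb setT measurableT
  (fun N t => (w N t * pospow (gam N) (1 - t ^+ 2))%:E) _ D mfN mf0 _ gi _.
- by apply: aeW => t _; exact: ptw.
- by apply: aeW => t N _; exact: dom.
apply: fine_cvg; rewrite fineK//; exact: integrable_fin_num i0.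
Unshelve. all: by end_near.
Qed.

(** The constant is the inverse of the integral of the unnormalized density, so dominated
    convergence takes the place of continuity of Gamma. *)
Lemma cvg_beta_const1 : beta_const 1 (gam N) @[N --> \oo] --> beta_const 1 gam0.
Proof.
have E (x : R) : (- 2^-1 <= x)%R ->
    beta_const 1 x = (fine (\int[leb]_t (1 * pospow x (1 - t ^+ 2))%:E))^-1%R.
  by move=> h; under eq_integral do rewrite mul1r; rewrite integral_pospow1 ?gt_half//= invrK.
rewrite E//; under eq_fun do rewrite E//.
apply: cvgV; first by rewrite -[X in X != _]invrK -E// invr_eq0 gt_eqF// beta_const_gt0// gt_half.
apply: (cvg_integral_pospow (w := fun _ _ => 1%R) (w0 := fun=> 1%R)) => //.
- by move=> _ _; rewrite ler01 lexx.
- by move=> t; exact: cvg_cst.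
Qed.

Lemma cvg_integral_marginal_density (w : nat -> R -> R) (w0 : R -> R) :
  (forall N, measurable_fun setT (w N)) -> measurable_fun setT w0 ->
  (forall N t, (0 <= w N t <= 1)%R) -> (forall t, w N t @[N --> \oo] --> w0 t) ->
  fine (\int[leb]_t (w N t * marginal_density (gam N) t)%:E) @[N --> \oo] -->
  fine (\int[leb]_t (w0 t * marginal_density gam0 t)%:E).
Proof.
move=> mw mw0 w01 wc.
have w00 t : (0 <= w0 t)%R.
  by apply: (ler_cvg_to (cvg_cst 0%R) (wc t)); near=> N; have /andP[] := w01 N t.
have E (x : R) (f : R -> R) : (- 2^-1 <= x)%R -> measurable_fun setT f -> (forall t, (0 <= f t)%R) ->
    fine (\int[leb]_t (f t * marginal_density x t)%:E) =
    (beta_const 1 x * fine (\int[leb]_t (f t * pospow x (1 - t ^+ 2))%:E))%R.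
  move=> h mf f0; under eq_integral do rewrite mulrCA EFinM.
  rewrite ge0_integralZl//; last 3 first.
  - by apply/measurable_EFinP; apply: measurable_funM => //; apply: measurable_pospow; mfun.
  - by move=> t _; rewrite lee_fin mulr_ge0 ?pospow_ge0.
  - by rewrite lee_fin ltW// beta_const_gt0// gt_half.
  have := beta_const_gt0 1 (gt_half h); move: (beta_const _ _) => c c0.
  (* Should the integral be infinite, [fine] makes both sides 0. *)
  case: (\int[leb]_t _) => [r| |]; rewrite -?EFinM//=.
    by rewrite gt0_muley ?lte_fin//= mulr0.
  by rewrite gt0_muleNy ?lte_fin//= mulr0.
rewrite E//.
rewrite (_ : (fun N => _) = fun N => (beta_const 1 (gam N) *
    fine (\int[leb]_t (w N t * pospow (gam N) (1 - t ^+ 2))%:E))%R); last first.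
  by apply/funext => N; rewrite E// => t; have /andP[] := w01 N t.
by apply: cvgM; [exact: cvg_beta_const1|exact: cvg_integral_pospow].
Unshelve. all: by end_near.
Qed.

Lemma cvg_marginal_cdf (h : R) : marginal_cdf (gam N) h @[N --> \oo] --> marginal_cdf gam0 h.
Proof.
apply: (@cvg_integral_marginal_density (fun _ t => (t < h)%R%:R) (fun t => (t < h)%R%:R)).
- by move=> _; mfun.
- by mfun.
- by move=> _ t; case: (t < h)%R; rewrite lexx ler01.
- by move=> t; exact: cvg_cst.
Qed.

End marginal_continuity.

(** * Continuity of I and of the chain formula for alpha >= 0 *)

Section Ink_continuity.
Context {R : realType}.

Variables (alpha : nat -> R) (alpha0 : R).
Hypotheses (alpha_ge0 : forall N, 0 <= alpha N) (alpha0_ge0 : 0 <= alpha0).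
Hypothesis alpha_cvg : alpha N @[N --> \oo] --> alpha0.

Lemma cvg_Ink m s : Ink m s (alpha N) @[N --> \oo] --> Ink m s alpha0.
Proof.
have half (x : R) : - 2^-1 <= (x - 1) / 2 = (0 <= x) by apply/idP/idP; lra.
have gt_half (x : R) : 0 <= x -> -1 < (x - 1) / 2 by lra.
have E (a : R) : 0 <= a -> Ink m s a =
    fine (\int[lebesgue_measure]_t (marginal_cdf ((a - 1) / 2) t ^+ (m - s) *
      marginal_density ((a * s%:R - 1) / 2) t)%:E)%E.
  by move=> a0; rewrite -InkE//; [lra|rewrite (lt_le_trans (ltrN10 _))// mulr_ge0].
rewrite E//; under eq_fun do rewrite E//.
have half_cvg (u : nat -> R) (v : R) : u N @[N --> \oo] --> v ->
    (u N - 1) / 2 @[N --> \oo] --> (v - 1) / 2.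
  by move=> uv; apply: cvgM; [apply: cvgB => //; exact: cvg_cst|exact: cvg_cst].
apply: cvg_integral_marginal_density.
- by move=> N; rewrite half mulr_ge0.
- by rewrite half mulr_ge0.
- by apply: half_cvg; apply: cvgM => //; exact: cvg_cst.
- by move=> N; apply: measurable_funX; apply: measurable_marginal_cdf; exact: gt_half.
- by apply: measurable_funX; apply: measurable_marginal_cdf; exact: gt_half.
- move=> N t; rewrite exprn_ge0 ?marginal_cdf_ge0 ?gt_half//=.
  by rewrite exprn_ile1 ?marginal_cdf_ge0 ?marginal_cdf_le1 ?gt_half.
- move=> t; apply: (cvg_comp _ (fun x : R => x ^+ (m - s)) _ (@exprn_continuous R (m - s) _)).
  apply: cvg_marginal_cdf.
  + by move=> N; rewrite half.
  + by rewrite half.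
  + exact: half_cvg.
Qed.

Lemma cvg_chain_formula n k :
  chain_formula n k (alpha N) @[N --> \oo] --> chain_formula n k alpha0.
Proof.
have aN1 (a : R) : 0 <= a -> (a == -1) = false.
  by move=> a0; apply/negbTE; rewrite gt_eqF// (lt_le_trans _ a0)// ltrN10.
apply: cvg_big => [|l _]; first exact: add_continuous.
apply: cvgM; first exact: cvg_cst.
apply: cvg_big => [|nu _]; first exact: add_continuous.
apply: cvgM; last exact: cvg_cst.
apply: cvg_big => [|i _]; first exact: mul_continuous.
rewrite /bbI aN1// !andbF.
under eq_fun do rewrite aN1// !andbF.
by apply: cvgM; [exact: cvg_cst|exact: cvg_Ink].
Qed.

End Ink_continuity.

(** * The formula for beta = -1 *)

Section sphere_case.
Context {R : realType}.
Variables (p k : nat).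
Hypotheses (p2 : (2 <= p)%N) (k0 : (0 < k)%N) (kp : (k <= p)%N).

Let p0 : (0 < p)%N := ltnW p2.

Lemma beta_law_sphere d : beta_law d (-1) = sphere_law d :> (set (coordinates R d) -> \bar R).
Proof. by apply/funext => A; rewrite /beta_law eqxx. Qed.

Let integral_sphere_pos_coefs (g : 'rV[R]_p) : g != 0 ->
  (\int[power_measure (sphere_law p) p.+1]_X (pos_coefs g k (diffs X))%:E =
   (chain_formula p.+1 k (p%:R - 2) / 'C(p.+1, k)%:R)%:E)%E.
Proof.
case: p p2 kp p0 g => [//|[//|q]] _ kq q0 g g0.
apply: face_prob_sphere_limit => //.
(* Here p = q + 2, so alpha = p - 2 + 2/(N + 1) decreases to p - 2 and stays nonnegative because p
   >= 2. *)
have seqE N : 2 * beta_seq N + q.+2%:R = q%:R + 2 * harmonic N :> R.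
  by rewrite /beta_seq /harmonic/= -addn2 natrD; move: (N.+1%:R^-1) => x; ring.
have half_cvg : q%:R + 2 * harmonic N @[N --> \oo] --> (q.+2%:R - 2 : R).
  rewrite (_ : q.+2%:R - 2 = q%:R + 2 * 0 :> R); last by rewrite mulr0 addr0 -addn2 natrD addrK.
  by apply: cvgD; [exact: cvg_cst|apply: cvgM; [exact: cvg_cst|exact: cvg_harmonic]].
have kq' : (0 < k <= q.+2)%N by rewrite k0.
have faceE N : face_prob (beta_seq N) g k q.+3 =
    chain_formula q.+3 k (q%:R + 2 * harmonic N) / 'C(q.+3, k)%:R.
  by rewrite -seqE; exact: (@face_prob_chain_formula R q.+2 k (beta_seq N) g kq' (beta_seq_gtN1 N) g0).
under eq_fun do rewrite faceE.
apply: cvgM; last exact: cvg_cst.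
apply: (@cvg_chain_formula R (fun N => q%:R + 2 * harmonic N)) => //.
by move=> N; rewrite addr_ge0// mulr_ge0// harmonic_ge0.
Qed.

Lemma bbJ_sphere : bbJ p.+1 k (-1) = chain_formula p.+1 k (p%:R - 2) :> R.
Proof.
have C0 : 0 < 'C(p.+1, k)%:R :> R by rewrite ltr0n bin_gt0 leqW.
have bT : beta_law p (-1 : R) setT = 1%E by rewrite beta_law_sphere; exact: sphere_lawT.
have nh : charges_no_hyperplane (beta_law p (-1 : R)).
  by have := @sphere_law_no_hyperplane R p p2; rewrite /charges_no_hyperplane beta_law_sphere.
rewrite /bbJ ifF; last by rewrite eqSS (gtn_eqF p2).
rewrite (@Jnk_const _ p p0 k (-1) k0 kp bT nh (chain_formula p.+1 k (p%:R - 2) / 'C(p.+1, k)%:R)).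
  by rewrite mulrC divfK// gt_eqF.
move=> g g0; rewrite -(integral_sphere_pos_coefs g0).
by rewrite beta_law_sphere.
Qed.

End sphere_case.

(** The chains are 2 and 2 > 1; with the conventional value 1 of I they contribute 2 - 1. *)
Lemma chain_formula_degenerate {R : realType} : chain_formula 2 1 (-1 : R) = 1.
Proof.
rewrite /chain_formula big_ord_recl big_ord1 expr0 mul1r expr1 chain_sum0//.
rewrite chain_sumS// big_nat1 chain_sum0// /bbI /= eqxx /= bin1 bin1; ring.
Qed.

Theorem theorem2p2 (R : realType) (beta : R) (n k : nat)
    (hbeta : -1 <= beta) (hk : (1 <= k <= n)%N) :
  bbJ n k beta =
  \sum_(l < (n - k).+1) (-1) ^+ l *
    \sum_(nu : {ffun 'I_l.+1 -> 'I_n.+1} | decreasing_chain k nu)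
      (\prod_(i < l) bbI (nu (widen_ord (leqnSn l) i)) (nu (lift ord0 i))
                         (2 * beta + n%:R - 1)) *
      'C(nu ord_max, k)%:R.
Proof.
(* For m = N = n, [chain_from] and [decreasing_chain] are convertible. *)
change (bbJ n k beta = chain_formula n k (2 * beta + n%:R - 1)).
have /andP[k1 kn] := hk.
move: kn; rewrite leq_eqVlt => /orP[/eqP kn|].
  by have [JE cE] := bbJ_diag beta (leq_trans k1 (leqnn k)); rewrite -kn JE cE.
case: n hk => [//|p] _; rewrite ltnS => kp.
have -> : 2 * beta + p.+1%:R - 1 = 2 * beta + p%:R by rewrite -addn1 natrD; ring.
have kp' : (0 < k <= p)%N by rewrite k1.
move: hbeta; rewrite le_eqVlt => /orP[/eqP <-|b1]; last exact: bbJ_chain_formula.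
have -> : 2 * (-1) + p%:R = p%:R - 2 :> R by ring.
have [p2|] := leqP 2 p; first exact: bbJ_sphere.
(* Two points on the sphere {-1, 1} of the line remain, the degenerate case, in which the left side
   is 1 by convention. *)
rewrite ltnS => p1; have k1' : k = 1%N by apply/eqP; rewrite eqn_leq k1 (leq_trans kp).
have p1' : p = 1%N by apply/eqP; rewrite eqn_leq p1 (leq_trans k1).
rewrite p1' k1' (_ : 1%:R - 2 = -1); last by rewrite /=; ring.
by rewrite chain_formula_degenerate /bbJ !eqxx.
Qed.
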